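(* Let $x,y,z\in\mathbb{C}^*$ with $|q|<|x|<1$, $|q|<|y|<1$ and $|q|<|z|<1$. Then $$\begin{aligned} \sum_{\substack{\mathrm{sg}(r)=\mathrm{sg}(s)=\mathrm{sg}(t)\\ r\equiv s\not\equiv t\ (\mathrm{mod}\ 2)}}q^{rs+rt+st}x^ry^sz^t &=z\,\frac{J_4^3j(q^2y^2z^2;q^4)}{j(q^2y^2;q^4)j(z^2;q^4)}\,m\Big(-\frac{qx}{yz},q^2,-qyz\Big)\\ &\quad+z\,\frac{J_4^3j(q^2x^2z^2;q^4)}{j(q^2x^2;q^4)j(z^2;q^4)}\,m\Big(-\frac{qy}{xz},q^2,-qxz\Big)\\ &\quad-z\,\frac{J_1^3J_2^3}{j(x;q)j(y;q)j(z;q)}\cdot\frac{j(xy;q^2)j(qxz;q^2)j(qyz;q^2)}{j(-xq;q^2)j(-yq;q^2)j(-z;q^2)}\\ &\quad-\frac{q}{xy}\cdot\frac{J_4^3j(x^2y^2;q^4)}{j(q^2x^2;q^4)j(q^2y^2;q^4)}\,m\Big(-\frac{qz}{xy},q^2,-xy\Big). \end{aligned}$$ If $yz=-q$ or $xz=-q$ (so that the corresponding $m$-function is undefined while its prefactor vanishes), the corresponding product is understood as its limiting value (removable singularity).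
   Context: $q$ is a fixed complex number with $0<|q|<1$, $\mathbb{C}^*=\mathbb{C}\setminus\{0\}$. $(x;q)_\infty=\prod_{i\ge0}(1-q^ix)$, $j(x;q)=(x;q)_\infty(q/x;q)_\infty(q;q)_\infty=\sum_{n\in\mathbb{Z}}(-1)^nq^{\binom n2}x^n$, and $J_m=\prod_{i\ge1}(1-q^{mi})$ for positive integers $m$. The Appell–Lerch function is $$m(x,q,z)=\frac1{j(z;q)}\sum_{r=-\infty}^{\infty}\frac{(-1)^rq^{\binom r2}z^r}{1-q^{r-1}xz}.$$ For an integer $r$, $\mathrm{sg}(r)=1$ if $r\ge0$ and $\mathrm{sg}(r)=-1$ if $r<0$. The sum on the left runs over integers $r,s,t$. *)

(* Defs.v *)
From HB Require Import structures.
From mathcomp Require Import all_boot all_order all_algebra.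
From mathcomp Require Import finmap complex.
From mathcomp Require Import all_classical all_reals all_analysis.
From mathcomp.analysis.showcase Require summability.
Set Implicit Arguments.
Unset Strict Implicit.
Unset Printing Implicit Defensive.
Import Order.TTheory GRing.Theory Num.Theory.
Import numFieldNormedType.Exports.
Local Open Scope classical_set_scope.
Local Open Scope ring_scope.

(* The norm topology is attached to an abstract [numClosedFieldType] by
   [numFieldNormedType.Exports]; it is not inferred on the bare type [R[i]],
   hence this packaged version of the complex numbers. *)
Definition cplx (R : realType) : numClosedFieldType := complex R.

Definition qpoch (K : numClosedFieldType) (x q : K) : K :=
  lim ((fun n : nat => \prod_(0 <= i < n) (1 - q ^+ i * x)) @ \oo).

Definition theta (K : numClosedFieldType) (x q : K) : K :=
  qpoch x q * qpoch (q / x) q * qpoch q q.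

Definition Jprod (K : numClosedFieldType) (q : K) (m : nat) : K :=
  lim ((fun n : nat => \prod_(1 <= i < n.+1) (1 - q ^+ (m * i))) @ \oo).

(* r (r - 1) / 2, an exact division, also for negative r *)
Definition binz2 (r : int) : int := ((r * (r - 1)) %/ 2)%Z.

(* The bilateral series is the limit of its finite partial sums along the
   directed set of finite subsets of [int] (unconditional summation). *)
Definition appell (K : numClosedFieldType) (x q z : K) : K :=
  (theta z q)^-1 *
  summability.sum (fun r : int =>
    ((-1) ^ r * q ^ binz2 r * z ^ r / (1 - q ^ (r - 1) * x * z) : K)).

Definition sg (r : int) : int := if 0 <= r then 1 else -1.

(* [v] is the value at [p] of [f], which is given by a formula meaningful on
   [D] only: at a point outside [D] it is the limit of [f] along [D]. Since
   division by zero is total, [f p] is not meaningful there. *)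
Definition ext_value (T : topologicalType) (K : numClosedFieldType)
    (D : set T) (f : T -> K) (p : T) (v : K) : Prop :=
  (D p -> v = f p) /\ (~ D p -> f @ within D (nbhs p) --> v).

(* Main.v *)
(* Write w = x y. Splitting r, s, t by parity turns the left-hand side into a Laurent series in z.
   Subtract from it the last Appell-Lerch term and multiply the difference by
   theta (q z) (q^2) * theta (z^2) (q^4); both the result and the product of the remaining three
   terms by the same factor then have Laurent coefficients satisfying one inhomogeneous recurrence,
   whose homogeneous part is v_(n+2) = q^(2n) w v_n. Its solution space is two-dimensional, so it
   suffices to compare the values at z = 1 and z = -1, where theta (z^2) (q^4) vanishes: the claim
   becomes an identity between two Lerch sums and a double sum over the quadrants, proved by
   rearranging lattice sums. The double sums are products of theta functions by Kronecker's
   identity, which is obtained by the same recurrence-and-evaluation argument.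
   The factor of the side terms which vanishes at y z = - q (or x z = - q) cancels against
   the theta function in the denominator of the Appell-Lerch function, leaving a continuous
   expression. *)
Require Import Defs.
From HB Require Import structures.
From mathcomp Require Import all_boot all_order all_algebra.
From mathcomp Require Import finmap complex ring lra zify.
From mathcomp Require Import all_classical all_reals all_analysis.
From mathcomp.analysis.showcase Require summability.
Set Implicit Arguments.
Unset Strict Implicit.
Unset Printing Implicit Defensive.
Import Order.TTheory GRing.Theory Num.Theory.
Import numFieldNormedType.Exports.
Local Open Scope classical_set_scope.
Local Open Scope ring_scope.

(** * Unconditional sums *)

(** The series in $z$ converge only for $|q|<|z|<1$, while the decisive points $\pm1$ lie on the
    boundary. Identities are therefore stated between coefficient sequences: convolving a rapidly
    decaying sequence with one of geometric growth always converges, so no function has to be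
    continued. The only part of the left-hand side singular at $z^2=1$, namely $z/(1-z^2)$, is split
    off; multiplied by [theta (z ^+ 2) (q ^+ 4)] it becomes an entire series with value $zJ_4^3$
    there. The recurrences express the dilation $z\mapsto q^2z$. Shifting the octants of summation
    leaves boundary terms: a double sum at $z^0$, Kronecker coefficients and a constant. The
    subtracted Appell-Lerch term is normalised so that its own jump at $n=0$ cancels the double sum;
    its other jump is a multiple of $q^n$. As bilateral sequences, the constant sits at $z^2=1$ and
    $q^n$ at $z=1/q$, zeros of the two theta factors; this explains their choice. The Kronecker
    coefficients turn into theta coefficients, which the other side produces as well. *)

Section Summation.
Variable R : realType.
Local Notation K := (cplx R).

(** The order on the complex numbers is partial, so [<=] forces the bound to be real. Bounding
    finite sums of moduli refers to no limit and passes directly to dominated families and along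
    injections. *)
Definition absum (I : choiceType) (f : I -> K) : Prop :=
  exists M : K, forall A : {fset I}, \sum_(i <- A) `|f i| <= M.

Definition tsum (I : choiceType) (f : I -> K) : K := summability.sum f.

Lemma partial_sumE (I : choiceType) (f : I -> K) (A : {fset I}) :
  summability.partial_sum f A = \sum_(i <- A) f i.
Proof. by rewrite /summability.partial_sum big_seq_fsetE. Qed.

Instance totally_proper (I : choiceType) : ProperFilter (@summability.totally I).
Proof. exact: summability.totally_filter. Qed.

Lemma cvg_totallyP (I : choiceType) (f : I -> K) (s : K) :
  (forall e : K, 0 < e -> exists A0 : {fset I}, forall A : {fset I},
     (A0 `<=` A)%fset -> `|s - \sum_(i <- A) f i| < e) <->
  summability.partial_sum f @ summability.totally --> s.
Proof.
split=> [H|H].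
  apply/cvgrPdist_lt => e e0; have [A0 HA] := H e e0.
  by exists A0 => // A /= sA; rewrite partial_sumE; exact: HA.
move=> e e0; move/cvgrPdist_lt : H => /(_ e e0)[A0 _ HA].
by exists A0 => A sA; rewrite -partial_sumE; exact: HA.
Qed.

Lemma tsum_unique (I : choiceType) (f : I -> K) (s : K) :
  (forall e : K, 0 < e -> exists A0 : {fset I}, forall A : {fset I},
     (A0 `<=` A)%fset -> `|s - \sum_(i <- A) f i| < e) -> tsum f = s.
Proof. by move=> /cvg_totallyP H; apply/cvg_lim => //; exact: norm_hausdorff. Qed.

Lemma ler_sum_fset (I : choiceType) (f : I -> R) (A B : {fset I}) :
  (forall i, 0 <= f i) -> (A `<=` B)%fset ->
  \sum_(i <- A) f i <= \sum_(i <- B) f i.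
Proof.
move=> f0 sAB; rewrite [leRHS](big_fsetID _ [in A]) /=.
have -> : [fset x in B | x \in A]%fset = A.
  by apply/fsetP => i; rewrite !inE andbC; case: (boolP (i \in A)) => //= /(fsubsetP sAB).
by rewrite lerDl sumr_ge0.
Qed.

Lemma cvg_ge0_real (I : choiceType) (g : I -> R) (M : R) :
  (forall i, 0 <= g i) -> (forall A : {fset I}, \sum_(i <- A) g i <= M) ->
  exists s : R, forall e : R, 0 < e -> exists A0 : {fset I}, forall A : {fset I},
     (A0 `<=` A)%fset -> `|s - \sum_(i <- A) g i| < e.
Proof.
move=> g0 gM; pose E := [set \sum_(i <- A) g i | A in [set: {fset I}]].
have hE : has_sup E.
  split; first by exists (\sum_(i <- fset0) g i); exists fset0.
  by exists M => _ [A _ <-].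
exists (sup E) => e e0; have [_ [A0 _ <-] hA] := sup_adherent e0 hE.
exists A0 => A sA; have := ler_sum_fset g0 sA => hAA.
have h2 : \sum_(i <- A) g i <= sup E by apply: ub_le_sup => //; [case: hE | exists A].
rewrite ger0_norm ?subr_ge0// ltrBlDr -ltrBlDl; exact: lt_le_trans hA _.
Qed.

Lemma cvg_ge0 (I : choiceType) (g : I -> R) (M : R) :
  (forall i, 0 <= g i) -> (forall A : {fset I}, \sum_(i <- A) g i <= M) ->
  exists s : K, summability.partial_sum (fun i => (g i)%:C%C : K) @ summability.totally --> s.
Proof.
move=> g0 gM; have [s hs] := cvg_ge0_real g0 gM.
exists (s%:C%C : K); apply/cvg_totallyP => e e0.
have er : e \is Num.real by rewrite realE ltW.
have [e' ee'] := complex_realP _ er; rewrite {}ee' in e0 *.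
have e'0 : 0 < e' by rewrite -ltcR.
have [A0 hA] := hs _ e'0; exists A0 => A /hA.
rewrite -ltcR.
have -> : `|s - \sum_(i <- A) g i|%:C%C = `|(s - \sum_(i <- A) g i)%:C%C| :> K.
  by rewrite normc_def /= expr0n /= addr0 sqrtr_sqr.
by rewrite rmorphB rmorph_sum.
Qed.

(** Completeness is used only for the reals, through suprema: the family is cut into the positive
    and negative parts of its real and imaginary parts, each dominated by the modulus. *)
Lemma tsum_cvg (I : choiceType) (f : I -> K) :
  absum f -> summability.partial_sum f @ summability.totally --> tsum f.
Proof.
move=> [M fM].
suff [s hs] : exists s : K, summability.partial_sum f @ summability.totally --> s.
  by rewrite /tsum /summability.sum (cvg_lim _ hs)//; exact: norm_hausdorff.
have hpos (h : K -> R) : (forall x, 0 <= h x) -> (forall x, (h x)%:C%C <= `|x|) ->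
    exists s : K, summability.partial_sum (fun i => (h (f i))%:C%C : K) @ summability.totally --> s.
  move=> h0 hle; apply: (@cvg_ge0 I (fun i => h (f i)) (complex.Re M)) => // A.
  have : (\sum_(i <- A) h (f i))%:C%C <= M.
    by rewrite rmorph_sum; apply: le_trans (fM A); apply: ler_sum => i _; exact: hle.
  by rewrite lecE => /andP[].
have nRe (x : K) : `|complex.Re x|%:C%C <= `|x|.
  by rewrite normc_def lecR -sqrtr_sqr ler_wsqrtr// lerDl sqr_ge0.
have nIm (x : K) : `|complex.Im x|%:C%C <= `|x|.
  by rewrite normc_def lecR -sqrtr_sqr ler_wsqrtr// lerDr sqr_ge0.
have l1 (t : R) : Num.max t 0 <= `|t| by rewrite ge_max ler_norm normr_ge0.
have l2 (t : R) : 0 <= Num.max t 0 by rewrite le_max lexx orbT.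
have [s1 h1] := hpos (fun x => Num.max (complex.Re x) 0) (fun x => l2 _)
  (fun x => le_trans (etrans (lecR _ _) (l1 _)) (nRe x)).
have [s2 h2] := hpos (fun x => Num.max (- complex.Re x) 0) (fun x => l2 _)
  (fun x => le_trans (etrans (lecR _ _) (l1 _)) (etrans (f_equal (fun t => t%:C%C <= _) (normrN _)) (nRe x))).
have [s3 h3] := hpos (fun x => Num.max (complex.Im x) 0) (fun x => l2 _)
  (fun x => le_trans (etrans (lecR _ _) (l1 _)) (nIm x)).
have [s4 h4] := hpos (fun x => Num.max (- complex.Im x) 0) (fun x => l2 _)
  (fun x => le_trans (etrans (lecR _ _) (l1 _)) (etrans (f_equal (fun t => t%:C%C <= _) (normrN _)) (nIm x))).
exists ((s1 - s2) + ('i%C : K) * (s3 - s4)).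
set G := (X in X @ _ --> _).
suff -> : G = (summability.partial_sum (fun i => (Num.max (complex.Re (f i)) 0)%:C%C : K)
   - summability.partial_sum (fun i => (Num.max (- complex.Re (f i)) 0)%:C%C : K))
   + cst ('i%C : K) * (summability.partial_sum (fun i => (Num.max (complex.Im (f i)) 0)%:C%C : K)
   - summability.partial_sum (fun i => (Num.max (- complex.Im (f i)) 0)%:C%C : K)).
  exact: (cvgD (cvgB h1 h2) (cvgM (cvg_cst ('i%C : K)) (cvgB h3 h4))).
apply/funext => A; rewrite /G.
rewrite !fctE !partial_sumE -!sumrB mulr_sumr -big_split /=.
apply: eq_bigr => i _; rewrite [LHS](complexE (f i)).
have hm (t : R) : t = Num.max t 0 - Num.max (- t) 0.
  by have [h|h] := lerP t 0; have [h'|h'] := lerP (- t) 0; lra.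
by rewrite {1}(hm (complex.Re (f i))) {1}(hm (complex.Im (f i))) !rmorphB.
Qed.

Lemma tsumP (I : choiceType) (f : I -> K) (e : K) : absum f -> 0 < e ->
  exists A0 : {fset I}, forall A : {fset I},
     (A0 `<=` A)%fset -> `|tsum f - \sum_(i <- A) f i| < e.
Proof. by move=> /tsum_cvg /cvg_totallyP; exact. Qed.

End Summation.

Section SummationTheory.
Variable R : realType.
Local Notation K := (cplx R).
Implicit Types I J : choiceType.

Lemma absum_bound I (f : I -> K) : absum f ->
  exists2 M : K, 0 <= M & forall A : {fset I}, \sum_(i <- A) `|f i| <= M.
Proof.
by move=> [M fM]; exists M => //; have := fM fset0; rewrite big_seq_fset0.
Qed.

Lemma absum_le I (g f : I -> K) : (forall i, `|f i| <= `|g i|) -> absum g -> absum f.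
Proof.
by move=> fg [M gM]; exists M => A; apply: le_trans (gM A); exact: ler_sum.
Qed.

Lemma absum_eq I (g f : I -> K) : f =1 g -> absum g -> absum f.
Proof. by move=> /funext ->. Qed.

Lemma eq_tsum I (g f : I -> K) : f =1 g -> tsum f = tsum g.
Proof. by move=> /funext ->. Qed.

Lemma absum_norm I (f : I -> K) : absum f -> absum (fun i => `|f i|).
Proof. by apply: absum_le => i; rewrite normr_id. Qed.

Lemma absumD I (f g : I -> K) : absum f -> absum g -> absum (fun i => f i + g i).
Proof.
move=> [M fM] [N gN]; exists (M + N) => A.
apply: le_trans (lerD (fM A) (gN A)); rewrite -big_split /=.
by apply: ler_sum => i _; exact: ler_normD.
Qed.

Lemma absumZ I (c : K) (f : I -> K) : absum f -> absum (fun i => c * f i).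
Proof.
move=> [M fM]; exists (`|c| * M) => A.
apply: le_trans (ler_wpM2l (normr_ge0 c) (fM A)); rewrite mulr_sumr.
by apply: ler_sum => i _; rewrite normrM.
Qed.

Lemma absumN I (f : I -> K) : absum f -> absum (fun i => - f i).
Proof. by apply: absum_le => i; rewrite normrN. Qed.

Lemma absumB I (f g : I -> K) : absum f -> absum g -> absum (fun i => f i - g i).
Proof. by move=> fs gs; apply: absumD => //; exact: absumN. Qed.

Lemma absum_inj I J (h : J -> I) (f : I -> K) :
  injective h -> absum f -> absum (fun j => f (h j)).
Proof.
move=> hi [M fM]; exists M => A; have := fM (h @` A)%fset.
by rewrite big_imfset //= => x y _ _; exact: hi.
Qed.

Lemma absum_prod I J (f : I -> K) (g : J -> K) :
  absum f -> absum g -> absum (fun p : I * J => f p.1 * g p.2).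
Proof.
move=> /absum_bound[M M0 fM] /absum_bound[N N0 gN]; exists (M * N) => A.
pose B := [fset p.1 | p in A]%fset; pose C := [fset p.2 | p in A]%fset.
have -> : \sum_(p <- A) `|f p.1 * g p.2| =
    \sum_(p <- A | p \in [seq (i, j) | i <- B, j <- C]) `|f p.1 * g p.2|.
  rewrite [RHS]big_mkcond; apply: eq_big_seq => -[i j] ijA; case: ifP => // /negP[].
  by apply/allpairsP; exists (i, j); split=> //=; apply/imfsetP; exists (i, j).
apply: le_trans (_ : \sum_(p <- [seq (i, j) | i <- B, j <- C]) `|f p.1 * g p.2| <= _).
  have ua : uniq [seq (i, j) | i <- B, j <- C].
    by apply: allpairs_uniq => [||[a b] [c d] _ _ []-> ->]; rewrite ?fset_uniq.
  rewrite [leRHS](bigID (fun p => p \in A)) /=.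
  rewrite -[leLHS]addr0; apply: lerD; last exact: sumr_ge0.
  rewrite -big_filter -[leRHS]big_filter.
  suff hp : perm_eq [seq p <- A | p \in [seq (i, j) | i <- B, j <- C]]
     [seq p <- [seq (i, j) | i <- B, j <- C] | p \in A] by rewrite (perm_big _ hp).
  by apply: uniq_perm; rewrite ?filter_uniq ?fset_uniq // => p; rewrite !mem_filter andbC.
rewrite big_allpairs /=.
under eq_bigr do under eq_bigr do rewrite normrM.
under eq_bigr do rewrite -mulr_sumr.
rewrite -mulr_suml; apply: ler_pM => //; apply: sumr_ge0 => *; exact: normr_ge0.
Qed.

Lemma tsum_norm I (f : I -> K) (M : K) :
  (forall A : {fset I}, \sum_(i <- A) `|f i| <= M) -> `|tsum f| <= M.
Proof.
move=> fM; apply/ler_addgt0Pr => e e0.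
have [A0 /(_ A0 (fsubset_refl _)) h] := tsumP (ex_intro _ M fM) e0.
rewrite -(subrK (\sum_(i <- A0) f i) (tsum f)) addrC.
apply: le_trans (ler_normD _ _) _; apply: lerD; last exact: ltW.
by apply: le_trans (fM A0); exact: ler_norm_sum.
Qed.

Lemma tsum_fin I (f : I -> K) (A0 : {fset I}) :
  (forall i, i \notin A0 -> f i = 0) -> tsum f = \sum_(i <- A0) f i.
Proof.
move=> f0; apply: tsum_unique => e e0; exists A0 => A sA.
rewrite (big_fset_incl _ sA) ?subrr ?normr0// => i _; exact: f0.
Qed.

Lemma tsum1 I (f : I -> K) (i0 : I) :
  (forall i, i != i0 -> f i = 0) -> tsum f = f i0.
Proof.
move=> f0; rewrite (@tsum_fin _ _ [fset i0]%fset) ?big_seq_fset1// => i.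
by rewrite inE; exact: f0.
Qed.

Lemma tsum0 I (f : I -> K) : (forall i, f i = 0) -> tsum f = 0.
Proof. by move=> f0; rewrite (@tsum_fin _ _ fset0) ?big_seq_fset0. Qed.

Lemma tsumD I (f g : I -> K) : absum f -> absum g ->
  tsum (fun i => f i + g i) = tsum f + tsum g.
Proof.
move=> fs gs; apply: tsum_unique => e e0.
have [A hA] := tsumP fs (divr_gt0 e0 (ltr0Sn _ 1)).
have [B hB] := tsumP gs (divr_gt0 e0 (ltr0Sn _ 1)).
exists (A `|` B)%fset => C; rewrite fsubUset => /andP[/hA h1 /hB h2].
rewrite big_split /= [X in `|X|](_ : _ =
  (tsum f - \sum_(i <- C) f i) + (tsum g - \sum_(i <- C) g i)); last by ring.
by rewrite (splitr e); apply: le_lt_trans (ler_normD _ _) _; exact: ltrD.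
Qed.

Lemma tsumZ I (c : K) (f : I -> K) : absum f ->
  tsum (fun i => c * f i) = c * tsum f.
Proof.
move=> fs; have [->|c0] := eqVneq c 0.
  by rewrite mul0r; apply: tsum0 => i; rewrite mul0r.
apply: tsum_unique => e e0; have c0' : 0 < `|c| by rewrite normr_gt0.
have [A hA] := tsumP fs (divr_gt0 e0 c0'); exists A => B /hA.
by rewrite ltr_pdivlMr// -mulr_sumr -mulrBr normrM [(`|c| * _)%R]mulrC.
Qed.

Lemma tsumN I (f : I -> K) : absum f -> tsum (fun i => - f i) = - tsum f.
Proof.
move=> fs; rewrite -[RHS]mulN1r -tsumZ//; apply: eq_tsum => i; by rewrite mulN1r.
Qed.

Lemma tsumB I (f g : I -> K) : absum f -> absum g ->
  tsum (fun i => f i - g i) = tsum f - tsum g.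
Proof. by move=> fs gs; rewrite tsumD ?tsumN//; exact: absumN. Qed.

Lemma tsum_reindex I J (h : J -> I) (f : I -> K) : injective h -> absum f ->
  (forall i, (forall j, h j != i) -> f i = 0) -> tsum f = tsum (fun j => f (h j)).
Proof.
move=> hi fs f0; apply/esym/tsum_unique => e e0.
have [A0 hA] := tsumP fs e0.
(* A partial inverse of [h], which pulls [A0] back to a finite set of indices in [J]. *)
pose g i := if pselect (exists j, h j = i) is left H then Some (xchoose (P := fun j => h j == i)
   (let: ex_intro j Hj := H in ex_intro _ j (introT eqP Hj))) else None.
have gh j : g (h j) = Some j.
  rewrite /g; case: pselect => [H|[]]; last by exists j.
  by congr Some; apply: hi; apply/eqP; exact: (xchooseP (P := fun j' => h j' == h j)).
exists [fset j in pmap g A0]%fset => B sB.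
have := hA (A0 `|` h @` B)%fset (fsubsetUl _ _).
rewrite -(@big_fset_incl _ _ _ _ (h @` B)%fset _ _ (fsubsetUr _ _)).
  by rewrite big_imfset //= => x y _ _; exact: hi.
move=> i; rewrite inE => /orP[iA|->//] iB; apply: f0 => j; apply/eqP => ji.
move/negP: iB; apply; apply/imfsetP; exists j => //=.
apply: (fsubsetP sB); rewrite !inE mem_pmap; apply/mapP; exists i => //.
by rewrite -ji gh.
Qed.

Lemma tsum_bij I J (h : J -> I) (f : I -> K) : bijective h -> absum f ->
  tsum f = tsum (fun j => f (h j)).
Proof.
move=> [g hg gh] fs; apply: tsum_reindex => //; first exact: can_inj hg.
by move=> i /(_ (g i)); rewrite gh eqxx.
Qed.

(** One finite set of columns serves a whole finite list of rows, so finitely many inner sums can be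
    replaced by one sum over a rectangle. *)
Lemma tsum_approx I J (f : I -> J -> K) (s : seq I) (e : K) :
  (forall i, absum (f i)) -> 0 < e ->
  exists C0 : {fset J}, forall C : {fset J}, (C0 `<=` C)%fset ->
    forall i, i \in s -> `|tsum (f i) - \sum_(j <- C) f i j| < e.
Proof.
move=> fs e0; elim: s => [|i s [C0 IH]]; first by exists fset0.
have [A hA] := tsumP (fs i) e0; exists (A `|` C0)%fset => C.
rewrite fsubUset => /andP[/hA h1 /IH h2] k; rewrite inE => /predU1P[->//|]; exact: h2.
Qed.

Lemma sum_fsetM I J (f : I * J -> K) (A : {fset I}) (C : {fset J}) :
  \sum_(p <- (A `*` C)%fset) f p = \sum_(i <- A) \sum_(j <- C) f (i, j).
Proof.
rewrite -(big_allpairs (r1 := A) (r2 := C) (F := f)) /=.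
apply: perm_big; apply: uniq_perm; rewrite ?fset_uniq //.
  by apply: allpairs_uniq => [||[a b] [c d] _ _ []-> ->]; rewrite ?fset_uniq.
move=> [i j]; rewrite in_fsetM /=; apply/andP/allpairsP => [[iA jC]|[[a b] /= [aA bC [-> ->]]]] //.
by exists (i, j).
Qed.

Lemma absum_slice I J (f : I * J -> K) (i : I) : absum f -> absum (fun j => f (i, j)).
Proof. by apply: absum_inj => a b []. Qed.

Lemma absum_tsum I J (f : I * J -> K) : absum f -> absum (fun i => tsum (fun j => f (i, j))).
Proof.
move=> fs; have [M M0 fM] := absum_bound fs; exists (M + 1) => A.
(* The rows in [A] are approximated so closely that their errors add up to at most 1, hence the
   bound [M + 1]. *)
have d0 : (0 : K) < (size A).+1%:R^-1 by rewrite invr_gt0 ltr0Sn.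
have [C0 /(_ _ (fsubset_refl _)) hC] :=
  tsum_approx A (fun i => absum_slice i fs) d0.
apply: le_trans (_ : \sum_(i <- A) (\sum_(j <- C0) `|f (i, j)| + (size A).+1%:R^-1) <= _).
  rewrite big_seq [leRHS]big_seq; apply: ler_sum => i /hC hi.
  rewrite -(subrK (\sum_(j <- C0) f (i, j)) (tsum _)) addrC.
  apply: le_trans (ler_normD _ _) _; apply: lerD; last exact: ltW.
  exact: ler_norm_sum.
rewrite big_split /=; apply: lerD; first by rewrite -(sum_fsetM (fun p => `|f p|)).
rewrite big_const_seq count_predT iter_addr_0 -[leLHS]mulr_natl.
by rewrite ler_pdivrMr ?ltr0Sn// mul1r ler_nat.
Qed.

Lemma tsum_pair I J (f : I * J -> K) : absum f ->
  tsum f = tsum (fun i => tsum (fun j => f (i, j))).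
Proof.
move=> fs; apply/esym/tsum_unique => e e0.
have e2 : 0 < e / 2 by rewrite divr_gt0.
have [B0 hB] := tsumP fs e2.
exists [fset p.1 | p in B0]%fset => A sA.
have d0 : 0 < e / 2 / (size A).+1%:R by rewrite divr_gt0 ?ltr0Sn.
have [C0 hC] := tsum_approx A (fun i => absum_slice i fs) d0.
(* [C] also contains the second coordinates of [B0], so the rectangle covers [B0] and the estimate
   for the full sum applies to it. *)
pose C := (C0 `|` [fset p.2 | p in B0])%fset.
have sB : (B0 `<=` A `*` C)%fset.
  apply/fsubsetP => -[i j] ij; rewrite in_fsetM /=; apply/andP; split.
    by apply: (fsubsetP sA); apply/imfsetP; exists (i, j).
  by rewrite inE; apply/orP; right; apply/imfsetP; exists (i, j).
rewrite [X in `|X|](_ : _ = (tsum f - \sum_(p <- (A `*` C)%fset) f p) -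
   \sum_(i <- A) (tsum (fun j => f (i, j)) - \sum_(j <- C) f (i, j))); last first.
  by rewrite sum_fsetM sumrB; ring.
rewrite (splitr e); apply: le_lt_trans (ler_normB _ _) _; apply: ltr_leD; first exact: hB.
apply: le_trans (ler_norm_sum _ _ _) _.
apply: le_trans (_ : \sum_(i <- A) (e / 2 / (size A).+1%:R) <= _).
  rewrite big_seq [leRHS]big_seq; apply: ler_sum => i iA.
  by apply: ltW; apply: hC => //; exact: fsubsetUl.
rewrite big_const_seq count_predT iter_addr_0 -[leLHS]mulr_natr -mulrA ler_piMr ?(ltW e2)//.
by rewrite mulrC ler_pdivrMr ?ltr0Sn// mul1r ler_nat.
Qed.

Lemma tsum_swap I J (f : I * J -> K) : absum f ->
  tsum (fun i => tsum (fun j => f (i, j))) = tsum (fun j => tsum (fun i => f (i, j))).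
Proof.
move=> fs; rewrite -tsum_pair//.
have sb : bijective (fun p : J * I => (p.2, p.1)) by exists (fun p => (p.2, p.1)) => -[].
by rewrite (tsum_bij sb fs) tsum_pair//; apply: absum_inj fs; exact: bij_inj sb.
Qed.

Lemma tsumM I J (f : I -> K) (g : J -> K) : absum f -> absum g ->
  tsum f * tsum g = tsum (fun p : I * J => f p.1 * g p.2).
Proof.
move=> fs gs; rewrite tsum_pair; last exact: absum_prod.
rewrite mulrC -tsumZ//; apply: eq_tsum => i /=; by rewrite tsumZ// mulrC.
Qed.

(** [A0] depends on the majorant alone: outside it every dominated [h] is controlled by the tail of
    [|g|]. Passing to the limit under the sum needs this uniformity. *)
Lemma tsum_tail I (g : I -> K) (e : K) : absum g -> 0 < e ->
  exists A0 : {fset I}, forall h : I -> K, (forall i, `|h i| <= `|g i|) ->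
    `|tsum h - \sum_(i <- A0) h i| < e.
Proof.
move=> gs e0; have e3 : 0 < e / 3 by rewrite divr_gt0.
have [A0 hA] := tsumP (absum_norm gs) e3; exists A0 => h hg.
have [B hB] := tsumP (absum_le hg gs) e3.
have := hB (A0 `|` B)%fset (fsubsetUr _ _) => h1.
rewrite -(subrK (\sum_(i <- (A0 `|` B)%fset) h i) (tsum h)) -addrA.
apply: le_lt_trans (ler_normD _ _) _.
have -> : e = e / 3 + (e / 3 + e / 3) by field.
apply: ltrD => //.
have hU (k : I -> K) : \sum_(i <- (A0 `|` B)%fset) k i - \sum_(i <- A0) k i =
    \sum_(i <- (A0 `|` B)%fset | i \notin A0) k i.
  rewrite (bigID (fun i => i \in A0)) /= -big_filter.
  have -> : \sum_(i <- [seq i <- (A0 `|` B)%fset | i \in A0]) k i = \sum_(i <- A0) k i.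
    apply: perm_big; apply: uniq_perm; rewrite ?filter_uniq ?fset_uniq// => i.
    by rewrite mem_filter inE; case: (i \in A0).
  by rewrite addrAC subrr add0r.
rewrite hU; apply: le_lt_trans (ler_norm_sum _ _ _) _.
apply: le_lt_trans (_ : \sum_(i <- (A0 `|` B)%fset | i \notin A0) `|g i| < _); first exact: ler_sum.
rewrite -[ltLHS]ger0_norm ?sumr_ge0// -(hU (fun i => `|g i|)).
set a := \sum_(i <- (A0 `|` B)%fset) _; set b := \sum_(i <- A0) _.
rewrite -(subrK (tsum (fun i => `|g i|)) a) -addrA.
apply: le_lt_trans (ler_normD _ _) _; apply: ltrD.
  by rewrite distrC; apply: hA; exact: fsubsetUl.
exact: hA.
Qed.

(** Dominated convergence, over an arbitrary proper filter because it serves both for limits of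
    finite products and for continuity in complex parameters. *)
Lemma tannery I (T : Type) (F : set_system T) (f : T -> I -> K) (l g : I -> K) :
  ProperFilter F -> absum g -> (\forall t \near F, forall i, `|f t i| <= `|g i|) ->
  (forall i, f t i @[t --> F] --> l i) -> tsum (f t) @[t --> F] --> tsum l.
Proof.
move=> FF gs fg fl.
have lg i : `|l i| <= `|g i|.
  apply/ler_addgt0Pr => e e0; have /cvgrPdist_lt /(_ e e0) h := fl i.
  have [t [/(_ i) h1 h2]] := filter_ex (filterI fg h).
  rewrite -(subrK (f t i) (l i)) addrC.
  by apply: le_trans (ler_normD _ _) _; apply: lerD => //; exact: ltW.
apply/cvgrPdist_lt => e e0; have e3 : 0 < e / 3 by rewrite divr_gt0.
have [A hA] := tsum_tail gs e3.
have /cvgrPdist_lt /(_ _ e3) hS : \sum_(i <- A) f t i @[t --> F] --> \sum_(i <- A) l i.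
  by apply: cvg_big => [|i _]; [exact: add_continuous|exact: fl].
near=> t.
rewrite [X in `|X|](_ : _ = (tsum l - \sum_(i <- A) l i) +
  ((\sum_(i <- A) l i - \sum_(i <- A) f t i) - (tsum (f t) - \sum_(i <- A) f t i))); last by ring.
have -> : e = e / 3 + (e / 3 + e / 3) by field.
apply: le_lt_trans (ler_normD _ _) _; apply: ltrD; first exact: hA.
apply: le_lt_trans (ler_normB _ _) _; apply: ltrD.
  by near: t.
by apply: hA; near: t.
Unshelve. all: by end_near.
Qed.

End SummationTheory.

(** * Laurent series as coefficient sequences *)

Section Laurent.
Variable R : realType.
Local Notation K := (cplx R).
Implicit Types (a b c d : int -> K) (z : K).

(** Decay faster than every geometric sequence in both directions: the Laurent series converges on
    the whole punctured plane. *)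
Definition entire a : Prop :=
  forall B : K, exists C : K, forall n, `|a n| * `|B| ^+ `|n|%N <= C.

(** Such a sequence may have a Laurent series that converges nowhere, like the constant 1, and can
    still be convolved with an [entire] one. *)
Definition expgrow d : Prop :=
  exists C B : K, 1 <= B /\ forall n, `|d n| <= C * B ^+ `|n|%N.

Definition conv a d (n : int) : K := tsum (fun m => a m * d (n - m)).

Definition ev d z : K := tsum (fun n => d n * z ^ n).

Definition absum_at d z : Prop := absum (fun n => d n * z ^ n).

Lemma expr_small (x B : K) : `|x| < 1 -> exists N, forall n, (N <= n)%N -> `|x| ^+ n * `|B| <= 1.
Proof.
move=> x1.
have [xr hx] := complex_realP _ (normr_real x).
have [br hb] := complex_realP _ (normr_real B).
have x0 : 0 <= xr by rewrite -ler0c -hx.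
have b0 : 0 <= br by rewrite -ler0c -hb.
have x1' : xr < 1 by rewrite -ltcR -hx rmorph1.
have := @cvg_expr R xr.
rewrite ger0_norm// => /(_ x1') /cvgrPdist_le /(_ (br + 1)^-1).
rewrite invr_gt0 ltr_wpDl// => /(_ isT)[N _ hN]; exists N => n /hN.
rewrite sub0r normrN ger0_norm ?exprn_ge0// => h.
rewrite hx hb -rmorphXn -rmorphM -(rmorph1 (real_complex R)) lecR.
apply: le_trans (ler_wpM2r b0 h) _.
by rewrite mulrC ler_pdivrMr ?ltr_wpDl// mul1r lerDl.
Qed.

Lemma absum_fin (I : finType) (f : I -> K) : absum f.
Proof.
exists (\sum_i `|f i|) => A; rewrite big_uniq ?fset_uniq//= big_mkcond /=.
by apply: ler_sum => i _; case: ifP.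
Qed.

Lemma absum_geo_nat (x : K) : `|x| < 1 -> absum (fun n : nat => x ^+ n).
Proof.
move=> x1; exists (1 - `|x|)^-1 => A.
have [N hN] : exists N, {subset A <= iota 0 N}.
  exists (\max_(i <- A) i).+1 => i iA; rewrite mem_iota /= add0n ltnS.
  exact: leq_bigmax_seq.
apply: le_trans (_ : \sum_(i <- iota 0 N) `|x ^+ i| <= _).
  rewrite [leRHS](bigID (fun i => i \in A)) /= -[leLHS]addr0 lerD ?sumr_ge0//.
  rewrite -[leRHS]big_filter.
  suff hp : perm_eq A [seq i <- iota 0 N | i \in A] by rewrite (perm_big _ hp).
  apply: uniq_perm; rewrite ?filter_uniq ?iota_uniq ?fset_uniq// => i.
  by rewrite mem_filter; case: (boolP (i \in A)) => //= /hN ->.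
under eq_bigr do rewrite normrX.
have -> : iota 0 N = index_iota 0 N by rewrite /index_iota subn0.
rewrite big_mkord.
have d0 : 0 < 1 - `|x| by rewrite subr_gt0.
rewrite -[leRHS]mul1r ler_pdivlMr// mulrC -opprB mulNr -subrX1 opprB.
by rewrite gerBl exprn_ge0.
Qed.

Lemma absum_geo (x : K) : `|x| < 1 -> absum (fun n : int => x ^+ `|n|%N).
Proof.
move=> x1; have h : injective (fun n : int => (`|n|%N, n < 0)).
  by move=> m n []; lia.
have := absum_inj h (absum_prod (absum_geo_nat x1) (absum_fin (fun _ : bool => 1 : K))).
by apply: absum_eq => n /=; rewrite mulr1.
Qed.

Lemma entire_bound a (B : K) : entire a -> 1 <= B ->
  absum (fun n => a n * B ^+ `|n|%N).
Proof.
(* Boundedness at radius [2 * B] leaves a summable factor $2^{-|n|}$ at radius [B]. *)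
move=> ha B1; have [C hC] := ha (2 * B).
have B0 : 0 <= B := le_trans ler01 B1.
have h2 : `|2^-1 : K| < 1 by rewrite ger0_norm ?invr_ge0// invf_lt1// ltr1n.
apply: absum_le (absumZ C (absum_geo h2)) => n.
have C0 : 0 <= C by apply: le_trans (hC 0); rewrite mulr_ge0.
rewrite normrM normrX (ger0_norm B0) normrM (ger0_norm C0) normrX (ger0_norm (_ : 0 <= 2^-1)) ?invr_ge0//.
rewrite exprVn ler_pdivlMr ?exprn_gt0//.
apply: le_trans (hC n); rewrite (ger0_norm (_ : 0 <= 2 * B)) ?mulr_ge0//.
by rewrite exprMn [2 ^+ _ * _]mulrC mulrA.
Qed.

Lemma normz_le z (n : int) : z != 0 -> `|z ^ n| <= (`|z| + `|z|^-1) ^+ `|n|%N.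
Proof.
move=> z0; have h0 : 0 < `|z| by rewrite normr_gt0.
case: n => n.
  rewrite absz_nat -exprnP normrX lerXn2r ?nnegrE ?addr_ge0 ?invr_ge0//.
  by rewrite lerDl invr_ge0.
rewrite NegzE abszN absz_nat -exprnN normfV normrX -exprVn.
by rewrite lerXn2r ?nnegrE ?addr_ge0 ?invr_ge0// lerDr.
Qed.

Lemma norm_addV_ge1 z : z != 0 -> 1 <= `|z| + `|z|^-1.
Proof.
move=> z0; have h0 : 0 < `|z| by rewrite normr_gt0.
have [h|h] := real_leP (real1 K) (normr_real z).
  by apply: le_trans h _; rewrite lerDl invr_ge0.
apply: le_trans (_ : `|z|^-1 <= _); last by rewrite lerDr.
by rewrite invf_ge1// ltW.
Qed.

Lemma entire_at a z : entire a -> z != 0 -> absum_at a z.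
Proof.
move=> ha z0; apply: absum_le (entire_bound ha (norm_addV_ge1 z0)) => n.
rewrite !normrM ler_wpM2l// normrX (ger0_norm (_ : 0 <= `|z| + `|z|^-1)) ?addr_ge0 ?invr_ge0//.
exact: normz_le.
Qed.

Lemma expgrow_normalize d : expgrow d ->
  exists C B : K, [/\ 0 <= C, 1 <= B & forall n, `|d n| <= C * B ^+ `|n|%N].
Proof.
move=> [C [B [B1 h]]]; exists C, B; split => //.
by have := h 0; rewrite absz0 expr0 mulr1; exact: le_trans.
Qed.

Lemma conv_absum a d n : entire a -> expgrow d -> absum (fun m => a m * d (n - m)).
Proof.
move=> ha /expgrow_normalize[C [B [C0 B1 h]]].
have B0 : 0 <= B := le_trans ler01 B1.
apply: absum_le (absumZ (C * B ^+ `|n|%N) (entire_bound ha B1)) => m.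
rewrite !normrM mulrCA ler_wpM2l// (ger0_norm C0) !normrX (ger0_norm B0).
apply: le_trans (h _) _; rewrite -mulrA ler_wpM2l// -exprD ler_weXn2l//.
lia.
Qed.

Lemma entire_expgrow a : entire a -> expgrow a.
Proof.
move=> /(_ 1)[C hC]; exists C, 1; split => // n; have := hC n.
by rewrite normr1 expr1n !mulr1.
Qed.

Lemma ev_conv a d z : z != 0 -> entire a -> absum_at d z ->
  absum_at (conv a d) z /\ ev (conv a d) z = ev a z * ev d z.
Proof.
move=> z0 ha hd; have fs := absum_prod (entire_at ha z0) hd.
have hb : bijective (fun p : int * int => (p.2, p.1 - p.2)).
  by exists (fun p => (p.2 + p.1, p.1)) => -[i j] /=; congr pair; ring.
have fs' := absum_inj (bij_inj hb) fs.
have E n : conv a d n * z ^ n = tsum (fun m => a m * z ^ m * (d (n - m) * z ^ (n - m))).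
  have zn : z ^ n != 0 by rewrite expfz_neq0.
  rewrite /conv mulrC -tsumZ; last first.
    have /(absumZ (z ^ n)^-1) := absum_slice n fs'.
    apply: absum_eq => m /=; rewrite expfzDr// -invr_expz; field.
    by rewrite !expfz_neq0.
  by apply: eq_tsum => m; rewrite expfzDr// -invr_expz; field; rewrite expfz_neq0.
split; first by have := absum_tsum fs'; apply: absum_eq => n /=; exact: E.
rewrite /ev tsumM//; last exact: entire_at.
rewrite (tsum_bij hb fs) tsum_pair//; apply: eq_tsum => n; exact: E.
Qed.

End Laurent.

(** * Theta functions and the triple product *)

Section Products.
Variable R : realType.
Local Notation K := (cplx R).

Lemma tsum_nat_cvg (f : nat -> K) : absum f ->
  \sum_(0 <= i < n) f i @[n --> \oo] --> tsum f.
Proof.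
move=> fs; apply/cvgrPdist_lt => e e0; have [A hA] := tsumP fs e0.
exists (\max_(i <- A) i).+1 => // n /= hn.
have := hA [fset i in iota 0 n]%fset.
have hp : perm_eq [fset i in iota 0 n]%fset (index_iota 0 n).
  by apply: uniq_perm; rewrite ?fset_uniq ?iota_uniq// => i; rewrite !inE /index_iota subn0.
rewrite (perm_big _ hp); apply; apply/fsubsetP => i iA; rewrite !inE mem_iota /= add0n.
by apply: leq_trans hn; rewrite ltnS; exact: leq_bigmax_seq.
Qed.

Definition ppoch (x q : K) (n : nat) : K := \prod_(0 <= i < n) (1 - q ^+ i * x).

Lemma ppochS x q n : ppoch x q n.+1 = ppoch x q n * (1 - q ^+ n * x).
Proof. by rewrite /ppoch big_nat_recr. Qed.

Lemma ppoch0 x q : ppoch x q 0 = 1. Proof. by rewrite /ppoch big_nil. Qed.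

Lemma ppochD x q m n : ppoch x q (m + n) = ppoch x q m * ppoch (q ^+ m * x) q n.
Proof.
elim: n => [|n IH]; first by rewrite addn0 ppoch0 mulr1.
by rewrite addnS !ppochS IH exprD -!mulrA; congr (_ * (_ * _)); ring.
Qed.

(** As long as the sum stays below one half the product has modulus at most 2, so a new factor moves
    it by at most [2 * |a n|]. *)
Lemma prod_near1 (a : nat -> K) n : \sum_(0 <= i < n) `|a i| <= 2^-1 ->
  `|\prod_(0 <= i < n) (1 - a i) - 1| <= 2 * \sum_(0 <= i < n) `|a i|.
Proof.
elim: n => [|n IH]; first by rewrite !big_nil subrr normr0 mulr0.
rewrite !big_nat_recr //=; set P := \prod_(_ <= _ < _) _; set S := \sum_(_ <= _ < _) _.
move=> hS; have S0 : 0 <= S by rewrite sumr_ge0.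
have S2 : S <= 2^-1 by apply: le_trans hS; rewrite lerDl.
have {IH} := IH S2; rewrite -/P -/S => IH.
have PS : `|P| <= 2.
  rewrite -(subrK 1 P); apply: le_trans (ler_normD _ _) _; rewrite normr1.
  have -> : 2 = 2 * 2^-1 + 1 :> K by field.
  by rewrite lerD2r; apply: le_trans IH _; rewrite ler_wpM2l.
have -> : P * (1 - a n) - 1 = (P - 1) - P * a n by ring.
apply: le_trans (ler_normB _ _) _; rewrite mulrDr normrM lerD//.
by rewrite ler_wpM2r.
Qed.

Variable q : K.
Hypothesis q1 : `|q| < 1.

Lemma geo_partial_le (y : K) n : \sum_(0 <= i < n) `|q ^+ i * y| <= `|y| / (1 - `|q|).
Proof.
have d0 : 0 < 1 - `|q| by rewrite subr_gt0.
under eq_bigr do rewrite normrM normrX.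
rewrite -mulr_suml [leLHS]mulrC ler_wpM2l// -[leRHS]mul1r ler_pdivlMr//.
rewrite big_mkord mulrC -opprB mulNr -subrX1 opprB gerBl.
by rewrite exprn_ge0.
Qed.

(** With one quarter here, [ppoch_small] keeps every product of later factors within one half of 1,
    so that these products and their inverses are bounded by 2. *)
Lemma tail_small (x : K) : exists N, `|q ^+ N * x| / (1 - `|q|) <= 4^-1.
Proof.
have d0 : 0 < 1 - `|q| by rewrite subr_gt0.
have [N /(_ N (leqnn _)) hN] := expr_small (4 * x / (1 - `|q|)) q1; exists N.
have -> : `|q ^+ N * x| / (1 - `|q|) = 4^-1 * (`|q| ^+ N * `|4 * x / (1 - `|q|)|).
  rewrite !normrM normfV (ger0_norm (ltW d0)) normrX normr_nat; field.
  by rewrite gt_eqF.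
by rewrite ler_piMr.
Qed.

Lemma ppoch_small (x : K) n : `|x| / (1 - `|q|) <= 4^-1 -> `|ppoch x q n - 1| <= 2^-1.
Proof.
move=> h; have hs := le_trans (geo_partial_le x n) h.
have h4 : (4^-1 : K) <= 2^-1 by rewrite lef_pV2 ?posrE// ler_nat.
apply: le_trans (prod_near1 (le_trans hs h4)) _.
have -> : 2^-1 = 2 * 4^-1 :> K by field.
by rewrite ler_wpM2l.
Qed.

Lemma ppoch_bounded (x : K) : exists2 M : K, 0 <= M & forall n, `|ppoch x q n| <= M.
Proof.
have [N hN] := tail_small x.
exists (\sum_(0 <= i < N) `|ppoch x q i| + `|ppoch x q N| * 2).
  by rewrite addr_ge0 ?mulr_ge0// sumr_ge0.
move=> n; have [nN|Nn] := ltnP n N.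
  apply: le_trans (_ : \sum_(0 <= i < N) `|ppoch x q i| <= _); last first.
    by rewrite lerDl mulr_ge0.
  rewrite (bigD1_seq n) ?iota_uniq//= ?mem_index_iota// lerDl.
  by rewrite sumr_ge0.
apply: le_trans (_ : `|ppoch x q N| * 2 <= _); last by rewrite lerDr sumr_ge0.
rewrite -(subnKC Nn) ppochD normrM ler_wpM2l//.
rewrite -(subrK 1 (ppoch _ _ _)); apply: le_trans (ler_normD _ _) _; rewrite normr1.
apply: le_trans (lerD (ppoch_small _ hN) (lexx _)) _.
by rewrite -[leRHS]/(1 + 1) lerD2r invf_le1// ler1n.
Qed.

(** The partial products telescope into $1+\sum f$, where the differences [f] are dominated by a
    geometric series because the products are bounded. *)
Lemma qpoch_cvg (x : K) : ppoch x q n @[n --> \oo] --> qpoch x q.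
Proof.
suff [l hl] : exists l : K, ppoch x q n @[n --> \oo] --> l.
  rewrite /qpoch; have -> : lim (ppoch x q n @[n --> \oo]) = l; last exact: hl.
  by apply/cvg_lim => //; exact: norm_hausdorff.
have [M M0 hM] := ppoch_bounded x.
pose f n := - (q ^+ n * x * ppoch x q n).
have fs : absum f.
  apply: absum_le (absumZ (x * M) (absum_geo_nat q1)) => n.
  rewrite /f normrN !normrM (ger0_norm M0).
  by rewrite [leRHS]mulrC mulrA ler_wpM2l ?mulr_ge0.
exists (1 + tsum f).
have -> : ppoch x q = (fun n => 1 + \sum_(0 <= i < n) f i).
  apply/funext; elim=> [|n IH]; first by rewrite ppoch0 big_nil addr0.
  by rewrite ppochS big_nat_recr//= addrA -IH /f; ring.
by apply: cvgD (tsum_nat_cvg fs); exact: cvg_cst.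
Qed.

Lemma ppoch_neq0 (x : K) n : (forall i, q ^+ i * x != 1) -> ppoch x q n != 0.
Proof. by move=> h; rewrite prodf_seq_neq0; apply/allP => i _ /=; rewrite subr_eq0 eq_sym. Qed.

Lemma ppoch_inv_bounded (x : K) : (forall i, q ^+ i * x != 1) ->
  exists2 M : K, 0 < M & forall n, `|(ppoch x q n)^-1| <= M.
Proof.
move=> hx; have [N hN] := tail_small x.
exists (\sum_(0 <= i < N) `|(ppoch x q i)^-1| + `|(ppoch x q N)^-1| * 2).
  by rewrite ltr_wpDl ?sumr_ge0// mulr_gt0// normr_gt0 invr_neq0// ppoch_neq0.
move=> n; have [nN|Nn] := ltnP n N.
  apply: le_trans (_ : \sum_(0 <= i < N) `|(ppoch x q i)^-1| <= _); last first.
    by rewrite lerDl mulr_ge0.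
  rewrite (bigD1_seq n) ?iota_uniq//= ?mem_index_iota// lerDl.
  by rewrite sumr_ge0.
apply: le_trans (_ : `|(ppoch x q N)^-1| * 2 <= _); last by rewrite lerDr sumr_ge0.
rewrite -(subnKC Nn) ppochD invfM normrM ler_wpM2l//.
set T := ppoch _ _ _; have hT : `|T - 1| <= 2^-1 := ppoch_small _ hN.
have : 2^-1 <= `|T|.
  have -> : 2^-1 = 1 - 2^-1 :> K by field.
  rewrite lerBlDr -[X in X <= _]normr1.
  apply: le_trans (_ : `|T| + `|T - 1| <= _); last by rewrite lerD2l.
  have {1}-> : 1 = T - (T - 1) by ring.
  exact: ler_normB.
move=> h; have T0 : 0 < `|T| by apply: lt_le_trans h; rewrite invr_gt0.
by rewrite normfV -[leRHS]invrK lef_pV2// posrE invr_gt0.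
Qed.

(** The inverses of the partial products are bounded, so the products stay away from 0 and so does
    their limit. *)
Lemma qpoch_neq0 (x : K) : (forall i, q ^+ i * x != 1) -> qpoch x q != 0.
Proof.
move=> hx; have [M M0 hM] := ppoch_inv_bounded hx.
apply/eqP => h0; have /cvgrPdist_lt /(_ M^-1) := qpoch_cvg (x := x).
rewrite invr_gt0 => /(_ M0)[n _ /(_ n (leqnn _))]; rewrite h0 sub0r normrN => hn.
have := hM n; rewrite normfV => hm.
have p0 : 0 < `|ppoch x q n| by rewrite normr_gt0 ppoch_neq0.
have : M < `|ppoch x q n|^-1 by rewrite -[M]invrK ltf_pV2 ?posrE ?invr_gt0.
by move=> /lt_le_trans /(_ hm); rewrite ltxx.
Qed.

End Products.

Lemma binz2S (n : int) : binz2 (n + 1) = binz2 n + n.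
Proof.
rewrite /binz2 addrK.
have -> : (n + 1) * n = n * 2 + n * (n - 1) by ring.
by rewrite divzMDl// addrC.
Qed.

Lemma binz2_nat (k : nat) : binz2 k = 'C(k, 2).
Proof.
elim: k => [//|k IH].
by rewrite -addn1 PoszD binz2S IH addn1 binS bin1 PoszD.
Qed.

Lemma binz2_neg (k : nat) : binz2 (- k%:Z) = ('C(k, 2) + k)%N.
Proof.
elim: k => [//|k IH].
have := binz2S (- k.+1%:Z); have -> : - k.+1%:Z + 1 = - k%:Z by lia.
rewrite IH binS bin1 => h; lia.
Qed.

Lemma binz2_double (n : int) : binz2 n * 2 = n * (n - 1).
Proof.
have step m : (binz2 (m + 1) * 2 == (m + 1) * (m + 1 - 1)) = (binz2 m * 2 == m * (m - 1)).
  by rewrite binz2S; apply/eqP/eqP => h; [have : (binz2 m + m) * 2 = (m + 1) * m by rewrite h; ring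
    | rewrite mulrDl h]; [move=> h'; apply: (@addIr _ (m * 2)); rewrite -mulrDl h'| ]; ring.
apply/eqP; case: n => n.
  by elim: n => [//|n IH]; rewrite -addn1 PoszD step.
rewrite NegzE; elim: n => [//|n IH]; rewrite -step.
by have -> : - n.+2%:Z + 1 = - n.+1%:Z by lia.
Qed.

Section Theta.
Variable R : realType.
Local Notation K := (cplx R).

(** Terms of the theta series at [a]; as a sequence in [n] they are equally the Laurent coefficients
    of [theta (a * x) p] in [x]. *)
Definition tcoef (p a : K) (n : int) : K := (-1) ^ n * p ^ binz2 n * a ^ n.

Lemma tcoefS (p a : K) (n : int) : p != 0 -> a != 0 ->
  tcoef p a (n + 1) = - a * p ^ n * tcoef p a n.
Proof.
move=> p0 a0; have n1 : (-1 : K) != 0 by rewrite oppr_eq0 oner_eq0.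
rewrite /tcoef binz2S (expfzDr _ _ n1) (expfzDr _ _ p0) (expfzDr _ _ a0) !expr1z.
by move: ((-1) ^ n) (p ^ binz2 n) (p ^ n) (a ^ n) => A B C D; ring.
Qed.

Lemma tcoef_scale (p a x : K) n : tcoef p a n * x ^ n = tcoef p (a * x) n.
Proof. by rewrite /tcoef expfzMl mulrA. Qed.

(** Consecutive terms have ratio $|p|^kB'$, at most 1 from some rank on, so the sum of the initial
    terms bounds them all. *)
Lemma quad_bound (p B : K) : `|p| < 1 ->
  exists C : K, forall k : nat, `|p| ^+ 'C(k, 2) * `|B| ^+ k <= C.
Proof.
move=> p1; pose B' := `|B| + 1.
have B'0 : 0 <= B' by rewrite addr_ge0.
pose u k := `|p| ^+ 'C(k, 2) * B' ^+ k.
have u0 k : 0 <= u k by rewrite mulr_ge0// exprn_ge0.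
have [N hN] := expr_small B' p1.
have uS k : u k.+1 = u k * (`|p| ^+ k * `|B'|).
  by rewrite /u binS bin1 exprD exprS (ger0_norm B'0); ring.
exists (\sum_(0 <= i < N.+1) u i) => k.
apply: le_trans (_ : u k <= _).
  by rewrite ler_wpM2l ?exprn_ge0// lerXn2r ?nnegrE// lerDl.
have h i : (i <= N)%N -> u i <= \sum_(0 <= i < N.+1) u i.
  move=> iN; rewrite (bigD1_seq i) ?iota_uniq//= ?mem_index_iota// lerDl.
  by rewrite sumr_ge0.
have [kN|Nk] := leqP k N; first exact: h.
rewrite -(subnKC (ltnW Nk)); elim: (k - N)%N => [|j IH]; first by rewrite addn0 h.
by rewrite addnS uS; apply: le_trans IH; rewrite ler_piMr// hN// leq_addr.
Qed.

Lemma tcoef_norm_le (p a : K) (n : int) : 0 < `|p| < 1 -> a != 0 ->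
  `|tcoef p a n| <= `|p| ^+ 'C(`|n|, 2) * (`|a| + `|a|^-1) ^+ `|n|.
Proof.
move=> /andP[p0 p1] a0; rewrite /tcoef !normrM.
have -> : `|(-1) ^ n| = 1 :> K.
  by case: n => n; rewrite ?NegzE -?exprnN -?exprnP ?normfV normrX normrN1 expr1n ?invr1.
rewrite mul1r; apply: ler_pM => //; last exact: normz_le.
case: n => n.
  by rewrite binz2_nat absz_nat -exprnP normrX.
rewrite NegzE binz2_neg abszN absz_nat -exprnP normrX.
by rewrite exprD ler_piMr ?exprn_ge0// exprn_ile1// ltW.
Qed.

Lemma entire_tcoef (p a : K) : 0 < `|p| < 1 -> a != 0 -> entire (tcoef p a).
Proof.
move=> hp a0 B; have [_ p1] := andP hp.
have [C] := quad_bound ((`|a| + `|a|^-1) * B) p1.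
rewrite normrM (ger0_norm (_ : 0 <= `|a| + `|a|^-1)) ?addr_ge0 ?invr_ge0// => hC.
exists C => n; apply: le_trans (hC `|n|%N).
rewrite exprMn mulrA ler_wpM2r ?exprn_ge0//; exact: tcoef_norm_le.
Qed.

Lemma absum_tcoef (p a : K) : 0 < `|p| < 1 -> a != 0 -> absum (tcoef p a).
Proof.
move=> hp a0; have := entire_at (entire_tcoef hp a0) (oner_neq0 K).
by apply: absum_eq => n; rewrite exp1rz mulr1.
Qed.

(** The factor [n] is absorbed by $|n|\le2^{|n|}$, at the price of doubling the radius. *)
Lemma entire_intmul (c : int -> K) : entire c -> entire (fun n => n%:~R * c n).
Proof.
move=> hc B; have [C hC] := hc (2 * B); exists C => n; apply: le_trans (hC n).
rewrite (normrM n%:~R) (normrM 2 B) normr_nat exprMn [_ * `|c n|]mulrC -mulrA.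
apply: ler_wpM2l => //; apply: ler_wpM2r; first by rewrite exprn_ge0.
rewrite -intr_norm -natr_absz -natrX ler_nat.
exact: ltnW (ltn_expl _ _).
Qed.

Lemma seq_cvg_unique (u : nat -> K) (a b : K) :
  u n @[n --> \oo] --> a -> u n @[n --> \oo] --> b -> a = b.
Proof.
move=> ha hb; have hK := @norm_hausdorff _ K.
by rewrite -(cvg_lim hK ha) -(cvg_lim hK hb).
Qed.

Section TripleProduct.
Variable q : K.
Hypothesis hq : 0 < `|q| < 1.
Let q0 : q != 0. Proof. by rewrite -normr_gt0; case/andP: hq. Qed.
Let q1 : `|q| < 1. Proof. by case/andP: hq. Qed.

(** The reciprocal of $(q;q)_n$ with its usual value 0 at negative integers; this makes
    [qfact_inv_pred] hold for every integer and cuts off the finite triple product. *)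
Definition qfact_inv (n : int) : K := if n is Posz k then (ppoch q q k)^-1 else 0.

Lemma expr_neq1 (i : nat) : q ^+ i * q != 1.
Proof.
apply/eqP => /(congr1 Num.norm); rewrite normrM normr1 normrX -exprSr => /eqP.
by rewrite lt_eqF// exprn_ilt1.
Qed.

Lemma qfact_inv_pred (n : int) : qfact_inv (n - 1) = (1 - q ^ n) * qfact_inv n.
Proof.
case: n => [[|n]|n].
- by rewrite expr0z subrr mul0r.
- have -> : n.+1%:Z - 1 = n by lia.
  rewrite /= ppochS -exprnP exprSr invfM mulrCA divff ?mulr1//.
  by rewrite subr_eq0 eq_sym expr_neq1.
- have -> : Negz n - 1 = Negz n.+1 by lia.
  by rewrite mulr0.
Qed.

(* The coefficient at [x ^ n] of the finite product [(x; q)_N (q / x; q)_N]. *)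
Definition jtp_coef (x : K) (N : nat) (n : int) : K :=
  tcoef q x n * (ppoch q q (N + N) * (qfact_inv (N%:Z + n) * qfact_inv (N%:Z - n))).

(** Multiplication by the new factors $(1-q^Nx)(1-q^{N+1}/x)$, read on the terms of the
    expansion. *)
Lemma jtp_coefS (x : K) N n : x != 0 -> jtp_coef x N.+1 n =
  (1 + q ^+ (N + N).+1) * jtp_coef x N n
  - x * q ^+ N * jtp_coef x N (n - 1) - q ^+ N.+1 / x * jtp_coef x N (n + 1).
Proof.
move=> x0; rewrite /jtp_coef (tcoefS n q0 x0).
have hm : tcoef q x n = - x * q ^ (n - 1) * tcoef q x (n - 1).
  by rewrite -tcoefS// subrK.
have -> : tcoef q x (n - 1) = - (q / x) / q ^ n * tcoef q x n.
  rewrite hm expfzDr// exprN1; field.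
  by rewrite x0 q0 expfz_neq0.
rewrite addSn addnS !ppochS.
have e1 : N%:Z + n = (N.+1%:Z + n) - 1 by lia.
have e2 : N%:Z - n = (N.+1%:Z - n) - 1 by lia.
have e3 : N%:Z + (n - 1) = (N.+1%:Z + n) - 1 - 1 by lia.
have e4 : N%:Z - (n - 1) = N.+1%:Z - n by lia.
have e5 : N%:Z + (n + 1) = N.+1%:Z + n by lia.
have e6 : N%:Z - (n + 1) = (N.+1%:Z - n) - 1 - 1 by lia.
rewrite e3 e4 e5 e6 e1 e2 !qfact_inv_pred.
set A := qfact_inv _; set B := qfact_inv _.
have Q0 : q ^ n != 0 by rewrite expfz_neq0.
rewrite !(expfzDr _ _ q0) -!invr_expz expr1z -!exprnP !exprSr !exprD.
field; by rewrite q0 Q0 x0.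
Qed.

Lemma qfact_inv_bounded : exists2 M : K, 0 < M & forall n, `|qfact_inv n| <= M.
Proof.
have [M M0 hM] := ppoch_inv_bounded q1 expr_neq1.
by exists M => // -[n|n]; [exact: hM | rewrite normr0 ltW].
Qed.

Lemma jtp_coef_bounded : exists2 M : K, 0 <= M & forall x N n,
  `|jtp_coef x N n| <= M * `|tcoef q x n|.
Proof.
have [M M0 hM] := ppoch_bounded q1 q.
have [M' M'0 hM'] := qfact_inv_bounded.
exists (M * (M' * M')) => [|x N n]; first by rewrite mulr_ge0// mulr_ge0// ltW.
by rewrite !normrM mulrC ler_wpM2r// ler_pM ?mulr_ge0// ler_pM.
Qed.

Lemma absum_jtp_coef x N (h : int -> K) : absum (fun n => h n * tcoef q x n) ->
  absum (fun n => h n * jtp_coef x N n).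
Proof.
have [M M0 hM] := jtp_coef_bounded.
move=> /(absumZ M); apply: absum_le => n.
rewrite (normrM (h n)) (normrM M) (normrM (h n)) mulrCA (ger0_norm M0).
by apply: ler_wpM2l.
Qed.

Lemma absum_shift (f : int -> K) (m : int) : absum f -> absum (fun n => f (n + m)).
Proof. by apply: absum_inj => a b /addIr. Qed.

Lemma tsum_shift (f : int -> K) (m : int) : absum f -> tsum (fun n => f (n + m)) = tsum f.
Proof.
move=> fs; rewrite -(tsum_bij (h := fun n => n + m) _ fs)//.
by exists (fun n => n - m) => n; ring.
Qed.

(** The weight lets one recurrence serve twice: [h n = 1] yields the finite triple product,
    [h n = n] its derivative at [x = 1]. *)
Lemma tsum_jtp_coefS x N (h : int -> K) : x != 0 ->
  absum (fun n => h n * jtp_coef x N n) -> absum (fun n => h (n + 1) * jtp_coef x N n) ->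
  absum (fun n => h (n - 1) * jtp_coef x N n) ->
  tsum (fun n => h n * jtp_coef x N.+1 n) =
  (1 + q ^+ (N + N).+1) * tsum (fun n => h n * jtp_coef x N n)
  - x * q ^+ N * tsum (fun n => h (n + 1) * jtp_coef x N n)
  - q ^+ N.+1 / x * tsum (fun n => h (n - 1) * jtp_coef x N n).
Proof.
move=> x0 s1 s2 s3.
have s2' := absum_shift (-1) s2; have s3' := absum_shift 1 s3.
rewrite -(tsum_shift (-1) s2) -(tsum_shift 1 s3) -!tsumZ// -!tsumB//; try exact: absumZ.
  apply: eq_tsum => n; rewrite jtp_coefS// subrK addrK; ring.
by apply: absumB; exact: absumZ.
Qed.

Lemma absum_jtp x N : x != 0 -> absum (jtp_coef x N).
Proof.
move=> x0; have h : absum (fun n => 1 * tcoef q x n).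
  by apply: absum_eq (absum_tcoef hq x0) => n; rewrite mul1r.
by apply: absum_eq (absum_jtp_coef N h) => n; rewrite mul1r.
Qed.

Lemma jtp_coef0 x n : n != 0 -> jtp_coef x 0 n = 0.
Proof. by case: n => [[|n]|n] //= _; rewrite /jtp_coef /= ?mulr0 ?mul0r ?mulr0. Qed.

Lemma jtp_coef00 x : jtp_coef x 0 0 = 1.
Proof. by rewrite /jtp_coef /tcoef /= !expr0z !ppoch0 invr1 !mulr1. Qed.

Lemma finite_jtp x N : x != 0 ->
  ppoch x q N * ppoch (q / x) q N = tsum (jtp_coef x N).
Proof.
move=> x0; elim: N => [|N IH].
  by rewrite !ppoch0 (tsum1 (i0 := 0)) ?jtp_coef00 ?mulr1// => n; exact: jtp_coef0.
have h1 M n : 1 * jtp_coef x M n = jtp_coef x M n by rewrite mul1r.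
have s : absum (fun n => 1 * jtp_coef x N n) by apply: absum_eq (h1 N) (absum_jtp N x0).
have := @tsum_jtp_coefS x N (fun _ => 1) x0 s s s.
rewrite (eq_tsum (h1 N)) (eq_tsum (h1 N.+1)) -IH => ->.
rewrite !ppochS !exprS exprD; field; exact: x0.
Qed.

Lemma absum_jtp_intmul N : absum (fun n => n%:~R * jtp_coef 1 N n).
Proof.
apply: absum_jtp_coef; have := entire_intmul (entire_tcoef hq (oner_neq0 K)).
by move=> /entire_at /(_ (oner_neq0 K)); apply: absum_eq => n; rewrite exp1rz mulr1.
Qed.

(** The weighted sum is the derivative of $(x;q)_{N+1}(q/x;q)_{N+1}$ at its zero $x=1$, that is,
    minus the product of the other factors. The recurrence replaces differentiation. *)
Lemma finite_jacobi N :
  tsum (fun n => n%:~R * jtp_coef 1 N.+1 n) = - (ppoch q q N.+1 * ppoch q q N).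
Proof.
have hS M : tsum (fun n => n%:~R * jtp_coef 1 M.+1 n) =
    (1 - q ^+ M) * (1 - q ^+ M.+1) * tsum (fun n => n%:~R * jtp_coef 1 M n)
    - (q ^+ M - q ^+ M.+1) * tsum (jtp_coef 1 M).
  have s := absum_jtp_intmul M; have s0 := absum_jtp M (oner_neq0 K).
  have e1 n : (n + 1)%:~R * jtp_coef 1 M n = n%:~R * jtp_coef 1 M n + jtp_coef 1 M n.
    by rewrite rmorphD /= mulrDl mul1r.
  have e2 n : (n - 1)%:~R * jtp_coef 1 M n = n%:~R * jtp_coef 1 M n - jtp_coef 1 M n.
    by rewrite rmorphB /= mulrBl mul1r.
  rewrite tsum_jtp_coefS ?oner_neq0//; last 2 first.
  - by apply: absum_eq (absumD s s0) => n; rewrite e1.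
  - by apply: absum_eq (absumB s s0) => n; rewrite e2.
  rewrite (eq_tsum e1) (eq_tsum e2) tsumD// tsumB// divr1 !exprS exprD; ring.
elim: N => [|N IH].
  rewrite hS -finite_jtp ?oner_neq0// !ppoch0 ppochS ppoch0 expr0 subrr !mul0r !mulr1 mul1r.
  by rewrite sub0r mul1r.
rewrite hS IH -finite_jtp ?oner_neq0//.
(* After the base case the unweighted sum contains the factor $1-1$ and drops out of the
   recurrence. *)
have -> : ppoch 1 q N.+1 = 0.
  by rewrite /ppoch big_nat_recl// expr0 mul1r subrr mul0r.
by rewrite mul0r mulr0 subr0 !ppochS !exprSr; ring.
Qed.

Lemma jtp_coef_cvg x n :
  jtp_coef x N n @[N --> \oo] --> tcoef q x n / qpoch q q.
Proof.
have qq0 : qpoch q q != 0 by apply: qpoch_neq0 => // i; exact: expr_neq1.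
have hl : tcoef q x n / qpoch q q =
    tcoef q x n * (qpoch q q * ((qpoch q q)^-1 * (qpoch q q)^-1)) by field.
rewrite hl.
have hi (m : int) : qfact_inv (N%:Z + m) @[N --> \oo] --> (qpoch q q)^-1.
  have hV : (ppoch q q k)^-1 @[k --> \oo] --> (qpoch q q)^-1.
    by apply: cvgV => //; exact: qpoch_cvg.
  move/cvgrPdist_lt : hV => h.
  apply/cvgrPdist_lt => e e0; have [A _ hA] := h e e0.
  exists (A + `|m|)%N => // N /= hN.
  have [k [-> hk]] : exists k : nat, N%:Z + m = k /\ (A <= k)%N.
    by exists (absz (N%:Z + m)); split; lia.
  exact: hA.
apply: cvgM; first exact: cvg_cst.
apply: cvgM; last by apply: cvgM; exact: hi.
apply: cvg_comp (qpoch_cvg q1 (x := q)).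
by apply/cvgnyPge => A; exists A => // N /= hN; lia.
Qed.

Lemma jtp_limit x (h : int -> K) : absum (fun n => h n * tcoef q x n) ->
  tsum (fun n => h n * jtp_coef x N n) @[N --> \oo] -->
  tsum (fun n => h n * tcoef q x n) / qpoch q q.
Proof.
move=> hs; have [M M0 hM] := jtp_coef_bounded.
rewrite mulrC -tsumZ//.
apply: (tannery (g := fun n => M * (h n * tcoef q x n))).
- exact: absumZ.
- near=> N => n; rewrite (normrM (h n)) (normrM M) (normrM (h n)) mulrCA (ger0_norm M0).
  by apply: ler_wpM2l.
- move=> n; rewrite mulrCA [_^-1 * _]mulrC.
  apply: cvgM; [exact: cvg_cst | exact: jtp_coef_cvg].
Unshelve. all: by end_near.
Qed.

Lemma thetaE (x : K) : x != 0 -> theta x q = tsum (tcoef q x).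
Proof.
move=> x0; have qq0 : qpoch q q != 0 by apply: qpoch_neq0 => // i; exact: expr_neq1.
have s : absum (fun n => 1 * tcoef q x n).
  by apply: absum_eq (absum_tcoef hq x0) => n; rewrite mul1r.
have := jtp_limit s.
have -> : (fun N => tsum (fun n => 1 * jtp_coef x N n)) = (fun N => ppoch x q N * ppoch (q / x) q N).
  by apply/funext => N; rewrite finite_jtp//; apply: eq_tsum => n; rewrite mul1r.
have h2 : ppoch x q N * ppoch (q / x) q N @[N --> \oo] --> qpoch x q * qpoch (q / x) q.
  by apply: cvgM; exact: qpoch_cvg.
move=> /(seq_cvg_unique h2); rewrite /theta => ->.
by rewrite mulfVK//; apply: eq_tsum => n; rewrite mul1r.
Qed.

(** The left side is the derivative of [theta x q] at its zero [x = 1]; it supplies the normalising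
    constant of Kronecker's identity. *)
Lemma jacobi_cube : tsum (fun n => n%:~R * tcoef q 1 n) = - qpoch q q ^+ 3.
Proof.
have qq0 : qpoch q q != 0 by apply: qpoch_neq0 => // i; exact: expr_neq1.
have s : absum (fun n : int => n%:~R * tcoef q 1 n).
  have := entire_at (entire_intmul (entire_tcoef hq (oner_neq0 K))) (oner_neq0 K).
  by apply: absum_eq => n; rewrite exp1rz mulr1.
have h1 : tsum (fun n => n%:~R * jtp_coef 1 N.+1 n) @[N --> \oo] -->
    tsum (fun n : int => n%:~R * tcoef q 1 n) / qpoch q q.
  have /cvgrPdist_lt h := jtp_limit s; apply/cvgrPdist_lt => e e0.
  by have [A _ hA] := h e e0; exists A => // N /= AN; apply: hA; exact: leqW.
have h2 : - (ppoch q q N.+1 * ppoch q q N) @[N --> \oo] --> - (qpoch q q * qpoch q q).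
  apply: cvgN; apply: cvgM; last exact: qpoch_cvg.
  have /cvgrPdist_lt h := qpoch_cvg q1 (x := q); apply/cvgrPdist_lt => e e0.
  by have [A _ hA] := h e e0; exists A => // N /= AN; apply: hA; exact: leqW.
have E : (fun N => tsum (fun n => n%:~R * jtp_coef 1 N.+1 n)) =
    (fun N => - (ppoch q q N.+1 * ppoch q q N)).
  by apply/funext => N; exact: finite_jacobi.
rewrite E in h1; have := seq_cvg_unique h2 h1.
by move=> /(congr1 ( *%R^~ (qpoch q q))); rewrite mulfVK// => <-; ring.
Qed.

End TripleProduct.
End Theta.

(** * Kronecker's identity *)

Section Kronecker.
Variable R : realType.
Local Notation K := (cplx R).

Lemma int_ge0_nat (n : int) : 0 <= n -> exists m : nat, n = m.
Proof. by case: n => // m _; exists m. Qed.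

Lemma int_lt0_nat (n : int) : n < 0 -> exists m : nat, n = - m.+1%:Z.
Proof. by case: n => // m _; exists m; rewrite NegzE. Qed.

Lemma int_ind1 (P : int -> Prop) : P 0 -> (forall n, P n <-> P (n + 1)) -> forall n, P n.
Proof.
move=> P0 PS [n|n].
  by elim: n => [//|n IH]; rewrite -addn1 PoszD; exact: (PS _).1.
rewrite NegzE; elim: n => [|n IH]; apply: (PS _).2; first exact: P0.
by have -> : - n.+2%:Z + 1 = - n.+1%:Z by lia.
Qed.

Lemma int_ind2 (P : int -> Prop) : P 0 -> P 1 -> (forall n, P n <-> P (n + 2)) -> forall n, P n.
Proof.
move=> P0 P1 PS n; suff [] : P n /\ P (n + 1) by [].
elim/int_ind1: n => [//|n]; split=> -[h1 h2]; split=> //.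
  have -> : n + 1 + 1 = n + 2 by ring.
  exact: (PS n).1.
by apply: (PS n).2; have -> : n + 2 = n + 1 + 1 by ring.
Qed.

Lemma int_parity (P : int -> Prop) : (forall k, P (k * 2)) -> (forall k, P (k * 2 + 1)) -> forall n, P n.
Proof.
move=> P0 P1; apply: int_ind2 => [|| n]; [exact: (P0 0)|exact: (P1 0)|].
split=> _; [have := P0 ((n + 2) %/ 2)%Z; have := P1 ((n + 2) %/ 2)%Z
           | have := P0 (n %/ 2)%Z; have := P1 (n %/ 2)%Z].
  have [h|h] : ((n + 2) %/ 2)%Z * 2 = n + 2 \/ ((n + 2) %/ 2)%Z * 2 + 1 = n + 2 by lia.
    by rewrite h.
  by rewrite h.
have [h|h] : (n %/ 2)%Z * 2 = n \/ (n %/ 2)%Z * 2 + 1 = n by lia.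
  by rewrite h.
by rewrite h.
Qed.

(** The coefficients of $\sum_kc_kx^{2k}$: substitution of the square of the variable. *)
Definition dbl (c : int -> K) (n : int) : K :=
  if (n %% 2)%Z == 0 then c (n %/ 2)%Z else 0.

Lemma dbl_even c k : dbl c (k * 2) = c k.
Proof. by rewrite /dbl modzMl eqxx mulzK. Qed.

Lemma dbl_odd c k : dbl c (k * 2 + 1) = 0.
Proof. by rewrite /dbl modzMDl. Qed.

Lemma entire_dbl c : entire c -> entire (dbl c).
Proof.
move=> hc B; have [C hC] := hc (B ^+ 2); exists C; apply: int_parity => k.
  rewrite dbl_even; apply: le_trans (hC k).
  by rewrite normrX -exprM; have -> : absz (k * 2) = (2 * absz k)%N by lia.
rewrite dbl_odd normr0 mul0r; apply: le_trans (hC 0); by rewrite mulr_ge0// exprn_ge0.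
Qed.

Lemma tsum_even (f : int -> K) : absum f -> (forall k, f (k * 2 + 1) = 0) ->
  tsum f = tsum (fun k => f (k * 2)).
Proof.
move=> fs f0; apply: tsum_reindex => //; first by move=> a b; lia.
by apply: int_parity => k h //; have := h k; rewrite eqxx.
Qed.

Lemma conv_dbl c d : expgrow d -> entire c -> expgrow (dbl d) ->
  conv (dbl c) (dbl d) = dbl (conv c d).
Proof.
move=> hd hc hd2; apply/funext; apply: int_parity => k.
  rewrite dbl_even /conv tsum_even; last by move=> m; rewrite dbl_odd mul0r.
    by apply: eq_tsum => m; rewrite dbl_even -mulrBl dbl_even.
  by apply: conv_absum => //; exact: entire_dbl.
rewrite dbl_odd /conv; apply: tsum0; apply: int_parity => m; rewrite ?dbl_odd ?mul0r//.
by rewrite addrAC -mulrBl dbl_odd mulr0.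
Qed.

Lemma expgrow_dbl d : expgrow d -> expgrow (dbl d).
Proof.
move=> /expgrow_normalize[C [B [C0 B1 h]]]; exists C, B; split => //.
have B0 : 0 <= B := le_trans ler01 B1.
apply: int_parity => k; last by rewrite dbl_odd normr0 mulr_ge0// exprn_ge0.
rewrite dbl_even; apply: le_trans (h k) _; rewrite ler_wpM2l// ler_weXn2l//; lia.
Qed.

Lemma ev_dbl c (x : K) : absum_at c (x ^+ 2) ->
  absum_at (dbl c) x /\ ev (dbl c) x = ev c (x ^+ 2).
Proof.
move=> hc.
have xk (k : int) : x ^ (k * 2) = (x ^+ 2) ^ k by rewrite mulrC -exprz_exp.
have hs : absum_at (dbl c) x.
  have hi : injective (fun n : int => ((n %/ 2)%Z, (n %% 2)%Z == 0)).
    by move=> m n []; lia.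
  apply: absum_le (absum_inj hi (absum_prod hc (absum_fin (fun _ : bool => 1 : K)))).
  apply: int_parity => k /=; last by rewrite dbl_odd mul0r normr0.
  by rewrite dbl_even xk mulzK// mulr1.
split; first exact: hs.
have h0 k : dbl c (k * 2 + 1) * x ^ (k * 2 + 1) = 0 by rewrite dbl_odd mul0r.
rewrite /ev (tsum_even hs h0); apply: eq_tsum => k; rewrite dbl_even xk.
by [].
Qed.

(** Coefficients of $1/(1-x)$ expanded inside the unit disc. *)
Definition step (n : int) : K := if 0 <= n then 1 else 0.

Lemma expgrow_step : expgrow step.
Proof. by exists 1, 1; split => // n; rewrite expr1n mulr1 /step; case: ifP; rewrite ?normr1 ?normr0. Qed.

(** A two-sided geometric majorant. With [y = p / x] it is summable for $|p|<|x|<1$: a power [x ^ n]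
    with [n < 0] comes with [|n|] factors [p]. *)
Definition alpha (x y : K) (n : int) : K := if 0 <= n then x ^+ `|n| else y ^+ `|n|.

Lemma absum_alpha x y : `|x| < 1 -> `|y| < 1 -> absum (alpha x y).
Proof.
move=> x1 y1; apply: absum_le (absumD (absum_norm (absum_geo x1)) (absum_norm (absum_geo y1))) => n.
rewrite (ger0_norm (_ : 0 <= `|_| + `|_|)) ?addr_ge0// /alpha; case: ifP => _; by rewrite ?lerDl ?lerDr.
Qed.

(** Coefficients in $x$ of Kronecker's series $\sum_nx^n/(1-ap^n)$. *)
Definition kap (p a : K) (n : int) : K := (1 - p ^ n * a)^-1.

Section Base.
Variable p : K.
Hypothesis hp : 0 < `|p| < 1.
Let p0 : p != 0. Proof. by rewrite -normr_gt0; case/andP: hp. Qed.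
Let p1 : `|p| < 1. Proof. by case/andP: hp. Qed.
Let J := qpoch p p.

Lemma J_neq0 : J != 0.
Proof. by apply: qpoch_neq0 => // i; exact: expr_neq1. Qed.

Lemma annulus_neq0 (x : K) : `|p| < `|x| < 1 -> x != 0.
Proof.
by move=> /andP[h _]; rewrite -normr_gt0; apply: lt_trans h; case/andP: hp.
Qed.

Lemma theta_ev a x : a != 0 -> x != 0 -> ev (tcoef p a) x = theta (a * x) p.
Proof.
move=> a0 x0; rewrite (thetaE hp (mulf_neq0 a0 x0)).
by apply: eq_tsum => n; rewrite tcoef_scale.
Qed.

Lemma theta_px x : x != 0 -> theta (p * x) p = - x^-1 * theta x p.
Proof.
move=> x0; rewrite (thetaE hp x0) (thetaE hp (mulf_neq0 p0 x0)).
have s := absum_tcoef hp x0.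
rewrite -(tsum_shift 1 s) -(tsumZ _ (absum_shift 1 s)).
apply: eq_tsum => n; rewrite (tcoefS n p0 x0).
have -> : tcoef p (p * x) n = p ^ n * tcoef p x n by rewrite /tcoef expfzMl mulrCA.
by move: (tcoef p x n) (p ^ n) => T P; field.
Qed.

Lemma theta1 : theta 1 p = 0.
Proof.
suff -> : theta 1 p = 0 * qpoch (p / 1) p * qpoch p p by rewrite !mul0r.
congr (_ * _ * _); apply: (@seq_cvg_unique _ (fun n => ppoch 1 p n.+1)).
  have /cvgrPdist_lt h := qpoch_cvg p1 (x := 1); apply/cvgrPdist_lt => e e0.
  by have [A _ hA] := h e e0; exists A => // N /= AN; apply: hA; exact: leqW.
have -> : (fun n => ppoch 1 p n.+1) = (fun=> 0).
  by apply/funext => n; rewrite /ppoch big_nat_recl// expr0 mul1r subrr mul0r.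
exact: cvg_cst.
Qed.

Lemma theta_neq0 x : `|p| < `|x| < 1 -> theta x p != 0.
Proof.
move=> /andP[px x1]; have x0 : x != 0 by rewrite -normr_gt0; apply: lt_trans px; case/andP: hp.
have nz y : `|y| < 1 -> qpoch y p != 0.
  move=> y1; apply: qpoch_neq0 => // i; apply/eqP => /(congr1 Num.norm) /eqP.
  rewrite normrM normr1 normrX lt_eqF//.
  apply: le_lt_trans y1; rewrite ler_piMl// exprn_ile1// ltW//.
apply: mulf_neq0; last exact: J_neq0.
apply: mulf_neq0; apply: nz => //.
by rewrite normrM normfV ltr_pdivrMr ?normr_gt0// mul1r.
Qed.

Lemma inv_1B_bound (u r : K) : `|u| <= r -> r < 1 -> `|(1 - u)^-1| <= (1 - r)^-1.
Proof.
move=> ur r1; have d0 : 0 < 1 - r by rewrite subr_gt0.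
have h : 1 - r <= `|1 - u|.
  have h1 : (1 : K) <= `|1 - u| + `|u|.
    rewrite -[X in X <= _](normr1 K); have {1}-> : 1 = (1 - u) + u by rewrite subrK.
    exact: ler_normD.
  by rewrite lerBlDr; apply: le_trans h1 _; rewrite lerD2l.
rewrite normfV lef_pV2// posrE//; exact: lt_le_trans h.
Qed.

Lemma kap_den_neq0 a n : `|p| < `|a| < 1 -> 1 - p ^ n * a != 0.
Proof.
move=> /andP[pa a1]; have [pp _] := andP hp.
rewrite subr_eq0 eq_sym; apply/eqP => /(congr1 Num.norm) /eqP; rewrite normrM normr1.
have [n0|n0] := leP 0 n.
  have [m ->] := int_ge0_nat n0; rewrite -exprnP normrX lt_eqF//.
  by apply: le_lt_trans a1; rewrite ler_piMl// exprn_ile1// ltW.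
have [m ->] := int_lt0_nat n0; rewrite -exprnN normfV normrX => /eqP h.
have : `|a| <= `|p|.
  have -> : `|a| = `|p| ^+ m.+1.
    have pm : `|p| ^+ m.+1 != 0 by rewrite expf_neq0// gt_eqF.
    by apply: (mulfI (invr_neq0 pm)); rewrite h mulVf.
  by rewrite exprS ler_piMr// exprn_ile1// ltW.
by move=> /(lt_le_trans pa); rewrite ltxx.
Qed.

(** By the last two estimates [kap] differs from [step] by a geometrically small sequence: on the
    unit circle the series has the same singularity as $1/(1-x)$. *)
Lemma kap_bound a : `|p| < `|a| < 1 -> exists2 M : K, 0 <= M &
  forall n, [/\ `|kap p a n| <= M, n < 0 -> `|kap p a n| <= M * `|p| ^+ `|n| &
    0 <= n -> `|kap p a n - 1| <= M * `|p| ^+ `|n|].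
Proof.
move=> /andP[pa a1]; have a0 : 0 < `|a| by apply: lt_trans pa; case/andP: hp.
have a0' : a != 0 by rewrite -normr_gt0.
have r1 : `|p| / `|a| < 1 by rewrite ltr_pdivrMr// mul1r.
set M1 := (1 - `|a|)^-1; set M2 := `|a|^-1 * (1 - `|p| / `|a|)^-1.
have M10 : 0 <= M1 by rewrite invr_ge0 subr_ge0 ltW.
have M20 : 0 <= M2 by rewrite mulr_ge0// invr_ge0// subr_ge0 ltW.
exists (M1 + M2) => [|n]; first by rewrite addr_ge0.
have [n0|n0] := leP 0 n.
  have [m nm] := int_ge0_nat n0.
  have pn : `|p ^ n * a| <= `|a|.
    rewrite nm -exprnP normrM normrX ler_piMl// exprn_ile1// ltW//.
  have k1 : `|kap p a n| <= M1 by exact: inv_1B_bound.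
  have kne : 1 - p ^ n * a != 0.
    apply/eqP => /eqP; rewrite subr_eq0 => /eqP h; move: pn; rewrite -h normr1.
    by move=> /le_lt_trans /(_ a1); rewrite ltxx.
  split=> [|//|_]; first by apply: le_trans k1 _; rewrite lerDl.
  have -> : kap p a n - 1 = kap p a n * (p ^ n * a) by rewrite /kap; field.
  rewrite normrM; apply: ler_pM => //; first by apply: le_trans k1 _; rewrite lerDl.
  rewrite nm absz_nat -exprnP normrM normrX ler_piMr ?exprn_ge0//; exact: ltW.
have [m nm] := int_lt0_nat n0.
have pm0 : p ^+ m.+1 != 0 by rewrite expf_neq0.
have pr : `|p ^+ m.+1 / a| <= `|p| / `|a|.
  rewrite normrM normfV normrX ler_wpM2r ?invr_ge0// exprS ler_piMr// exprn_ile1// ltW//.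
have kne : 1 - p ^+ m.+1 / a != 0.
  apply/eqP => /eqP; rewrite subr_eq0 => /eqP h; move: pr; rewrite -h normr1.
  by move=> /le_lt_trans /(_ r1); rewrite ltxx.
have kne2 : a - p ^+ m.+1 != 0.
  have -> : a - p ^+ m.+1 = a * (1 - p ^+ m.+1 / a) by field.
  by rewrite mulf_neq0.
have kE : kap p a n = - (p ^+ m.+1 / a) * (1 - p ^+ m.+1 / a)^-1.
  rewrite /kap nm -exprnN; field.
  by rewrite kne2 a0' pm0 -opprB oppr_eq0 kne2.
have k2 : `|kap p a n| <= M2 * `|p| ^+ m.+1.
  rewrite kE normrM normrN normrM normfV normrX -mulrA mulrC ler_wpM2r ?exprn_ge0//.
  by rewrite ler_wpM2l ?invr_ge0//; exact: inv_1B_bound.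
have k3 : `|kap p a n| <= M2.
  by apply: le_trans k2 _; rewrite ler_piMr// exprn_ile1// ltW.
split=> [|_|//]; first by apply: le_trans k3 _; rewrite lerDr.
apply: le_trans k2 _; rewrite nm abszN absz_nat ler_wpM2r ?exprn_ge0//.
by rewrite lerDr.
Qed.

Lemma expgrow_kap a : `|p| < `|a| < 1 -> expgrow (kap p a).
Proof.
move=> /kap_bound[M M0 hM]; exists M, 1; split=> // n; rewrite expr1n mulr1.
by have [] := hM n.
Qed.

Lemma absum_kap_at a x : `|p| < `|a| < 1 -> `|p| < `|x| < 1 -> absum_at (kap p a) x.
Proof.
move=> /kap_bound[M M0 hM] /andP[px x1].
have x0 : 0 < `|x| by apply: lt_trans px; case/andP: hp.
have pxn : `|p / x| < 1 by rewrite normrM normfV ltr_pdivrMr// mul1r.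
apply: absum_le (absumZ M (absum_alpha x1 pxn)) => n.
have [h1 h2 _] := hM n.
rewrite !(normrM _ (_ ^ _)) (normrM M) (ger0_norm M0) /alpha.
case: leP => n0.
  have [m nm] := int_ge0_nat n0.
  by rewrite nm absz_nat in h1 *; rewrite ler_wpM2r.
have [m nm] := int_lt0_nat n0.
have -> : `|(p / x) ^+ `|n| | = `|p| ^+ `|n| * `|x ^ n|.
  by rewrite nm abszN absz_nat -exprnN -normrX -normrM expr_div_n.
by rewrite mulrA ler_wpM2r// h2.
Qed.

Lemma absum_kap_step a : `|p| < `|a| < 1 -> absum (fun n => kap p a n - step n).
Proof.
move=> /kap_bound[M M0 hM]; apply: absum_le (absumZ M (absum_geo p1)) => n.
rewrite (normrM M) (ger0_norm M0) normrX; have [_ h2 h3] := hM n.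
by rewrite /step; case: leP => n0; rewrite ?subr0; [exact: h3|exact: h2].
Qed.

Lemma tcoef_total : tsum (tcoef p 1) = 0.
Proof. by rewrite -(thetaE hp (oner_neq0 K)) theta1. Qed.

(* The coefficients of [theta x p / (1 - x)], i.e. the partial sums of those of
   [theta]: since the latter add up to 0, they decay in both directions. *)
Definition theta_red : int -> K := conv (tcoef p 1) step.

Lemma theta_redE n : theta_red n = tsum (fun m => if m <= n then tcoef p 1 m else 0).
Proof.
apply: eq_tsum => m; rewrite /step subr_ge0; case: ifP; by rewrite ?mulr1 ?mulr0.
Qed.

Lemma absum_if (I : choiceType) (P : pred I) (f : I -> K) :
  absum f -> absum (fun i => if P i then f i else 0).
Proof. by apply: absum_le => i; case: ifP; rewrite ?normr0. Qed.

Lemma entire_theta_red : entire theta_red.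
Proof.
have n1 := oner_neq0 K; have hj := entire_tcoef hp n1; have s := absum_tcoef hp n1.
move=> B0; pose B := `|B0| + 1.
have B1 : 1 <= B by rewrite lerDr.
have BB : 0 <= B := le_trans ler01 B1.
have [M M0 hM] := absum_bound (entire_bound hj B1); exists M => n.
apply: le_trans (_ : `|theta_red n| * B ^+ `|n| <= _).
  by rewrite ler_wpM2l// lerXn2r ?nnegrE// lerDl.
have -> : B ^+ `|n| = `|B ^+ `|n| | by rewrite ger0_norm ?exprn_ge0.
(* The partial sum for [n < 0], and the complementary tail for [n >= 0], only involve indices with
   [|m| >= |n|], so [B ^+ |n|] can be moved under the sum as [B ^+ |m|]. *)
suff key (P : pred int) : (forall m, P m -> (`|n| <= `|m|)%N) ->
    `|tsum (fun m => if P m then tcoef p 1 m else 0)| * `|B ^+ `|n| | <= M.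
  have [n0|n0] := leP 0 n; last by rewrite theta_redE; apply: key => m; lia.
  have -> : theta_red n = - tsum (fun m => if n < m then tcoef p 1 m else 0).
    rewrite theta_redE; apply/eqP; rewrite -addr_eq0 -tsumD; [|exact: absum_if..].
    apply/eqP; rewrite -[RHS]tcoef_total; apply: eq_tsum => m.
    by case: leP => _; rewrite ?addr0 ?add0r.
  by rewrite normrN; apply: key => m; lia.
move=> hP; rewrite -normrM mulrC -tsumZ; last exact: absum_if.
apply: tsum_norm => A; apply: le_trans (hM A); apply: ler_sum => m _.
rewrite (normrM (B ^+ _)) (normrM (tcoef p 1 m)) mulrC.
case: (boolP (P m)) => [/hP h|_]; last by rewrite normr0 mul0r mulr_ge0.
by rewrite ler_wpM2l// !ger0_norm ?exprn_ge0// ler_weXn2l.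
Qed.

(** Summation by parts: $\sum n(c_n-c_{n-1})=-\sum c_n$ for the partial sums $c_n$, and the left
    side is Jacobi's sum. *)
Lemma ev_theta_red1 : ev theta_red 1 = J ^+ 3.
Proof.
have n1 := oner_neq0 K; have s := absum_tcoef hp n1.
have hr := entire_theta_red.
have E n : theta_red n = theta_red (n - 1) + tcoef p 1 n.
  have h : tsum (fun m => if m == n then tcoef p 1 m else 0) = tcoef p 1 n.
    by rewrite (tsum1 (i0 := n)) ?eqxx// => m /negbTE ->.
  rewrite !theta_redE -h -tsumD; [|exact: absum_if..]; apply: eq_tsum => m.
  have -> : (m <= n - 1) = (m < n) by lia.
  by case: (ltgtP m n) => _; rewrite ?addr0 ?add0r.
have s1 : absum (fun n : int => n%:~R * theta_red n).
  have := entire_at (entire_intmul hr) n1.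
  by apply: absum_eq => n; rewrite exp1rz mulr1.
have s0 : absum theta_red.
  by have := entire_at hr n1; apply: absum_eq => n; rewrite exp1rz mulr1.
have := jacobi_cube hp; rewrite (@eq_tsum _ _ (fun n => n%:~R * theta_red n -
   ((n - 1)%:~R * theta_red (n - 1) + theta_red (n - 1)))); last first.
  by move=> n; rewrite {1}E rmorphB /=; ring.
rewrite tsumB//; last by apply: absumD; [exact: (absum_shift (-1) s1)|exact: absum_shift].
rewrite (tsum_shift (-1) (absumD s1 s0)) tsumD// opprD addrA subrr sub0r.
move=> /oppr_inj <-; apply: eq_tsum => n; by rewrite exp1rz mulr1.
Qed.

(** Kronecker's identity on coefficients. The convolution inherits the recurrence of
    [theta (a * x) p]; its constant is found at [x = 1], where the zero of theta kills [kap - step]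
    and the part [step] contributes through [theta_red]. *)
Lemma conv_kap a : `|p| < `|a| < 1 ->
  conv (tcoef p 1) (kap p a) = (fun n => J ^+ 3 / theta a p * tcoef p a n).
Proof.
move=> ha; have a0 := annulus_neq0 ha.
have n1 := oner_neq0 K; have hj := entire_tcoef hp n1.
have hk := expgrow_kap ha.
set g := conv _ _.
have kne n : 1 - p ^ n * a != 0 by exact: kap_den_neq0.
have gS n : g (n + 1) = - a * p ^ n * g n.
  apply/eqP; rewrite -subr_eq0 mulNr mulNr opprK; apply/eqP.
  rewrite /g /conv -(tsum_shift 1 (conv_absum (n + 1) hj hk)) -tsumZ; last exact: conv_absum.
  rewrite -tsumD; last 2 first.
  - exact: (absum_shift 1 (conv_absum (n + 1) hj hk)).
  - by apply: absumZ; exact: conv_absum.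
  (* The two terms combine to [tcoef p 1 (m + 1)] times $1-p^{n-m}a$, which cancels the denominator;
     what remains is the vanishing total of the theta coefficients. *)
  rewrite (@eq_tsum _ _ (fun m => tcoef p 1 (m + 1))); last first.
    move=> m; rewrite tcoefS//.
    have -> : n + 1 - (m + 1) = n - m by ring.
    have -> : p ^ n = p ^ m * p ^ (n - m) by rewrite -expfzDr// addrC subrK.
    rewrite /kap; field; exact: kne.
  rewrite tsum_shift ?tcoef_total//; exact: absum_tcoef.
have gE n : g n = g 0 * tcoef p a n.
  elim/int_ind1: n => [|n]; first by rewrite /tcoef !expr0z !mulr1.
  rewrite gS tcoefS//; split=> [->|h]; first by ring.
  have u0 : - a * p ^ n != 0 by rewrite mulf_neq0 ?oppr_eq0 ?expfz_neq0.
  by apply: (mulfI u0); rewrite h; ring.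
suff g0 : g 0 * theta a p = J ^+ 3.
  apply/funext => n; rewrite gE -g0 mulfK//; exact: theta_neq0.
have s' : absum_at (fun n => kap p a n - step n) 1.
  by apply: absum_eq (absum_kap_step ha) => n; rewrite exp1rz mulr1.
have [h1 h2] := ev_conv n1 hj s'.
rewrite (theta_ev n1 n1) mulr1 theta1 mul0r in h2.
have hd n : g n = conv (tcoef p 1) (fun n => kap p a n - step n) n + theta_red n.
  have hs : absum (fun m => tcoef p 1 m * (kap p a (n - m) - step (n - m))).
    apply: absum_eq (absumB (conv_absum n hj hk) (conv_absum n hj expgrow_step)) => m.
    by rewrite mulrBr.
  rewrite /theta_red /conv -tsumD//; last exact: conv_absum expgrow_step.
  by apply: eq_tsum => m; rewrite -mulrDr subrK.
have h3 : ev g 1 = J ^+ 3.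
  rewrite -ev_theta_red1 -[RHS]add0r -h2 /ev -tsumD//; last exact: entire_at entire_theta_red n1.
  by apply: eq_tsum => n; rewrite hd mulrDl.
rewrite -h3 (thetaE hp a0) -tsumZ; last exact: absum_tcoef.
by apply: eq_tsum => n; rewrite exp1rz mulr1 -gE.
Qed.

Lemma kronecker a x : `|p| < `|a| < 1 -> `|p| < `|x| < 1 ->
  ev (kap p a) x = J ^+ 3 * theta (a * x) p / (theta a p * theta x p).
Proof.
move=> ha hx.
have a0 : a != 0 := annulus_neq0 ha; have x0 : x != 0 := annulus_neq0 hx; have n1 := oner_neq0 K.
have ta := theta_neq0 ha; have tx := theta_neq0 hx.
have [_] := ev_conv x0 (entire_tcoef hp n1) (absum_kap_at ha hx).
rewrite (conv_kap ha) (theta_ev n1 x0) mul1r => h.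
have -> : J ^+ 3 * theta (a * x) p = theta a p * (theta x p * ev (kap p a) x).
  have s1 := entire_at (entire_tcoef hp a0) x0.
  have s2 : absum (fun n => J ^+ 3 / theta a p * tcoef p a n * x ^ n).
    by apply: absum_eq (absumZ (J ^+ 3 / theta a p) s1) => n; rewrite mulrA.
  rewrite -h -(theta_ev a0 x0) {1 2}/ev -(tsumZ _ s1) -(tsumZ _ s2).
  apply: eq_tsum => n; move: (x ^ n) (tcoef p a n) => X T; field; exact: ta.
by move: (theta a p) (theta x p) (ev _ _) ta tx => A B C ta tx; field; rewrite ta tx.
Qed.

End Base.
End Kronecker.

(* Unification would otherwise unfold these down to the underlying limits. *)
Local Opaque theta qpoch tsum.

(** * Splitting and merging theta functions of nomes $q$ and $q^2$ *)

Section ThetaProducts.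
Variable R : realType.
Local Notation K := (cplx R).

Lemma seq_cvg_subseq (u : nat -> K) (f : nat -> nat) (l : K) :
  (forall n, (n <= f n)%N) -> u n @[n --> \oo] --> l -> u (f n) @[n --> \oo] --> l.
Proof.
move=> hf /cvgrPdist_lt h; apply/cvgrPdist_lt => e e0.
have [A _ hA] := h e e0; exists A => // N /= AN; apply: hA; exact: leq_trans (hf N).
Qed.

Section Base.
Variable q : K.
Hypothesis hq : 0 < `|q| < 1.
Let q0 : q != 0. Proof. by rewrite -normr_gt0; case/andP: hq. Qed.
Let q1 : `|q| < 1. Proof. by case/andP: hq. Qed.

Lemma norm_expr_lt1 k : (0 < k)%N -> 0 < `|q ^+ k| < 1.
Proof.
move=> k0; rewrite normr_gt0 (expf_neq0 _ q0) /= normrX.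
by rewrite (exprn_ilt1 _ (normr_ge0 q) q1) -lt0n.
Qed.

Let hq2 : 0 < `|q ^+ 2| < 1. Proof. by apply: norm_expr_lt1. Qed.
Let q21 : `|q ^+ 2| < 1. Proof. by case/andP: hq2. Qed.

Lemma qpoch_split (x : K) : qpoch x q = qpoch x (q ^+ 2) * qpoch (q * x) (q ^+ 2).
Proof.
have E n : ppoch x q (n + n) = ppoch x (q ^+ 2) n * ppoch (q * x) (q ^+ 2) n.
  elim: n => [|n IH]; first by rewrite !ppoch0 mulr1.
  rewrite addSn addnS !ppochS IH -!exprM mul2n -addnn !exprS.
  by move: (ppoch x (q ^+ 2) n) (ppoch (q * x) (q ^+ 2) n) (q ^+ (n + n)) => A B Q; ring.
apply: (@seq_cvg_unique _ (fun n => ppoch x q (n + n))).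
  by apply: seq_cvg_subseq (qpoch_cvg q1 (x := x)) => n; exact: leq_addr.
have -> : (fun n => ppoch x q (n + n)) =
    (fun n => ppoch x (q ^+ 2) n * ppoch (q * x) (q ^+ 2) n) by apply/funext.
by apply: cvgM; exact: qpoch_cvg.
Qed.

Lemma qpoch_sqr (x : K) : qpoch x q * qpoch (- x) q = qpoch (x ^+ 2) (q ^+ 2).
Proof.
have E n : ppoch (x ^+ 2) (q ^+ 2) n = ppoch x q n * ppoch (- x) q n.
  elim: n => [|n IH]; first by rewrite !ppoch0 mulr1.
  rewrite !ppochS IH -exprM mulnC exprM.
  by move: (ppoch x q n) (ppoch (- x) q n) (q ^+ n) => A B Q; ring.
apply: (@seq_cvg_unique _ (fun n => ppoch (x ^+ 2) (q ^+ 2) n)); last exact: qpoch_cvg.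
have -> : (fun n => ppoch (x ^+ 2) (q ^+ 2) n) =
    (fun n => ppoch x q n * ppoch (- x) q n) by apply/funext.
by apply: cvgM; exact: qpoch_cvg.
Qed.

Lemma thetaF (x p : K) : theta x p = qpoch x p * qpoch (p / x) p * qpoch p p.
Proof. by []. Qed.

Lemma theta_split (x : K) : x != 0 ->
  theta x q = theta x (q ^+ 2) * theta (q * x) (q ^+ 2) *
    (qpoch q q / qpoch (q ^+ 2) (q ^+ 2) ^+ 2).
Proof.
move=> x0; have J2 := J_neq0 hq2; rewrite !thetaF !(qpoch_split x) !(qpoch_split (q / x)).
have -> : q ^+ 2 / (q * x) = q / x by field; rewrite q0 x0.
have -> : q * (q / x) = q ^+ 2 / x by field.
move: (qpoch q q) (qpoch (q ^+ 2) (q ^+ 2)) J2 => J1 J2 J20.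
move: (qpoch x (q ^+ 2)) (qpoch (q * x) (q ^+ 2)) (qpoch (q / x) (q ^+ 2)) (qpoch (q ^+ 2 / x) (q ^+ 2)) => A B C D.
by field.
Qed.

Lemma theta_sqr (x : K) : x != 0 ->
  theta x q * theta (- x) q = theta (x ^+ 2) (q ^+ 2) *
    (qpoch q q ^+ 2 / qpoch (q ^+ 2) (q ^+ 2)).
Proof.
move=> x0; have J2 := J_neq0 hq2; rewrite !thetaF.
have -> : q / - x = - (q / x) by field.
have -> : q ^+ 2 / x ^+ 2 = (q / x) ^+ 2 by field.
rewrite -(qpoch_sqr x) -(qpoch_sqr (q / x)).
move: (qpoch q q) (qpoch (q ^+ 2) (q ^+ 2)) J2 => J1 J2 J20.
move: (qpoch x q) (qpoch (- x) q) (qpoch (q / x) q) (qpoch (- (q / x)) q) => A B C D.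
by field.
Qed.

Lemma JprodE m : (0 < m)%N -> Jprod q m = qpoch (q ^+ m) (q ^+ m).
Proof.
move=> m0; have /andP[_ qm1] := norm_expr_lt1 m0.
rewrite /Jprod; apply/cvg_lim; first exact: norm_hausdorff.
have -> : (fun n => \prod_(1 <= i < n.+1) (1 - q ^+ (m * i))) = ppoch (q ^+ m) (q ^+ m).
  apply/funext => n; rewrite big_add1 /=; apply: eq_bigr => i _.
  by rewrite -exprSr -exprM.
exact: qpoch_cvg.
Qed.

Lemma dil_tcoef (a : K) n : a != 0 -> q ^ n * tcoef q a n = - a^-1 * tcoef q a (n + 1).
Proof.
move=> a0; rewrite tcoefS//; move: (tcoef q a n) (q ^ n) => T Q; by field.
Qed.

(** Coefficient form of the product of [theta (a * x) q] and [theta (- a * x) q]. A recurrence of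
    step 2 leaves two constants: the odd one vanishes by symmetry, the even one is read off at
    $x=s/a$, with [s] in an annulus free of zeros. *)
Lemma conv_tcoef_opp (a s : K) : a != 0 -> `|q| < `|s| < 1 ->
  conv (tcoef q a) (tcoef q (- a)) =
  (fun n => qpoch q q ^+ 2 / qpoch (q ^+ 2) (q ^+ 2) * dbl (tcoef (q ^+ 2) (a ^+ 2)) n).
Proof.
move=> a0 hs; have s0 := annulus_neq0 hq hs.
have na0 : - a != 0 by rewrite oppr_eq0.
have e1 := entire_tcoef hq a0; have e2 := entire_tcoef hq na0.
have g1 := entire_expgrow e1; have g2 := entire_expgrow e2.
set h := conv _ _; set t := dbl _.
have q20 : q ^+ 2 != 0 by rewrite expf_neq0.
have a20 : a ^+ 2 != 0 by rewrite expf_neq0.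
have hS n : h (n + 2) = - a ^+ 2 * q ^ n * h n.
  have c1 := conv_absum (n + 2) e1 g2; have c0 := conv_absum n e1 g2.
  rewrite /h /conv -(tsum_shift 1 c1) -(tsumZ _ c0); apply: eq_tsum => m.
  have -> : n + 2 - (m + 1) = (n - m) + 1 by ring.
  rewrite !tcoefS//; have -> : q ^ n = q ^ m * q ^ (n - m) by rewrite -expfzDr// addrC subrK.
  by move: (tcoef q a m) (tcoef q (- a) (n - m)) (q ^ m) (q ^ (n - m)) => A B C D; ring.
have tS n : t (n + 2) = - a ^+ 2 * q ^ n * t n.
  elim/int_parity: n => k; rewrite /t.
    have -> : k * 2 + 2 = (k + 1) * 2 by ring.
    rewrite !dbl_even tcoefS//; congr (_ * _ * _).
    by rewrite mulrC -exprz_exp.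
  have -> : k * 2 + 1 + 2 = (k + 1) * 2 + 1 by ring.
  by rewrite !dbl_odd mulr0.
have t0 : t 0 = 1.
  by have := dbl_even (tcoef (q ^+ 2) (a ^+ 2)) 0; rewrite mul0r /tcoef !expr0z !mulr1.
have t1 : t 1 = 0 by have := dbl_odd (tcoef (q ^+ 2) (a ^+ 2)) 0; rewrite mul0r add0r.
(* Reversing the convolution, [m] to [1 - m], exchanges [a] with [- a] and changes the sign of the
   sum. *)
have h1 : h 1 = 0.
  have hb : bijective (fun m : int => 1 - m) by exists (fun m => 1 - m) => m; ring.
  have c1 := conv_absum 1 e1 g2.
  have : h 1 = - h 1.
    rewrite {1}/h /conv (tsum_bij hb c1) /h /conv -(tsumN c1); apply: eq_tsum => m.
    have -> : 1 - (1 - m) = m by ring.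
    rewrite /tcoef; have -> : (- a) ^ m = (-1) ^ m * a ^ m by rewrite -expfzMl mulN1r.
    have -> : (- a) ^ (1 - m) = (-1) ^ (1 - m) * a ^ (1 - m) by rewrite -expfzMl mulN1r.
    have -> : (-1) ^ (1 - m) = - (-1) ^ m :> K.
      have n1 : (-1 : K) != 0 by rewrite oppr_eq0 oner_eq0.
      by rewrite (expfzDr _ _ n1) expr1z -exprz_inv invrN1 mulN1r.
    move: ((-1) ^ m) (q ^ binz2 m) (q ^ binz2 (1 - m)) (a ^ m) (a ^ (1 - m)) => A B C D E; ring.
  move/eqP; rewrite -addr_eq0 -mulr2n mulrn_eq0 /= => /eqP; exact.
have hE n : h n = h 0 * t n.
  elim/int_ind2: n => [||n]; first by rewrite t0 mulr1.
    by rewrite t1 h1 mulr0.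
  rewrite hS tS; split=> [->|hh]; first by ring.
  have u0 : - a ^+ 2 * q ^ n != 0 by rewrite mulf_neq0 ?oppr_eq0 ?expfz_neq0.
  by apply: (mulfI u0); rewrite hh; ring.
suff -> : qpoch q q ^+ 2 / qpoch (q ^+ 2) (q ^+ 2) = h 0 by apply/funext.
have sa0 : s / a != 0 by rewrite mulf_neq0 ?invr_neq0.
have [_] := ev_conv sa0 e1 (entire_at e2 sa0).
have Es : a * (s / a) = s by field.
rewrite (theta_ev hq a0 sa0) (theta_ev hq na0 sa0) mulNr Es -/h (theta_sqr s0).
have hs2 : `|q ^+ 2| < `|s ^+ 2| < 1.
  case/andP: hs => qs s1; rewrite !normrX exprn_ilt1// andbT ltrXn2r// nnegrE//.
have ht := theta_neq0 hq2 hs2.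
have sa2 : (s / a) ^+ 2 != 0 by rewrite expf_neq0.
have ea : absum_at (tcoef (q ^+ 2) (a ^+ 2)) ((s / a) ^+ 2).
  exact: entire_at (entire_tcoef hq2 a20) sa2.
have [ht1 ht2] := ev_dbl ea.
have -> : ev h (s / a) = h 0 * theta (s ^+ 2) (q ^+ 2).
  have -> : s ^+ 2 = a ^+ 2 * (s / a) ^+ 2 by field.
  rewrite -(theta_ev hq2 a20 sa2) -ht2 /ev -(tsumZ _ ht1); apply: eq_tsum => n.
  by rewrite hE mulrA.
move=> /eqP; rewrite [X in _ == X]mulrC => /eqP /(mulIf ht) <-.
by [].
Qed.

End Base.
End ThetaProducts.

(** * A lattice identity for Lerch sums *)

(** These are the exponents of the lattice sums in [th3_product]. In the negative quadrant they must
    gain [|k| + |n|], one factor of the base for each negative power, as [quadrant_bound]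
    demands. *)
Lemma square_form_ge0 (k n : int) : 0 <= k -> 0 <= n -> 0 <= k * k + 2 * (k * n).
Proof. nia. Qed.

Lemma square_form_lt0 (k n : int) : k < 0 -> n < 0 ->
  `|k|%N%:Z + `|n|%N%:Z <= k * k + 2 * (k * n).
Proof. nia. Qed.

Lemma prod_form_ge0 (k n : int) : 0 <= k -> 0 <= n -> 0 <= 2 * (k * n).
Proof. nia. Qed.

Lemma prod_form_lt0 (k n : int) : k < 0 -> n < 0 -> `|k|%N%:Z + `|n|%N%:Z <= 2 * (k * n).
Proof. nia. Qed.

Section LatticeIdentity.
Variable R : realType.
Local Notation K := (cplx R).

(* 1 on the nonnegative quadrant, -1 on the negative one: the signs of the
   expansion of [1 / (1 - p ^ k * x)] in powers of [x], for |p| < |x| < 1. *)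
Definition wt (k n : int) : K :=
  if (0 <= k) && (0 <= n) then 1 else if (k < 0) && (n < 0) then -1 else 0.

(** The left side is $[k\ge0]-[n<0]$ for $d>0$, $[n\ge0]-[k<0]$ for $d<0$ and $[k\ge0]+[n\ge0]-1$
    for $d=0$; these agree. As [d] is free, a sum over the quadrants can be cut along any linear
    form. *)
Lemma wt_identity (k n d : int) : wt k d + wt n (- d) - (if d == 0 then 1 else 0) = wt k n.
Proof.
have E1 : (- d < 0) = (0 < d) by lia.
have E2 : (0 <= - d) = (d <= 0) by lia.
rewrite /wt E1 E2.
by case: (ltgtP d 0) => _; case: (leP 0 k) => _; case: (leP 0 n) => _ /=; ring.
Qed.

Lemma tsum_geo_nat (x : K) : `|x| < 1 -> tsum (fun n : nat => x ^+ n) = (1 - x)^-1.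
Proof.
move=> x1; have s := absum_geo_nat x1.
have d0 : 1 - x != 0.
  by rewrite subr_eq0; apply/eqP => h; move: x1; rewrite -h normr1 ltxx.
have h1 := tsum_nat_cvg s.
have E n : \sum_(0 <= i < n) x ^+ i = (1 - x)^-1 - (1 - x)^-1 * x ^+ n.
  apply: (mulfI d0); rewrite mulrBr mulrA mulfV// mul1r big_mkord.
  by rewrite -opprB mulNr -subrX1 opprB.
have h2 : \sum_(0 <= i < n) x ^+ i @[n --> \oo] --> (1 - x)^-1.
  have -> : (fun n => \sum_(0 <= i < n) x ^+ i) = (fun n => (1 - x)^-1 - (1 - x)^-1 * x ^+ n).
    by apply/funext.
  apply/cvgrPdist_lt => e e0.
  have [N hN] := expr_small ((1 - x)^-1 * 2 / e) x1; exists N => // n /= /hN.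
  rewrite opprB addrCA subrr addr0 !normrM normrX normfV normr_nat normfV (ger0_norm (ltW e0)).
  set u := `|1 - x|^-1; set v := `|x| ^+ n => h.
  have h' : u * v * 2 <= e.
    have -> : u * v * 2 = (v * (u * 2 / e)) * e by field; rewrite gt_eqF.
    by rewrite -[leRHS]mul1r ler_wpM2r// ltW.
  have uv0 : 0 <= u * v by rewrite mulr_ge0// ?invr_ge0// exprn_ge0.
  have [->//|uv] := eqVneq (u * v) 0.
  apply: lt_le_trans h'; rewrite mulr_natr mulr2n ltrDl lt_def uv//.
exact: (seq_cvg_unique h1 h2).
Qed.

Lemma absum_geo_half (x : K) : `|x| < 1 -> absum (fun n : int => if 0 <= n then x ^ n else 0).
Proof.
move=> x1; apply: absum_le (absum_geo x1) => n.
case: leP => n0; last by rewrite normr0.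
by have [m ->] := int_ge0_nat n0; rewrite absz_nat.
Qed.

Lemma tsum_geo_ge0 (x : K) : `|x| < 1 ->
  tsum (fun n : int => if 0 <= n then x ^ n else 0) = (1 - x)^-1.
Proof.
move=> x1; rewrite -(tsum_geo_nat x1).
rewrite (tsum_reindex (h := Posz) _ (absum_geo_half x1)) => [||n hn].
- exact: eq_tsum.
- by move=> a b [].
- case: leP => // n0; have [m nm] := int_ge0_nat n0.
  by have := hn m; rewrite nm eqxx.
Qed.

Lemma absum_geo_lt0 (x : K) : 1 < `|x| -> absum (fun n : int => if n < 0 then x ^ n else 0).
Proof.
move=> x1; have x0 : 0 < `|x| by apply: lt_trans x1.
have v1 : `|x^-1| < 1 by rewrite normfV invf_lt1.
apply: absum_le (absum_geo v1) => n; case: ltP => n0; last by rewrite normr0.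
by have [m ->] := int_lt0_nat n0; rewrite abszN absz_nat -exprnN exprVn.
Qed.

Lemma tsum_geo_lt0 (x : K) : 1 < `|x| ->
  tsum (fun n : int => if n < 0 then x ^ n else 0) = - (1 - x)^-1.
Proof.
move=> x1; have x0 : 0 < `|x| by apply: lt_trans x1.
have x0' : x != 0 by rewrite -normr_gt0.
have v1 : `|x^-1| < 1 by rewrite normfV invf_lt1.
have d0 : 1 - x != 0.
  by rewrite subr_eq0; apply/eqP => h; move: x1; rewrite -h normr1 ltxx.
have d1 : x - 1 != 0 by rewrite -opprB oppr_eq0.
have -> : - (1 - x)^-1 = x^-1 * (1 - x^-1)^-1 by field; rewrite d1 x0' d0.
rewrite -(tsum_geo_nat v1) -(tsumZ _ (absum_geo_nat v1)).
rewrite (tsum_reindex (h := fun m : nat => - m.+1%:Z) _ (absum_geo_lt0 x1)) => [||n hn].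
- apply: eq_tsum => m; have -> : (- m.+1%:Z < 0) = true by lia.
  by rewrite -exprnN -exprVn exprS.
- by move=> a b; lia.
- case: ltP => // n0; have [m nm] := int_lt0_nat n0.
  by have := hn m; rewrite nm eqxx.
Qed.

Section Base.
Variable p : K.
Hypothesis hp : 0 < `|p| < 1.
Let p1 : `|p| < 1. Proof. by case/andP: hp. Qed.

Lemma normz_le_expr (e : int) (m : nat) : m%:Z <= e -> `|p ^ e| <= `|p| ^+ m.
Proof.
case: e => e; last by lia.
by move=> h; rewrite -exprnP normrX ler_wiXn2l// ltW.
Qed.

Lemma kap_expand (x : K) (k : int) : `|p| < `|x| < 1 ->
  absum (fun n => wt k n * (p ^ (k * n) * x ^ n)) /\
  kap p x k = tsum (fun n => wt k n * (p ^ (k * n) * x ^ n)).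
Proof.
move=> /andP[px x1]; rewrite /kap; have pp : 0 < `|p| by case/andP: hp.
have E n : p ^ (k * n) * x ^ n = (p ^ k * x) ^ n by rewrite expfzMl exprz_exp.
have [k0|k0] := leP 0 k.
  have y1 : `|p ^ k * x| < 1.
    rewrite normrM; apply: le_lt_trans x1; rewrite ler_piMl//.
    by have := @normz_le_expr k 0; apply.
  have E' n : wt k n * (p ^ (k * n) * x ^ n) = if 0 <= n then (p ^ k * x) ^ n else 0.
    by rewrite E /wt k0 ltNge k0 /=; case: ifP => _; rewrite ?mul1r ?mul0r.
  split; first by apply: absum_eq (absum_geo_half y1).
  by rewrite (eq_tsum E') (tsum_geo_ge0 y1).
have y1 : 1 < `|p ^ k * x|.
  have [m ->] := int_lt0_nat k0; rewrite -exprnN normrM normfV normrX mulrC.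
  rewrite ltr_pdivlMr ?exprn_gt0// mul1r; apply: le_lt_trans px.
  by rewrite exprS ler_piMr// exprn_ile1// ltW.
have E' n : wt k n * (p ^ (k * n) * x ^ n) = - (if n < 0 then (p ^ k * x) ^ n else 0).
  by rewrite E /wt leNgt k0 /=; case: ifP => _; rewrite ?mulN1r ?mul0r ?oppr0.
have s := absum_geo_lt0 y1.
split; first by apply: absum_eq E' (absumN s).
by rewrite (eq_tsum E') (tsumN s) (tsum_geo_lt0 y1) opprK.
Qed.

Lemma alpha_ge0 (x : K) n : 0 <= n -> `|alpha x (p / x) n| = `|x ^ n|.
Proof. by move=> n0; rewrite /alpha n0; have [m ->] := int_ge0_nat n0; rewrite absz_nat. Qed.

Lemma alpha_lt0 (x : K) n : n < 0 -> `|alpha x (p / x) n| = `|p| ^+ `|n| * `|x ^ n|.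
Proof.
move=> n0; rewrite /alpha leNgt n0 /=; have [m ->] := int_lt0_nat n0.
by rewrite abszN absz_nat -exprnN -normrX -normrM expr_div_n.
Qed.

Lemma absum_alpha_annulus (x : K) : `|p| < `|x| < 1 -> absum (alpha x (p / x)).
Proof.
move=> /[dup] hx /andP[px x1]; apply: absum_alpha => //.
have x0 : 0 < `|x| by apply: lt_trans px; case/andP: hp.
by rewrite normrM normfV ltr_pdivrMr// mul1r.
Qed.

Lemma quadrant_bound (x y : K) (k n e : int) :
  (0 <= k -> 0 <= n -> 0 <= e) -> (k < 0 -> n < 0 -> `|k|%N%:Z + `|n|%N%:Z <= e) ->
  `|wt k n * (p ^ e * (x ^ k * y ^ n))| <= `|alpha x (p / x) k * alpha y (p / y) n|.
Proof.
move=> h1 h2; rewrite !normrM /wt.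
have [k0|k0] := leP 0 k; have [n0|n0] := leP 0 n => /=; rewrite ?normr0 ?mul0r ?mulr_ge0//.
  rewrite normr1 mul1r !alpha_ge0// ler_piMl ?mulr_ge0//.
  by have := @normz_le_expr e 0; apply; exact: h1.
rewrite normrN normr1 mul1r !alpha_lt0// mulrACA -exprD ler_wpM2r ?mulr_ge0//.
apply: normz_le_expr; rewrite PoszD; exact: h2.
Qed.

End Base.

Section Main.
Variable q : K.
Hypothesis hq : 0 < `|q| < 1.
Let q0 : q != 0. Proof. by rewrite -normr_gt0; case/andP: hq. Qed.
Let q1 : `|q| < 1. Proof. by case/andP: hq. Qed.
Let hq2 : 0 < `|q ^+ 2| < 1. Proof. by apply: norm_expr_lt1. Qed.

(* [th3 w] is the theta function with coefficients [q ^ (n * n)]. *)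
Definition th3 (w : K) : K := theta (- (q * w)) (q ^+ 2).

(** The sum in $m(-qx/w,q^2,-qw)$, without its theta denominator. *)
Definition lerch (x w : K) : K := tsum (fun k => tcoef (q ^+ 2) (- (q * w)) k * kap (q ^+ 2) x k).

Lemma tcoef_square (w : K) n : tcoef (q ^+ 2) (- (q * w)) n = q ^ (n * n) * w ^ n.
Proof.
rewrite /tcoef; have -> : (- (q * w)) ^ n = (-1) ^ n * (q ^ n * w ^ n).
  by rewrite -[- (q * w)]mulN1r !expfzMl.
have -> : (q ^+ 2) ^ binz2 n = q ^ (n * (n - 1)) by rewrite -binz2_double mulrC -exprz_exp.
have -> : q ^ (n * n) = q ^ (n * (n - 1)) * q ^ n by rewrite -expfzDr//; congr (_ ^ _); ring.
have h : (-1) ^ n * (-1) ^ n = 1 :> K by rewrite -expfzMl mulrNN mulr1 exp1rz.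
move: (q ^ (n * (n - 1))) (q ^ n) (w ^ n) ((-1) ^ n) h => A B C D h.
have -> : D * A * (D * (B * C)) = (D * D) * (A * B * C) by ring.
by rewrite h mul1r.
Qed.

Lemma annulus_q2 (x : K) : `|q| < `|x| < 1 -> `|q ^+ 2| < `|x| < 1.
Proof.
move=> /andP[qx ->]; rewrite andbT; apply: le_lt_trans qx.
by rewrite normrX expr2 ler_piMl// ltW.
Qed.

Lemma absum_lerch_pair (x y eps : K) : `|q| < `|x| < 1 -> `|q| < `|y| < 1 -> `|eps| = 1 ->
  absum (fun kn : int * int => tcoef (q ^+ 2) (- (q * (eps * y))) kn.1 *
    (wt kn.1 kn.2 * ((q ^+ 2) ^ (kn.1 * kn.2) * x ^ kn.2))).
Proof.
move=> hx hy he.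
apply: absum_le (absum_prod (absum_alpha_annulus hq hy) (absum_alpha_annulus hq hx)) => -[k n] /=.
have -> : tcoef (q ^+ 2) (- (q * (eps * y))) k * (wt k n * ((q ^+ 2) ^ (k * n) * x ^ n)) =
    eps ^ k * (wt k n * (q ^ (k * k + 2 * (k * n)) * (y ^ k * x ^ n))).
  rewrite tcoef_square expfzMl (expfzDr _ _ q0) -(exprz_exp q 2).
  move: (q ^ (k * k)) ((q ^ 2) ^ (k * n)) (eps ^ k) (y ^ k) (x ^ n) (wt k n) => A B C D E F.
  ring.
have ek : `|eps ^ k| = 1.
  by case: k => m; rewrite ?NegzE -?exprnN -?exprnP ?normfV normrX he expr1n ?invr1.
rewrite (normrM (eps ^ k)) ek mul1r.
by apply: (@quadrant_bound q hq y x k n) => h1 h2; [exact: square_form_ge0|exact: square_form_lt0].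
Qed.

(** Expanding [kap] gives a sum over three indices; replacing them by $(j+k,k,n-k-j)$ brings the
    quadratic form to $j^2+2kn$, the same for all the products compared in [th3_product]. *)
Lemma th3_lerch (x y eps : K) : `|q| < `|x| < 1 -> `|q| < `|y| < 1 -> eps ^+ 2 = 1 ->
  let f := fun t : int * (int * int) => wt t.2.1 (t.2.2 - t.2.1 - t.1) *
    (q ^ (t.1 * t.1 + 2 * (t.2.1 * t.2.2)) * (eps ^ t.1 * (x ^ t.2.2 * y ^ t.2.1))) in
  absum f /\ th3 (eps * x) * lerch x (eps * y) = tsum f.
Proof.
move=> hx hy he f.
have e0 : eps != 0 by apply/eqP => h; move: he; rewrite h expr0n => /eqP; rewrite eq_sym oner_eq0.
have ne : `|eps| = 1.
  by apply/eqP; rewrite -(@pexpr_eq1 _ _ 2)// -normrX he normr1.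
have x0 := annulus_neq0 hq hx; have y0 := annulus_neq0 hq hy.
have ex0 : - (q * (eps * x)) != 0 by rewrite oppr_eq0 !mulf_neq0.
have s1 := absum_tcoef hq2 ex0; have s2 := absum_lerch_pair hx hy ne.
have s3 := absum_prod s1 s2.
have hb : bijective (fun t : int * (int * int) => (t.1 + t.2.1, (t.2.1, t.2.2 - t.2.1 - t.1))).
  exists (fun t => (t.1 - t.2.1, (t.2.1, t.2.2 + t.1))) => -[j [k n]] /=;
    by congr (_, (_, _)); ring.
have E t : (fun p : int * (int * int) => tcoef (q ^+ 2) (- (q * (eps * x))) p.1 *
    (tcoef (q ^+ 2) (- (q * (eps * y))) p.2.1 *
    (wt p.2.1 p.2.2 * ((q ^+ 2) ^ (p.2.1 * p.2.2) * x ^ p.2.2))))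
    (t.1 + t.2.1, (t.2.1, t.2.2 - t.2.1 - t.1)) = f t.
  case: t => j [k n]; rewrite /f /= !tcoef_square !(expfzMl eps).
  have -> : q ^ (j * j + 2 * (k * n)) = q ^ ((j + k) * (j + k)) * q ^ (k * k) *
      (q ^+ 2) ^ (k * (n - k - j)).
    rewrite (exprz_exp q 2) -!(expfzDr _ _ q0); congr (_ ^ _); ring.
  have -> : x ^ n = x ^ (j + k) * x ^ (n - k - j).
    by rewrite -(expfzDr _ _ x0); congr (_ ^ _); ring.
  have ek : eps ^ k * eps ^ k = 1 by rewrite -expfzMl -expr2 he exp1rz.
  have -> : eps ^ j = eps ^ (j + k) * eps ^ k.
    by rewrite (expfzDr _ _ e0) -mulrA ek mulr1.
  move: (q ^ ((j + k) * (j + k))) (q ^ (k * k)) ((q ^+ 2) ^ (k * (n - k - j))) (eps ^ (j + k))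
    (eps ^ k) (x ^ (j + k)) (x ^ (n - k - j)) (y ^ k) (wt k (n - k - j)) => *; ring.
have s4 : absum f.
  have := absum_inj (bij_inj hb) s3; apply: absum_eq => t; by rewrite -E.
split=> //.
rewrite -(eq_tsum E) -(tsum_bij hb s3) -(tsumM s1 s2) /th3 (thetaE hq2 ex0); congr (_ * _).
rewrite (tsum_pair s2); apply: eq_tsum => k /=.
have [s ->] := kap_expand hq2 k (annulus_q2 hx).
by rewrite (tsumZ _ s).
Qed.

(** All four products become sums of the same monomials, with weights [wt k d], [wt n (- d)], the
    indicator of [d = 0] and [wt k n], where $d=n-k-j$; the claim is then [wt_identity] term by
    term. The sign [eps] stands for the points $\pm1$. *)
Lemma th3_product (x y eps : K) : `|q| < `|x| < 1 -> `|q| < `|y| < 1 -> eps ^+ 2 = 1 ->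
  th3 (eps * x) * lerch x (eps * y) + th3 (eps * y) * lerch y (eps * x)
  - th3 (eps * x) * th3 (eps * y) = th3 eps * ev (kap (q ^+ 2) x) y.
Proof.
move=> hx hy he.
have e0 : eps != 0 by apply/eqP => h; move: he; rewrite h expr0n => /eqP; rewrite eq_sym oner_eq0.
have x0 := annulus_neq0 hq hx; have y0 := annulus_neq0 hq hy.
have ex0 : - (q * (eps * x)) != 0 by rewrite oppr_eq0 !mulf_neq0.
have ey0 : - (q * (eps * y)) != 0 by rewrite oppr_eq0 !mulf_neq0.
have qe0 : - (q * eps) != 0 by rewrite oppr_eq0 !mulf_neq0.
pose mono (t : int * (int * int)) := q ^ (t.1 * t.1 + 2 * (t.2.1 * t.2.2)) *
  (eps ^ t.1 * (x ^ t.2.2 * y ^ t.2.1)).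
have [s1 E1] : absum (fun t => wt t.2.1 (t.2.2 - t.2.1 - t.1) * mono t) /\
  th3 (eps * x) * lerch x (eps * y) =
  tsum (fun t => wt t.2.1 (t.2.2 - t.2.1 - t.1) * mono t) := th3_lerch hx hy he.
have [s2 E2] := th3_lerch hy hx he.
(* This involution exchanges [x] and [y] and sends $d=n-k-j$ to $-d$. *)
have hb2 : bijective (fun t : int * (int * int) => (- t.1, (t.2.2, t.2.1))).
  by exists (fun t : int * (int * int) => (- t.1, (t.2.2, t.2.1))) => -[j [k n]] /=; rewrite opprK.
have F2 t : (fun t : int * (int * int) => wt t.2.1 (t.2.2 - t.2.1 - t.1) *
    (q ^ (t.1 * t.1 + 2 * (t.2.1 * t.2.2)) * (eps ^ t.1 * (y ^ t.2.2 * x ^ t.2.1))))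
    (- t.1, (t.2.2, t.2.1)) = wt t.2.2 (- (t.2.2 - t.2.1 - t.1)) * mono t.
  case: t => j [k n]; rewrite /mono /=; congr (wt _ _ * (q ^ _ * (_ * _))); try ring.
  have ek : eps ^ j * eps ^ j = 1 by rewrite -expfzMl -expr2 he exp1rz.
  by apply: (mulIf (expfz_neq0 j e0)); rewrite -(expfzDr _ _ e0) addNr expr0z ek.
have s2' := absum_inj (bij_inj hb2) s2.
have {s2 E2}E2 : th3 (eps * y) * lerch y (eps * x) =
    tsum (fun t => wt t.2.2 (- (t.2.2 - t.2.1 - t.1)) * mono t).
  exact: (etrans E2 (etrans (tsum_bij hb2 s2) (eq_tsum F2))).
have {s2'}s2 : absum (fun t => wt t.2.2 (- (t.2.2 - t.2.1 - t.1)) * mono t).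
  by apply: absum_eq s2' => t; rewrite F2.
have [s3 E3] : absum (fun t => (if t.2.2 - t.2.1 - t.1 == 0 then 1 else 0) * mono t) /\
    th3 (eps * x) * th3 (eps * y) =
    tsum (fun t => (if t.2.2 - t.2.1 - t.1 == 0 then 1 else 0) * mono t).
  have c1 := absum_tcoef hq2 ex0; have c2 := absum_tcoef hq2 ey0.
  have hb : bijective (fun t : int * (int * int) => (t.2.2 - t.2.1 - t.1, (t.2.2, t.2.1))).
    exists (fun t : int * (int * int) => (t.2.1 - t.2.2 - t.1, (t.2.2, t.2.1))) => -[j [k n]] /=;
      by congr (_, _); ring.
  have d1 : `|0 : K| < 1 by rewrite normr0.
  have sd : absum (fun d : int => if d == 0 then 1 else 0 : K).
    apply: absum_le (absum_geo d1) => d; rewrite expr0n absz_eq0.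
    by case: eqP => _; rewrite ?normr1 ?normr0.
  have c3 := absum_prod c1 c2; have c4 := absum_prod sd c3.
  have F3 t : (fun p : int * (int * int) => (if p.1 == 0 then 1 else 0) *
      (tcoef (q ^+ 2) (- (q * (eps * x))) p.2.1 * tcoef (q ^+ 2) (- (q * (eps * y))) p.2.2))
      (t.2.2 - t.2.1 - t.1, (t.2.2, t.2.1)) =
      (if t.2.2 - t.2.1 - t.1 == 0 then 1 else 0) * mono t.
    case: t => j [k n] /=; case: eqP => [h|_]; last by rewrite !mul0r.
    have -> : j = n - k by rewrite -[RHS](subrK j) h add0r.
    rewrite !mul1r /mono /= !tcoef_square !(expfzMl eps).
    have -> : q ^ ((n - k) * (n - k) + 2 * (k * n)) = q ^ (n * n) * q ^ (k * k).
      by rewrite -(expfzDr _ _ q0); congr (_ ^ _); ring.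
    have ek : eps ^ k * eps ^ k = 1 by rewrite -expfzMl -expr2 he exp1rz.
    have -> : eps ^ (n - k) = eps ^ n * eps ^ k.
      apply: (mulIf (expfz_neq0 k e0)).
      by rewrite -(expfzDr _ _ e0) subrK -mulrA ek mulr1.
    by move: (q ^ (n * n)) (q ^ (k * k)) (eps ^ n) (eps ^ k) (x ^ n) (y ^ k) => *; ring.
  split; first by apply: absum_eq (absum_inj (bij_inj hb) c4) => t; rewrite -F3.
  rewrite -(eq_tsum F3) -(tsum_bij hb c4) -(tsumM sd c3) -(tsumM c1 c2).
  by rewrite (tsum1 (i0 := 0)) ?eqxx ?mul1r /th3 ?(thetaE hq2 ex0) ?(thetaE hq2 ey0)// => d /negbTE ->.
have [s4 E4] : absum (fun t => wt t.2.1 t.2.2 * mono t) /\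
    th3 eps * ev (kap (q ^+ 2) x) y = tsum (fun t => wt t.2.1 t.2.2 * mono t).
  have c1 := absum_tcoef hq2 qe0.
  have c2 : absum (fun kn : int * int => wt kn.1 kn.2 *
      (q ^ (2 * (kn.1 * kn.2)) * (y ^ kn.1 * x ^ kn.2))).
    apply: absum_le (absum_prod (absum_alpha_annulus hq hy) (absum_alpha_annulus hq hx)) => -[k n] /=.
    by apply: (@quadrant_bound q hq y x k n) => h1 h2; [exact: prod_form_ge0|exact: prod_form_lt0].
  have c3 := absum_prod c1 c2.
  have F4 t : tcoef (q ^+ 2) (- (q * eps)) t.1 * (wt t.2.1 t.2.2 *
      (q ^ (2 * (t.2.1 * t.2.2)) * (y ^ t.2.1 * x ^ t.2.2))) = wt t.2.1 t.2.2 * mono t.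
    case: t => j [k n]; rewrite /mono /= tcoef_square (expfzDr _ _ q0).
    by move: (q ^ (j * j)) (q ^ (2 * (k * n))) (eps ^ j) (x ^ n) (y ^ k) (wt k n) => *; ring.
  split; first by apply: absum_eq c3 => t; rewrite -F4.
  rewrite -(eq_tsum F4) -(tsumM c1 c2) /th3 (thetaE hq2 qe0); congr (_ * _).
  rewrite (tsum_pair c2); apply: eq_tsum => k.
  have [s ->] := kap_expand hq2 k (annulus_q2 hx).
  rewrite mulrC -(tsumZ _ s); apply: eq_tsum => n /=; rewrite (exprz_exp q 2).
  by move: (q ^ _) (y ^ k) (x ^ n) (wt k n) => *; ring.
rewrite E1 E2 E3 E4 -(tsumD s1 s2) -(tsumB (absumD s1 s2) s3).
apply: eq_tsum => t; rewrite -(wt_identity t.2.1 t.2.2 (t.2.2 - t.2.1 - t.1)).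
by rewrite mulrBl mulrDl.
Qed.

End Main.
End LatticeIdentity.

(** * The Laurent coefficients of the triple sum *)

(** The summand $-2k$ comes from absorbing [q ^+ 2] into the variable in [shift_Z], which makes room
    for the unit circle. The deficit 4 in the negative octant is repaid by the factor [q ^ (-4)] of
    the majorant. *)
Lemma even_exp_ge0 (k a b : int) : 0 <= k -> 0 <= a -> 0 <= b ->
  0 <= 2 * k * (2 * a + 2 * b + 2) + (2 * a + 1) * (2 * b + 1) - 2 * k.
Proof. nia. Qed.

Lemma even_exp_lt0 (k a b : int) : k < 0 -> a < 0 -> b < 0 ->
  - (4 * k) - 2 * a - 2 * b <= 2 * k * (2 * a + 2 * b + 2) + (2 * a + 1) * (2 * b + 1) - 2 * k + 4.
Proof. nia. Qed.

Lemma odd_exp_ge0 (k a b : int) : 0 <= k -> 0 <= a -> 0 <= b -> 0 < a + b ->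
  0 <= (2 * k + 1) * (2 * a + 2 * b) + 4 * (a * b) - 2 * k.
Proof. nia. Qed.

Lemma odd_exp_lt0 (k a b : int) : k < 0 -> a < 0 -> b < 0 ->
  - (4 * k) - 2 * a - 2 * b <= (2 * k + 1) * (2 * a + 2 * b) + 4 * (a * b) - 2 * k + 4.
Proof. nia. Qed.

Lemma mul_exp_ge0 (a b : int) : 0 <= a -> 0 <= b -> 0 <= a * b + 1.
Proof. nia. Qed.

Lemma mul_exp_lt0 (a b : int) : a < 0 -> b < 0 -> `|a|%N%:Z + `|b|%N%:Z <= a * b + 1.
Proof. nia. Qed.

Section HyperbolicSum.
Variable R : realType.
Local Notation K := (cplx R).

Definition chi (k a b : int) : K :=
  if [&& 0 <= k, 0 <= a & 0 <= b] || [&& k < 0, a < 0 & b < 0] then 1 else 0.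

(** A shifted difference of octant indicators lives on the coordinate planes. The plane [k = 0] will
    give a double sum, [a = 0] and [b = 0] Kronecker coefficients, and their common line a
    constant. *)
Lemma chi_identity (k a b : int) :
  chi k (a - 1) (b - 1) - chi (k - 1) a b =
  (if k == 0 then 1 else 0) * wt R (a - 1) (b - 1)
  - (if b == 0 then 1 else 0) * wt R (k - 1) a
  - (if a == 0 then 1 else 0) * wt R (k - 1) b
  + (if (a == 0) && (b == 0) then 1 else 0).
Proof.
rewrite /chi /wt.
have E1 (n : int) : (n - 1 < 0) = (n <= 0) by lia.
have E2 (n : int) : (0 <= n - 1) = (0 < n) by lia.
rewrite !E1 !E2.
by case: (ltgtP k 0) => _; case: (ltgtP a 0) => _; case: (ltgtP b 0) => _ /=; ring.
Qed.

Section Base.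
Variable q : K.
Hypothesis hq : 0 < `|q| < 1.
Let q0 : q != 0. Proof. by rewrite -normr_gt0; case/andP: hq. Qed.
Let q1 : `|q| < 1. Proof. by case/andP: hq. Qed.
Let hq2 : 0 < `|q ^+ 2| < 1. Proof. by apply: norm_expr_lt1. Qed.
Let hq4 : 0 < `|q ^+ 4| < 1. Proof. by apply: norm_expr_lt1. Qed.

Lemma octant_bound (X Y Z : K) (k a b e : int) :
  (0 <= k -> 0 <= a -> 0 <= b -> 0 <= e) ->
  (k < 0 -> a < 0 -> b < 0 -> - (4 * k) - 2 * a - 2 * b <= e + 4) ->
  `|chi k a b * (q ^ e * (X ^ a * Y ^ b * Z ^ k))| <=
  `|q ^ (-4) * (alpha Z (q ^+ 4 / Z) k * (alpha X (q ^+ 2 / X) a * alpha Y (q ^+ 2 / Y) b))|.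
Proof.
move=> h1 h2; rewrite /chi; case: ifP => [|_]; last by rewrite mul0r normr0.
rewrite mul1r !normrM; case/orP => /and3P[hk ha hb].
  rewrite !alpha_ge0// [(`|Z ^ k| * _)%R]mulrC ler_wpM2r ?mulr_ge0//.
  rewrite -exprnN normfV normrX; apply: le_trans (_ : 1 <= _).
    by have := @normz_le_expr _ q hq e 0; apply; exact: h1.
  by rewrite -exprVn exprn_ege1// invf_ge1 ?(ltW q1)//; case/andP: hq.
rewrite !alpha_lt0//.
have hqe : `|q ^ e| <= `|q ^ (- (4))| * (`|q ^+ 4| ^+ `|k| * (`|q ^+ 2| ^+ `|a| * `|q ^+ 2| ^+ `|b|)).
  rewrite !normrX -!exprM -!exprD.
  have -> : e = (- (4)) + (e + 4) by ring.
  rewrite (expfzDr _ _ q0) normrM ler_wpM2l//.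
  apply: (normz_le_expr hq); have := h2 hk ha hb; lia.
have : 0 <= `|X ^ a| * `|Y ^ b| * `|Z ^ k| by rewrite !mulr_ge0.
move: (`|X ^ a|) (`|Y ^ b|) (`|Z ^ k|) (`|q ^ e|) (`|q ^ (- (4))|)
  (`|q ^+ 4| ^+ `|k|) (`|q ^+ 2| ^+ `|a|) (`|q ^+ 2| ^+ `|b|) hqe => A B C D E F G H.
move=> h' h; apply: le_trans (ler_wpM2r h h') _.
by rewrite le_eqVlt; apply/orP; left; apply/eqP; ring.
Qed.

Variables x y : K.
Hypothesis hx : `|q| < `|x| < 1.
Hypothesis hy : `|q| < `|y| < 1.
Let x0 : x != 0. Proof. exact: (annulus_neq0 hq hx). Qed.
Let y0 : y != 0. Proof. exact: (annulus_neq0 hq hy). Qed.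

Lemma annulus_sqr (u : K) : `|q| < `|u| < 1 -> `|q ^+ 2| < `|u ^+ 2| < 1.
Proof.
case/andP => qs s1; rewrite !normrX exprn_ilt1// andbT ltrXn2r// nnegrE//.
Qed.

(** The term with $r=2a+1$, $s=2b+1$, $t=2k$, without its power of $z$. *)
Definition even_term (k : int) (ab : int * int) : K :=
  chi k ab.1 ab.2 * (q ^ (2 * k * (2 * ab.1 + 2 * ab.2 + 2) + (2 * ab.1 + 1) * (2 * ab.2 + 1)) *
   (x * y * ((x ^+ 2) ^ ab.1 * (y ^+ 2) ^ ab.2))).

(** The term with $r=2a$, $s=2b$, $t=2k+1$, without its power of $z$. *)
Definition odd_term (k : int) (ab : int * int) : K :=
  chi k ab.1 ab.2 * (q ^ ((2 * k + 1) * (2 * ab.1 + 2 * ab.2) + 4 * (ab.1 * ab.2)) *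
   ((x ^+ 2) ^ ab.1 * (y ^+ 2) ^ ab.2)).

(* The terms omitted here sum to [(1 - z ^+ 2)^-1]; without them the series in [z ^+ 2]
   also converges on the unit circle, hence at [z = 1] and [z = -1]. *)
Definition odd_term_red (k : int) (ab : int * int) : K :=
  if (0 <= k) && (ab == (0, 0)) then 0 else odd_term k ab.

(* [Z] plays the role of [z ^+ 2], in an annulus containing the unit circle. *)
Lemma absum_bounding (Z : K) : `|q ^+ 2| < `|Z| -> `|q ^+ 2 * Z| < 1 ->
  absum (fun p : int * (int * int) => q ^ (-4) * (alpha (q ^+ 2 * Z) (q ^+ 4 / (q ^+ 2 * Z)) p.1 *
    (alpha (x ^+ 2) (q ^+ 2 / x ^+ 2) p.2.1 * alpha (y ^+ 2) (q ^+ 2 / y ^+ 2) p.2.2))).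
Proof.
move=> h1 h2; apply: absumZ.
have hz : `|q ^+ 4| < `|q ^+ 2 * Z| < 1.
  rewrite h2 andbT; have -> : q ^+ 4 = q ^+ 2 * q ^+ 2 by ring.
  by rewrite normrM [ltRHS]normrM ltr_pM2l//; case/andP: hq2.
have c1 := absum_alpha_annulus hq4 hz.
have c2 := absum_alpha_annulus hq2 (annulus_sqr hx).
have c3 := absum_alpha_annulus hq2 (annulus_sqr hy).
exact: (absum_prod c1 (absum_prod c2 c3)).
Qed.

Lemma shift_Z (Z : K) (k e : int) : Z != 0 -> q ^ e * Z ^ k = q ^ (e - 2 * k) * (q ^+ 2 * Z) ^ k.
Proof.
move=> Z0; rewrite expfzMl (exprz_exp q 2) mulrA -(expfzDr _ _ q0).
by congr (_ ^ _ * _); ring.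
Qed.

Lemma absum_even_term (Z : K) : `|q ^+ 2| < `|Z| -> `|q ^+ 2 * Z| < 1 ->
  absum (fun p : int * (int * int) => even_term p.1 p.2 * Z ^ p.1).
Proof.
move=> h1 h2; have Z0 : Z != 0 by rewrite -normr_gt0; apply: lt_trans h1; case/andP: hq2.
apply: absum_eq (absumZ (x * y) (absum_le _ (absum_bounding h1 h2))) => [|p].
  move=> [k [a b]]; rewrite /even_term /=.
  set e := 2 * k * _ + _.
  transitivity (x * y * (chi k a b * (q ^ (e - 2 * k) *
     ((x ^+ 2) ^ a * (y ^+ 2) ^ b * (q ^+ 2 * Z) ^ k)))).
    have h := shift_Z k e Z0.
    have -> : q ^ (e - 2 * k) * ((x ^+ 2) ^ a * (y ^+ 2) ^ b * (q ^+ 2 * Z) ^ k) =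
      (x ^+ 2) ^ a * (y ^+ 2) ^ b * (q ^ (e - 2 * k) * (q ^+ 2 * Z) ^ k).
      by move: (q ^ (e - 2 * k)) ((q ^+ 2 * Z) ^ k) ((x ^+ 2) ^ a) ((y ^+ 2) ^ b) => *; ring.
    rewrite -h; move: (chi k a b) (q ^ e) (Z ^ k) ((x ^+ 2) ^ a) ((y ^+ 2) ^ b) => *; ring.
  pose f (p : int * (int * int)) := let: (k, (a, b)) := p in
    chi k a b * (q ^ (2 * k * (2 * a + 2 * b + 2) + (2 * a + 1) * (2 * b + 1) - 2 * k) *
     ((x ^+ 2) ^ a * (y ^+ 2) ^ b * (q ^+ 2 * Z) ^ k)).
  exact: (erefl (x * y * f (k, (a, b)))).
case: p => k [a b] /=; apply: octant_bound => hk ha hb.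
  exact: even_exp_ge0.
exact: even_exp_lt0.
Qed.

Lemma absum_odd_term_red (Z : K) : `|q ^+ 2| < `|Z| -> `|q ^+ 2 * Z| < 1 ->
  absum (fun p : int * (int * int) => odd_term_red p.1 p.2 * Z ^ p.1).
Proof.
move=> h1 h2; have Z0 : Z != 0 by rewrite -normr_gt0; apply: lt_trans h1; case/andP: hq2.
apply: absum_le (absum_bounding h1 h2) => -[k [a b]]; rewrite /odd_term_red /=.
case: ifP => [_|hne]; first by rewrite mul0r normr0.
rewrite /odd_term /=; set e := (2 * k + 1) * _ + _.
have -> : chi k a b * (q ^ e * ((x ^+ 2) ^ a * (y ^+ 2) ^ b)) * Z ^ k =
    chi k a b * (q ^ (e - 2 * k) * ((x ^+ 2) ^ a * (y ^+ 2) ^ b * (q ^+ 2 * Z) ^ k)).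
  have h := shift_Z k e Z0.
  have -> : q ^ (e - 2 * k) * ((x ^+ 2) ^ a * (y ^+ 2) ^ b * (q ^+ 2 * Z) ^ k) =
    (x ^+ 2) ^ a * (y ^+ 2) ^ b * (q ^ (e - 2 * k) * (q ^+ 2 * Z) ^ k).
    by move: (q ^ (e - 2 * k)) ((q ^+ 2 * Z) ^ k) ((x ^+ 2) ^ a) ((y ^+ 2) ^ b) => *; ring.
  rewrite -h; move: (chi k a b) (q ^ e) (Z ^ k) ((x ^+ 2) ^ a) ((y ^+ 2) ^ b) => *; ring.
apply: octant_bound => hk ha hb; last exact: odd_exp_lt0.
apply: odd_exp_ge0 => //; move: hne; rewrite hk /= xpair_eqE; clear -ha hb; lia.
Qed.

Let norm_q2_1 : `|q ^+ 2| < `|1 : K|. Proof. by rewrite normr1; case/andP: hq2. Qed.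
Let norm_q2_mul1 : `|q ^+ 2 * 1| < 1. Proof. by rewrite mulr1; case/andP: hq2. Qed.

Lemma absum_even k : absum (even_term k).
Proof.
have := absum_slice k (absum_even_term norm_q2_1 norm_q2_mul1).
by apply: absum_eq => ab; rewrite exp1rz mulr1.
Qed.

Lemma absum_odd_red k : absum (odd_term_red k).
Proof.
have := absum_slice k (absum_odd_term_red norm_q2_1 norm_q2_mul1).
by apply: absum_eq => ab; rewrite exp1rz mulr1.
Qed.

Definition origin_term (k : int) (ab : int * int) : K := if (0 <= k) && (ab == (0, 0)) then 1 else 0.

Lemma odd_term_split k ab : odd_term k ab = odd_term_red k ab + origin_term k ab.
Proof.
rewrite /odd_term_red /origin_term; case: ifP => [|_]; last by rewrite addr0.
case/andP => k0 /eqP ->; rewrite /odd_term /chi k0 lexx /= !(mulr0, addr0).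
by rewrite !expr0z !mulr1 add0r.
Qed.

Lemma absum_delta (I : choiceType) (i0 : I) (c : K) : absum (fun i => if i == i0 then c else 0).
Proof.
exists `|c| => A; case: (boolP (i0 \in A)) => hA.
  rewrite (big_fsetD1 i0)//= eqxx big1_seq ?addr0// => i; rewrite /= !inE => /andP[/negbTE -> _].
  by rewrite normr0.
rewrite big1_seq// => i /andP[_ iA]; case: eqP => [h|_]; last by rewrite normr0.
by rewrite -h iA in hA.
Qed.

Lemma absum_origin k : absum (origin_term k).
Proof.
apply: absum_le (absum_delta (0, 0) 1) => ab; rewrite /origin_term.
by case: (0 <= k) => //=; case: ifP => _; rewrite ?normr0.
Qed.

Lemma absum_odd k : absum (odd_term k).
Proof.
by apply: absum_eq (absumD (absum_odd_red k) (absum_origin k)) => ab; exact: odd_term_split.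
Qed.

Definition even_coef k := tsum (even_term k).
Definition odd_coef k := tsum (odd_term k).
Definition odd_coef_red k := tsum (odd_term_red k).

Lemma odd_coefE k : odd_coef k = odd_coef_red k + step R k.
Proof.
have -> : step R k = tsum (origin_term k).
  rewrite /step (tsum1 (i0 := (0, 0))) /origin_term ?eqxx ?andbT//.
  by move=> ab /negbTE ->; rewrite andbF.
by rewrite -(tsumD (absum_odd_red k) (absum_origin k)); apply: eq_tsum => ab; exact: odd_term_split.
Qed.

(** Termwise: both terms at the same indices lie in the same octant, and their exponents differ by
    $4k+1$. No boundary is crossed, unlike in [even_coef_rec]. *)
Lemma odd_coef_rec k : q ^ (4 * k + 2) * odd_coef k = q / (x * y) * even_coef k.
Proof.
rewrite -(tsumZ _ (absum_odd k)) -(tsumZ _ (absum_even k)); apply: eq_tsum => -[a b].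
rewrite /odd_term /even_term /=.
have -> : q ^ (2 * k * (2 * a + 2 * b + 2) + (2 * a + 1) * (2 * b + 1)) =
   q ^ (4 * k + 2) * q ^ ((2 * k + 1) * (2 * a + 2 * b) + 4 * (a * b)) / q.
  rewrite -(expfzDr _ _ q0) -(exprN1 q) -(expfzDr _ _ q0); congr (_ ^ _); ring.
move: (chi k a b) (q ^ (4 * k + 2)) (q ^ _) ((x ^+ 2) ^ a) ((y ^+ 2) ^ b) => *.
by field; rewrite x0 y0 q0.
Qed.

(** The sum of $\pm q^{rs}x^ry^s$ over odd $r,s$ of equal sign, contributed by the plane [k = 0];
    Kronecker's identity evaluates it in [K11E]. *)
Definition K11 : K := tsum (fun ab : int * int => wt R ab.1 ab.2 *
  (q ^ ((2 * ab.1 + 1) * (2 * ab.2 + 1)) * (x * y * ((x ^+ 2) ^ ab.1 * (y ^+ 2) ^ ab.2)))).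

Let X := q ^+ 2 * x ^+ 2.
Let Y := q ^+ 2 * y ^+ 2.

Lemma annulus_q4 (u : K) : `|q| < `|u| < 1 -> `|q ^+ 4| < `|q ^+ 2 * u ^+ 2| < 1.
Proof.
move=> /annulus_sqr /andP[h1 h2]; have [p0 p1] := andP hq2.
have -> : q ^+ 4 = q ^+ 2 * q ^+ 2 by ring.
rewrite normrM [X in _ < X < _]normrM ltr_pM2l// h1 /=.
by apply: lt_trans p1; rewrite -[ltRHS]mulr1 ltr_pM2l.
Qed.

Let hX : `|q ^+ 4| < `|X| < 1. Proof. exact: annulus_q4. Qed.
Let hY : `|q ^+ 4| < `|Y| < 1. Proof. exact: annulus_q4. Qed.

Lemma absum_K11_gen : absum (fun ab : int * int => wt R ab.1 ab.2 *
   ((q ^+ 4) ^ (ab.1 * ab.2) * (X ^ ab.1 * Y ^ ab.2))).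
Proof.
have h := absum_prod (absum_alpha_annulus hq4 hX) (absum_alpha_annulus hq4 hY).
have h2 := absumZ (q ^ (-4)) h.
apply: absum_le h2 => -[a b] /=.
(* The exponent [a * b] alone falls short of [|a| + |b|] at [a = b = -1]; borrowing one factor
   [q ^+ 4] repairs this. *)
have -> : (q ^+ 4) ^ (a * b) = q ^ (- (4)) * (q ^ 4 * (q ^+ 4) ^ (a * b)).
  by rewrite mulrA -(expfzDr _ _ q0) addNr expr0z mul1r.
have -> : q ^ 4 * (q ^+ 4) ^ (a * b) = (q ^+ 4) ^ (a * b + 1).
  by rewrite [RHS](expfzDr _ _ (expf_neq0 4 q0)) expr1z [RHS]mulrC.
rewrite mulrCA -mulrA (normrM (q ^ _)) [leRHS](normrM (q ^ _)) mulrCA ler_wpM2l//.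
by apply: (quadrant_bound hq4) => ha hb; [exact: mul_exp_ge0|exact: mul_exp_lt0].
Qed.

Lemma K11_termE (a b : int) : wt R a b *
  (q ^ ((2 * a + 1) * (2 * b + 1)) * (x * y * ((x ^+ 2) ^ a * (y ^+ 2) ^ b))) =
  q * x * y * (wt R a b * ((q ^+ 4) ^ (a * b) * (X ^ a * Y ^ b))).
Proof.
rewrite /X /Y (expfzMl _ (x ^+ 2)) (expfzMl _ (y ^+ 2)) (exprz_exp q 4) (exprz_exp q 2) (exprz_exp q 2).
have -> : q ^ ((2 * a + 1) * (2 * b + 1)) = q * q ^ (4 * (a * b)) * q ^ (2 * a) * q ^ (2 * b).
  by rewrite -{2}(expr1z q) -!(expfzDr _ _ q0); congr (_ ^ _); ring.
move: (q ^ (4 * (a * b))) (q ^ (2 * a)) (q ^ (2 * b)) ((x ^+ 2) ^ a) ((y ^+ 2) ^ b) (wt R a b).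
by move=> *; ring.
Qed.

Lemma K11E : K11 = q * x * y * (qpoch (q ^+ 4) (q ^+ 4) ^+ 3 * theta (Y * X) (q ^+ 4) /
  (theta Y (q ^+ 4) * theta X (q ^+ 4))).
Proof.
rewrite -(kronecker hq4 hY hX) /ev.
have s := absum_K11_gen.
transitivity (q * x * y * tsum (fun ab : int * int => wt R ab.1 ab.2 *
   ((q ^+ 4) ^ (ab.1 * ab.2) * (X ^ ab.1 * Y ^ ab.2)))).
  rewrite -(tsumZ _ s); apply: eq_tsum => -[a b] /=.
  exact: K11_termE.
congr (_ * _); rewrite (tsum_pair s); apply: eq_tsum => a.
have [s' ->] := kap_expand hq4 a hY.
rewrite mulrC -(tsumZ _ s'); apply: eq_tsum => b /=.
by move: (X ^ a) (Y ^ b) ((q ^+ 4) ^ (a * b)) (wt R a b) => *; ring.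
Qed.

Lemma tsum_axis2 (f : int -> K) : absum f ->
  absum (fun ab : int * int => (if ab.2 == 0 then 1 else 0) * f ab.1) /\
  tsum (fun ab : int * int => (if ab.2 == 0 then 1 else 0) * f ab.1) = tsum f.
Proof.
move=> fs; have d := absum_delta (0 : int) 1.
have E (ab : int * int) : f ab.1 * (if ab.2 == 0 then 1 else 0) = (if ab.2 == 0 then 1 else 0) * f ab.1.
  exact: mulrC.
split; first by apply: absum_eq (absum_prod fs d) => ab; rewrite -E.
have h1 : tsum (fun b : int => if b == 0 then 1 else 0 : K) = 1.
  by rewrite (tsum1 (i0 := 0)) ?eqxx// => b /negbTE ->.
by rewrite -(eq_tsum E) -(tsumM fs d) h1 mulr1.
Qed.

Lemma tsum_axis1 (f : int -> K) : absum f ->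
  absum (fun ab : int * int => (if ab.1 == 0 then 1 else 0) * f ab.2) /\
  tsum (fun ab : int * int => (if ab.1 == 0 then 1 else 0) * f ab.2) = tsum f.
Proof.
move=> fs; have [s h] := tsum_axis2 fs.
have hb : bijective (fun p : int * int => (p.2, p.1)) by exists (fun p => (p.2, p.1)) => -[].
split; first exact: (absum_inj (bij_inj hb) s).
by rewrite -h (tsum_bij hb s).
Qed.

Lemma absum_K11 : absum (fun ab : int * int => wt R ab.1 ab.2 *
  (q ^ ((2 * ab.1 + 1) * (2 * ab.2 + 1)) * (x * y * ((x ^+ 2) ^ ab.1 * (y ^+ 2) ^ ab.2)))).
Proof.
apply: absum_eq (absumZ (q * x * y) absum_K11_gen) => -[a b] /=.
exact: K11_termE.
Qed.

(** Lowering [a] and [b] by 1 in the even terms gives both series on the left the same monomial, so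
    [chi_identity] applies and each coordinate plane is summed separately. *)
Lemma even_coef_rec k : q ^ (4 * k) * even_coef k - q / (x * y) * odd_coef (k - 1) =
  q / (x * y) * (1 - kap (q ^+ 4) X (k - 1) - kap (q ^+ 4) Y (k - 1))
  + (if k == 0 then K11 else 0).
Proof.
have hb : bijective (fun ab : int * int => (ab.1 - 1, ab.2 - 1)).
  by exists (fun ab : int * int => (ab.1 + 1, ab.2 + 1)) => -[a b] /=; congr pair; ring.
set c := q / (x * y).
(* The common monomial of the two series, carrying the factor [c]. *)
pose m (ab : int * int) := c * (q ^ (2 * (k - 1) * (2 * ab.1 + 2 * ab.2) + 2 * ab.1 + 2 * ab.2 + 4 * (ab.1 * ab.2)) *
   ((x ^+ 2) ^ ab.1 * (y ^+ 2) ^ ab.2)).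
have E1 ab : q ^ (4 * k) * even_term k (ab.1 - 1, ab.2 - 1) = chi k (ab.1 - 1) (ab.2 - 1) * m ab.
  case: ab => a b; rewrite /even_term /m /c /=.
  have x20 : x ^+ 2 != 0 by rewrite expf_neq0.
  have y20 : y ^+ 2 != 0 by rewrite expf_neq0.
  rewrite (expfzDr _ _ x20) (expfzDr _ _ y20) !exprN1.
  set e1 := 2 * k * _ + _; set e2 := 2 * (k - 1) * _ + _ + _ + _.
  have -> : q ^ e1 = q * q ^ e2 * (q ^ (4 * k))^-1.
    rewrite invr_expz -{2}(expr1z q) -!(expfzDr _ _ q0) /e1 /e2; congr (_ ^ _); ring.
  have : q ^ (4 * k) != 0 by rewrite expfz_neq0.
  move: (q ^ (4 * k)) (q ^ e2) ((x ^+ 2) ^ a) ((y ^+ 2) ^ b) (chi k (a - 1) (b - 1)) => A B C D E A0.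
  by field; rewrite x0 y0 A0.
have E2 ab : c * odd_term (k - 1) ab = chi (k - 1) ab.1 ab.2 * m ab.
  case: ab => a b; rewrite /odd_term /m /=.
  have -> : (2 * (k - 1) + 1) * (2 * a + 2 * b) + 4 * (a * b) =
     2 * (k - 1) * (2 * a + 2 * b) + 2 * a + 2 * b + 4 * (a * b) by ring.
  by move: (q ^ _) ((x ^+ 2) ^ a) ((y ^+ 2) ^ b) (chi _ a b) => *; ring.
have s1 := absum_inj (bij_inj hb) (absum_even k).
have s1' : absum (fun ab => chi k (ab.1 - 1) (ab.2 - 1) * m ab).
  by apply: absum_eq (absumZ (q ^ (4 * k)) s1) => ab; rewrite -E1.
have s2' : absum (fun ab => chi (k - 1) ab.1 ab.2 * m ab).
  by apply: absum_eq (absumZ c (absum_odd (k - 1))) => ab; rewrite -E2.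
rewrite /even_coef (tsum_bij hb (absum_even k)) -(tsumZ _ s1) (eq_tsum E1).
rewrite /odd_coef -(tsumZ c (absum_odd (k - 1))) (eq_tsum E2) -(tsumB s1' s2').
pose g1 (ab : int * int) := (if k == 0 then 1 else 0) * wt R (ab.1 - 1) (ab.2 - 1) * m ab.
pose g2 (ab : int * int) := (if ab.2 == 0 then 1 else 0) * (wt R (k - 1) ab.1 * m (ab.1, 0)).
pose g3 (ab : int * int) := (if ab.1 == 0 then 1 else 0) * (wt R (k - 1) ab.2 * m (0, ab.2)).
pose g4 (ab : int * int) := if ab == (0, 0) then m (0, 0) else 0.
have hg ab : chi k (ab.1 - 1) (ab.2 - 1) * m ab - chi (k - 1) ab.1 ab.2 * m ab =
    g1 ab - g2 ab - g3 ab + g4 ab.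
  rewrite -mulrBl chi_identity /g1 /g2 /g3 /g4; case: ab => a b; rewrite xpair_eqE /=.
  move: (wt R) (if k == 0 then 1 else 0) => W D.
  case: (eqVneq a 0) => [->|_]; case: (eqVneq b 0) => [->|_] /=; ring.
have c0 : c != 0 by rewrite /c mulf_neq0 ?invr_neq0 ?mulf_neq0.
have [sg1 tg1] : absum g1 /\ tsum g1 = if k == 0 then K11 else 0.
  rewrite /g1; case: (eqVneq k 0) => [k0|_]; last first.
    split; last by apply: tsum0 => ab; rewrite !mul0r.
    by apply: absum_le (absum_origin 0) => ab; rewrite !mul0r normr0.
  have E3 (ab : int * int) : wt R (ab.1 - 1) (ab.2 - 1) * (q ^ ((2 * (ab.1 - 1) + 1) * (2 * (ab.2 - 1) + 1)) *
      (x * y * ((x ^+ 2) ^ (ab.1 - 1) * (y ^+ 2) ^ (ab.2 - 1)))) =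
      1 * wt R (ab.1 - 1) (ab.2 - 1) * m ab.
    case: ab => a b; rewrite /m /c k0 /=.
    have x20 : x ^+ 2 != 0 by rewrite expf_neq0.
    have y20 : y ^+ 2 != 0 by rewrite expf_neq0.
    rewrite (expfzDr _ _ x20) (expfzDr _ _ y20) !exprN1.
    set e1 := _ * (2 * (b - 1) + 1); set e2 := 2 * (0 - 1) * _ + _ + _ + _.
    have -> : q ^ e1 = q * q ^ e2.
      by rewrite -{2}(expr1z q) -(expfzDr _ _ q0) /e1 /e2; congr (_ ^ _); ring.
    move: (q ^ e2) ((x ^+ 2) ^ a) ((y ^+ 2) ^ b) (wt R (a - 1) (b - 1)) => A B C D.
    by field; rewrite x0 y0.
  split; first by apply: absum_eq (absum_inj (bij_inj hb) absum_K11) => ab; rewrite -E3.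
  by rewrite -(eq_tsum E3) /K11 (tsum_bij hb absum_K11).
have axis (u : K) (v : int -> K) : `|q ^+ 4| < `|u| < 1 ->
    (forall a, v a = c * ((q ^+ 4) ^ ((k - 1) * a) * u ^ a)) ->
    absum (fun a => wt R (k - 1) a * v a) /\
    tsum (fun a => wt R (k - 1) a * v a) = c * kap (q ^+ 4) u (k - 1).
  move=> hu hv; have [s ->] := kap_expand hq4 (k - 1) hu.
  have E a : c * (wt R (k - 1) a * ((q ^+ 4) ^ ((k - 1) * a) * u ^ a)) = wt R (k - 1) a * v a.
    by rewrite hv mulrCA.
  split; first by apply: absum_eq (absumZ c s) => a; rewrite -E.
  by rewrite -(tsumZ c s); apply: eq_tsum => a; rewrite -E.
have vX a : m (a, 0) = c * ((q ^+ 4) ^ ((k - 1) * a) * X ^ a).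
  rewrite /m /X /= expr0z mulr1 (expfzMl _ (x ^+ 2)) (exprz_exp q 4) (exprz_exp q 2).
  congr (c * _); rewrite [RHS]mulrA -(expfzDr _ _ q0); congr (_ ^ _ * _); ring.
have vY a : m (0, a) = c * ((q ^+ 4) ^ ((k - 1) * a) * Y ^ a).
  rewrite /m /Y /= expr0z mul1r (expfzMl _ (y ^+ 2)) (exprz_exp q 4) (exprz_exp q 2).
  congr (c * _); rewrite [RHS]mulrA -(expfzDr _ _ q0); congr (_ ^ _ * _); ring.
have [sX tX] := axis X (fun a => m (a, 0)) hX vX.
have [sY tY] := axis Y (fun a => m (0, a)) hY vY.
have [sg2 tg2] := tsum_axis2 sX.
have [sg3 tg3] := tsum_axis1 sY.
have sg4 : absum g4 := absum_delta (0, 0) (m (0, 0)).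
have tg4 : tsum g4 = c.
  rewrite /g4 (tsum1 (i0 := (0, 0))) ?eqxx; last by move=> ab /negbTE ->.
  by rewrite /m /= !mulr0 !addr0 !expr0z !mulr1.
rewrite (eq_tsum hg) (tsumD (absumB (absumB sg1 sg2) sg3) sg4).
rewrite (tsumB (absumB sg1 sg2) sg3) (tsumB sg1 sg2) tg1 tg4.
have -> : tsum g2 = c * kap (q ^+ 4) X (k - 1) := etrans tg2 tX.
have -> : tsum g3 = c * kap (q ^+ 4) Y (k - 1) := etrans tg3 tY.
by move: (kap _ X _) (kap _ Y _) (if _ then _ else _) => *; ring.
Qed.

End Base.
End HyperbolicSum.

(** * Laurent coefficients of the last Appell-Lerch term *)

Lemma lerch_exp_ge0 (k n : int) : 0 <= k -> 0 <= n -> 0 <= binz2 (k + 1) + k * n + 1.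
Proof.
move=> hk hn; have := binz2_double (k + 1); rewrite addrK; have : 0 <= k * n by nia.
nia.
Qed.

Lemma lerch_exp_lt0 (k n : int) : k < 0 -> n < 0 ->
  `|k|%N%:Z + `|n|%N%:Z <= binz2 (k + 1) + k * n + 1.
Proof.
move=> hk hn; have := binz2_double (k + 1); rewrite addrK.
have : 0 <= (k + 1) * (n + 1) by nia.
nia.
Qed.

Section LerchCoef.
Variable R : realType.
Local Notation K := (cplx R).
Variable p : K.
Hypothesis hp : 0 < `|p| < 1.
Let p0 : p != 0. Proof. by rewrite -normr_gt0; case/andP: hp. Qed.
Variable w : K.
Hypothesis hw : `|p| < `|w| < 1.
Let w0 : w != 0. Proof. exact: (annulus_neq0 hp hw). Qed.

Definition lerch_term (n k : int) : K := wt R k n * (p ^ (binz2 (k + 1) + k * n) * w ^ k).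

Definition lerch_coef (n : int) : K := tsum (lerch_term n).

Lemma absum_lerch_term (u : K) : `|p| < `|u| < 1 ->
  absum (fun nk : int * int => lerch_term nk.1 nk.2 * u ^ nk.1).
Proof.
move=> hu.
have hb : injective (fun nk : int * int => (nk.2, nk.1)) by move=> [a b] [c d] [-> ->].
have h := absum_inj hb (absum_prod (absum_alpha_annulus hp hw) (absum_alpha_annulus hp hu)).
apply: absum_le (absumZ (p ^ (-1)) h) => -[n k] /=; rewrite /lerch_term.
have -> : wt R k n * (p ^ (binz2 (k + 1) + k * n) * w ^ k) * u ^ n =
    p ^ (-1) * (wt R k n * (p ^ (binz2 (k + 1) + k * n + 1) * (w ^ k * u ^ n))).
  rewrite (expfzDr _ 1 p0) expr1z exprN1.
  by move: (wt R k n) (p ^ _) (w ^ k) (u ^ n) => *; field.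
rewrite (normrM (p ^ _)) [leRHS](normrM (p ^ _)) ler_wpM2l//.
by apply: (quadrant_bound hp) => hk hn; [exact: lerch_exp_ge0|exact: lerch_exp_lt0].
Qed.

Lemma absum_lerch_coef n : absum (lerch_term n).
Proof.
have := absum_slice n (absum_lerch_term hw).
move=> /(absumZ (w ^ (- n))); apply: absum_eq => k /=.
by rewrite mulrCA -(expfzDr _ _ w0) addNr expr0z mulr1.
Qed.

Lemma lerch_ev (u : K) : `|p| < `|u| < 1 -> absum_at lerch_coef u /\
  tsum (fun k => tcoef p (- (p * w)) k * kap p u k) = ev lerch_coef u.
Proof.
move=> hu; have s := absum_lerch_term hu.
have E n : tsum (fun k => lerch_term n k * u ^ n) = lerch_coef n * u ^ n.
  rewrite mulrC -(tsumZ _ (absum_lerch_coef n)); apply: eq_tsum => k; exact: mulrC.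
split; first by apply: absum_eq (absum_tsum s) => n; rewrite -E.
rewrite /ev -(eq_tsum E) (tsum_swap s); apply: eq_tsum => k /=.
have [s' ->] := kap_expand hp k hu; rewrite -(tsumZ _ s'); apply: eq_tsum => n.
rewrite /lerch_term (expfzDr _ _ p0) binz2S (expfzDr _ _ p0) /tcoef.
have -> : (- (p * w)) ^ k = (-1) ^ k * (p ^ k * w ^ k) by rewrite -[- (p * w)]mulN1r !expfzMl.
have h : (-1) ^ k * (-1) ^ k = 1 :> K by rewrite -expfzMl mulrNN mulr1 exp1rz.
move: (p ^ binz2 k) (p ^ k) (w ^ k) (p ^ (k * n)) (u ^ n) (wt R k n) ((-1) ^ k) h => A B C D E' F G h.
have -> : G * A * (G * (B * C)) * (F * (D * E')) = (G * G) * (A * (B * C) * (F * (D * E'))) by ring.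
by rewrite h; ring.
Qed.

Lemma wt_shift (k n : int) : wt R (k - 1) n - wt R k (n - 1) =
  (if n == 0 then 1 else 0) - (if k == 0 then 1 else 0).
Proof.
rewrite /wt.
have E1 (m : int) : (m - 1 < 0) = (m <= 0) by lia.
have E2 (m : int) : (0 <= m - 1) = (0 < m) by lia.
rewrite !E1 !E2.
by case: (ltgtP k 0) => _; case: (ltgtP n 0) => _ /=; ring.
Qed.

(** By [wt_shift] the difference of the two series lives on [n = 0], where it is a whole theta
    series, and on [k = 0], where it is a single term. The jump at [n = 0] allows a multiple of this
    sequence to cancel [K11]. *)
Lemma lerch_coef_rec n : p ^ n * lerch_coef n - w^-1 * lerch_coef (n - 1) =
  w^-1 * ((if n == 0 then theta (- w) p else 0) - 1).
Proof.
have nw0 : - w != 0 by rewrite oppr_eq0.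
have s1 := absum_shift (-1) (absum_lerch_coef n).
have s2 := absum_lerch_coef (n - 1).
pose m k := w^-1 * (p ^ (binz2 k + k * n) * w ^ k).
have E1 k : p ^ n * lerch_term n (k - 1) = wt R (k - 1) n * m k.
  rewrite /lerch_term /m subrK (expfzDr _ _ w0) exprN1.
  have -> : p ^ (binz2 k + k * n) = p ^ n * p ^ (binz2 k + (k - 1) * n).
    by rewrite -(expfzDr _ _ p0); congr (_ ^ _); ring.
  by move: (wt R _ n) (p ^ n) (p ^ _) (w ^ k) => *; ring.
have E2 k : w^-1 * lerch_term (n - 1) k = wt R k (n - 1) * m k.
  rewrite /lerch_term /m binz2S.
  have -> : binz2 k + k + k * (n - 1) = binz2 k + k * n by ring.
  by move: (wt R k _) (p ^ _) (w ^ k) => *; ring.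
have sm1 : absum (fun k => wt R (k - 1) n * m k).
  by apply: absum_eq (absumZ (p ^ n) s1) => k; rewrite -E1.
have sm2 : absum (fun k => wt R k (n - 1) * m k).
  by apply: absum_eq (absumZ w^-1 s2) => k; rewrite -E2.
rewrite /lerch_coef -(tsum_shift (-1) (absum_lerch_coef n)) -(tsumZ _ s1) (eq_tsum E1).
rewrite -(tsumZ _ s2) (eq_tsum E2) -(tsumB sm1 sm2).
have hm k : wt R (k - 1) n * m k - wt R k (n - 1) * m k =
    (if n == 0 then m k else 0) - (if k == 0 then m 0 else 0).
  rewrite -mulrBl wt_shift; case: (n == 0); case: (eqVneq k 0) => [->|_]; ring.
have sd := absum_delta (0 : int) (m 0).
have m0 : m 0 = w^-1 by rewrite /m mul0r addr0 !expr0z !mulr1.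
have td : tsum (fun k : int => if k == 0 then m 0 else 0) = w^-1.
  by rewrite (tsum1 (i0 := 0)) ?eqxx// => k /negbTE ->.
rewrite (eq_tsum hm); case: (eqVneq n 0) => [n0|nn0].
  have Em k : w^-1 * tcoef p (- w) k = m k.
    rewrite /m n0 mulr0 addr0 /tcoef -[- w]mulN1r expfzMl.
    have h : (-1) ^ k * (-1) ^ k = 1 :> K by rewrite -expfzMl mulrNN mulr1 exp1rz.
    move: (p ^ binz2 k) (w ^ k) ((-1) ^ k) h => A B C h.
    have -> : C * A * (C * B) = (C * C) * (A * B) by ring.
    by rewrite h mul1r.
  have st := absum_tcoef hp nw0.
  have sm : absum m by apply: absum_eq (absumZ w^-1 st) => k; rewrite -Em.
  rewrite (tsumB sm sd) td -(eq_tsum Em) (tsumZ _ st) -(thetaE hp nw0).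
  by rewrite mulrBr mulr1.
have s0 : absum (fun _ : int => 0 : K).
  by apply: absum_le sd => k; rewrite normr0.
by rewrite (tsumB s0 sd) td tsum0// !sub0r mulrN1.
Qed.

End LerchCoef.

(** * Clearing the poles *)

Section ConvCalculus.
Variable R : realType.
Local Notation K := (cplx R).
Implicit Types (a b d : int -> K).

Lemma expgrow_at d (z : K) : z != 0 -> absum_at d z -> expgrow d.
Proof.
move=> z0 hs; have [M M0 hM] := absum_bound hs.
exists M, (`|z^-1| + `|z^-1|^-1); split; first exact: norm_addV_ge1 (invr_neq0 z0).
move=> n; have h1 := normz_le n (invr_neq0 z0).
have -> : d n = d n * z ^ n * z^-1 ^ n.
  by rewrite exprz_inv -mulrA -(expfzDr _ _ z0) subrr expr0z mulr1.
rewrite (normrM (_ * _)); apply: ler_pM => //.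
by have := hM [fset n]%fset; rewrite big_seq_fset1.
Qed.

Lemma expgrowD d e : expgrow d -> expgrow e -> expgrow (fun n => d n + e n : K).
Proof.
move=> /expgrow_normalize[C [B [C0 B1 h]]] /expgrow_normalize[C' [B' [C0' B1' h']]].
have B0 : 0 <= B := le_trans ler01 B1. have B0' : 0 <= B' := le_trans ler01 B1'.
have B2 : 1 <= B * B' by rewrite mulr_ege1.
exists (C + C'), (B * B'); split=> // n.
apply: le_trans (ler_normD _ _) _; rewrite mulrDl; apply: lerD.
  apply: le_trans (h n) _; rewrite ler_wpM2l// lerXn2r ?nnegrE ?mulr_ge0//.
  by rewrite ler_peMr.
apply: le_trans (h' n) _; rewrite ler_wpM2l// lerXn2r ?nnegrE ?mulr_ge0//.
by rewrite ler_peMl.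
Qed.

Lemma expgrowM d e : expgrow d -> expgrow e -> expgrow (fun n => d n * e n : K).
Proof.
move=> /expgrow_normalize[C [B [C0 B1 h]]] /expgrow_normalize[C' [B' [C0' B1' h']]].
have B0 : 0 <= B := le_trans ler01 B1. have B0' : 0 <= B' := le_trans ler01 B1'.
exists (C * C'), (B * B'); split=> [|n]; first by rewrite mulr_ege1.
by rewrite normrM exprMn mulrACA ler_pM.
Qed.

Lemma expgrow_cst (c : K) : expgrow (fun _ => c).
Proof. by exists `|c|, 1; split=> // n; rewrite expr1n mulr1. Qed.

Lemma expgrow_expz (c : K) : c != 0 -> expgrow (fun n => c ^ n).
Proof.
move=> c0; exists 1, (`|c| + `|c|^-1); split=> [|n]; first exact: norm_addV_ge1.
by rewrite mul1r normz_le.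
Qed.

Lemma expgrow_shift d (m : int) : expgrow d -> expgrow (fun n => d (n + m)).
Proof.
move=> /expgrow_normalize[C [B [C0 B1 h]]]; exists (C * B ^+ `|m|), B; split=> // n.
apply: le_trans (h _) _; rewrite -mulrA ler_wpM2l// -exprD ler_weXn2l//; lia.
Qed.

Lemma convD a d e n : entire a -> expgrow d -> expgrow e ->
  conv a (fun n => d n + e n) n = conv a d n + conv a e n.
Proof.
move=> ha hd he; rewrite /conv -(tsumD (conv_absum n ha hd) (conv_absum n ha he)).
by apply: eq_tsum => m; rewrite mulrDr.
Qed.

Lemma convZ a d (c : K) n : entire a -> expgrow d ->
  conv a (fun n => c * d n) n = c * conv a d n.
Proof.
move=> ha hd; rewrite /conv -(tsumZ c (conv_absum n ha hd)).
by apply: eq_tsum => m; rewrite mulrCA.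
Qed.

Lemma conv_shift a d (m n : int) : conv a (fun n => d (n + m)) n = conv a d (n + m).
Proof. by apply: eq_tsum => k; congr (_ * d _); ring. Qed.

Lemma conv_shiftl a d (m n : int) : entire a -> expgrow d ->
  conv (fun n => a (n + m)) d n = conv a d (n + m).
Proof.
move=> ha hd; rewrite [RHS]/conv -(tsum_shift m (conv_absum (n + m) ha hd)).
by apply: eq_tsum => k; congr (_ * d _); ring.
Qed.

Lemma convZl a d (c : K) n : entire a -> expgrow d ->
  conv (fun n => c * a n) d n = c * conv a d n.
Proof.
move=> ha hd; rewrite /conv -(tsumZ c (conv_absum n ha hd)).
by apply: eq_tsum => m; rewrite mulrA.
Qed.

Lemma conv_dil a d (Q : K) n : Q != 0 ->  entire a -> expgrow d ->
  Q ^ n * conv a d n = conv (fun n => Q ^ n * a n) (fun n => Q ^ n * d n) n.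
Proof.
move=> Q0 ha hd; rewrite /conv -(tsumZ _ (conv_absum n ha hd)); apply: eq_tsum => m.
by rewrite mulrACA -(expfzDr _ _ Q0); congr (_ ^ _ * _); ring.
Qed.

Lemma entire_shift a (m : int) : entire a -> entire (fun n => a (n + m)).
Proof.
move=> ha B0; pose B := `|B0| + 1.
have B1 : 1 <= B by rewrite lerDr.
have BB : 0 <= B := le_trans ler01 B1.
have [C] := ha B; rewrite (ger0_norm BB) => hC.
have C0 : 0 <= C by apply: le_trans (hC 0); rewrite mulr_ge0 ?exprn_ge0.
exists (C * B ^+ `|m|) => n.
apply: le_trans (_ : `|a (n + m)| * B ^+ `|n| <= _).
  by rewrite ler_wpM2l// lerXn2r ?nnegrE// lerDl.
apply: le_trans (_ : `|a (n + m)| * B ^+ `|n + m| * B ^+ `|m| <= _).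
  rewrite -mulrA ler_wpM2l// -exprD ler_weXn2l//; lia.
by rewrite ler_wpM2r ?exprn_ge0.
Qed.

Lemma entireM_bounded a d (M : K) : entire a -> 0 <= M -> (forall n, `|d n| <= M) ->
  entire (fun n => a n * d n).
Proof.
move=> ha M0 hM B; have [C hC] := ha B; exists (C * M) => n.
by rewrite normrM mulrAC ler_pM// mulr_ge0// exprn_ge0.
Qed.

Lemma ev_shift d (z : K) : z != 0 -> absum_at d z ->
  absum_at (fun n => d (n - 1)) z /\ ev (fun n => d (n - 1)) z = z * ev d z.
Proof.
move=> z0 hd; have s := absum_shift (-1) hd.
have E n : z * (d (n - 1) * z ^ (n - 1)) = d (n - 1) * z ^ n.
  by rewrite (expfzDr _ _ z0) exprN1; move: (d _) (z ^ n) => *; field.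
split; first by apply: absum_eq (absumZ z s) => n; rewrite -E.
by rewrite /ev -(eq_tsum E) (tsumZ _ s) (tsum_shift (-1) hd).
Qed.

Lemma evD d e (z : K) : absum_at d z -> absum_at e z ->
  absum_at (fun n => d n + e n) z /\ ev (fun n => d n + e n) z = ev d z + ev e z.
Proof.
move=> hd he; have E n : d n * z ^ n + e n * z ^ n = (d n + e n) * z ^ n by rewrite mulrDl.
split; first by apply: absum_eq (absumD hd he) => n; rewrite E.
by rewrite /ev -(tsumD hd he); apply: eq_tsum => n; rewrite E.
Qed.

Lemma evZ d (c z : K) : absum_at d z ->
  absum_at (fun n => c * d n) z /\ ev (fun n => c * d n) z = c * ev d z.
Proof.
move=> hd; have E n : c * (d n * z ^ n) = c * d n * z ^ n by rewrite mulrA.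
split; first by apply: absum_eq (absumZ c hd) => n; rewrite E.
by rewrite /ev -(tsumZ c hd); apply: eq_tsum => n; rewrite E.
Qed.

Lemma dbl_shift d n : dbl (fun k => d (k - 1)) n = dbl d (n - 2).
Proof.
elim/int_parity: n => k.
  have -> : k * 2 - 2 = (k - 1) * 2 by ring.
  by rewrite !dbl_even.
have -> : k * 2 + 1 - 2 = (k - 1) * 2 + 1 by ring.
by rewrite !dbl_odd.
Qed.

End ConvCalculus.

Lemma absz_sub_le (m n : int) : (`|(n - m)%R| <= `|n| + `|m|)%N.
Proof. lia. Qed.

Lemma odd_neq0 (k : int) : (k * 2 + 1 == 0) = false.
Proof. lia. Qed.

Section DoubleConv.
Variable R : realType.
Local Notation K := (cplx R).

Lemma convE (a d : int -> K) n : conv a d n = tsum (fun m => a m * d (n - m)).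
Proof. by []. Qed.

Lemma expgrow_conv (a d : int -> K) : entire a -> expgrow d -> expgrow (conv a d).
Proof.
move=> ha /expgrow_normalize[C [B [C0 B1 h]]].
have B0 : 0 <= B := le_trans ler01 B1.
have [M M0 hM] := absum_bound (entire_bound ha B1).
exists (C * M), B; split=> // n; apply: tsum_norm => A.
apply: le_trans (_ : \sum_(m <- A) C * B ^+ `|n| * `|a m * B ^+ `|m| | <= _).
  apply: ler_sum => m _; rewrite !normrM [in leRHS]normrX (ger0_norm B0) mulrCA ler_wpM2l//.
  apply: le_trans (h _) _; rewrite -mulrA ler_wpM2l// -exprD ler_weXn2l//.
  exact: absz_sub_le.
by rewrite -mulr_sumr mulrAC ler_wpM2r ?exprn_ge0// ler_wpM2l.
Qed.

Variables a b : int -> K.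
Hypothesis ea : entire a.
Hypothesis eb : entire b.

Definition conv2 (d : int -> K) : int -> K := conv a (conv b d).

Lemma conv2D d e n : expgrow d -> expgrow e ->
  conv2 (fun n => d n + e n) n = conv2 d n + conv2 e n.
Proof.
move=> hd he; rewrite /conv2 -(convD _ ea (expgrow_conv eb hd) (expgrow_conv eb he)).
by congr (conv a _ n); apply/funext => m; rewrite convD.
Qed.

Lemma conv2Z d c n : expgrow d -> conv2 (fun n => c * d n) n = c * conv2 d n.
Proof.
move=> hd; rewrite /conv2 -(convZ _ _ ea (expgrow_conv eb hd)).
by congr (conv a _ n); apply/funext => m; rewrite convZ.
Qed.

Lemma conv2_shift d (m n : int) : conv2 (fun n => d (n + m)) n = conv2 d (n + m).
Proof.
rewrite /conv2 -conv_shift; congr (conv a _ n); apply/funext => k; exact: conv_shift.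
Qed.

(* If multiplying the coefficients by [Q ^ n], i.e. dilating the variable,
   shifts those of [a] and [b], then it shifts the product. *)
Lemma conv2_dil (Q u v : K) (k l : int) d n : Q != 0 ->
  (forall n, Q ^ n * a n = u * a (n + k)) -> (forall n, Q ^ n * b n = v * b (n + l)) ->
  expgrow d ->
  Q ^ n * conv2 d n = u * v * conv2 (fun n => Q ^ n * d n) (n + (k + l)).
Proof.
move=> Q0 ha hb hd; have gd : expgrow (fun n => Q ^ n * d n).
  by apply: expgrowM => //; exact: expgrow_expz.
have g2 := expgrow_conv eb gd.
rewrite /conv2 (conv_dil _ Q0 ea (expgrow_conv eb hd)).
have -> : (fun n => Q ^ n * a n) = (fun n => u * a (n + k)) by apply/funext.
have -> : (fun n => Q ^ n * conv b d n) =
    (fun n => v * conv b (fun n => Q ^ n * d n) (n + l)).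
  apply/funext => m; rewrite (conv_dil _ Q0 eb hd).
  have -> : (fun n => Q ^ n * b n) = (fun n => v * b (n + l)) by apply/funext.
  by rewrite (convZl _ _ (entire_shift l eb) gd) (conv_shiftl _ _ eb gd).
have ek := entire_shift k ea; have gl := expgrow_shift l g2.
rewrite (convZl _ _ ek (expgrowM (expgrow_cst v) gl)) (convZ _ _ ek gl).
rewrite (conv_shift (fun n => a (n + k)) (conv b _)) (conv_shiftl _ _ ea g2).
by rewrite mulrA; congr (_ * conv a _ _); ring.
Qed.

End DoubleConv.

Local Opaque kap conv.

(** * The recurrence of the left-hand side after subtraction *)

Section Core.
Variable R : realType.
Local Notation K := (cplx R).
Variable q : K.
Hypothesis hq : 0 < `|q| < 1.
Let q0 : q != 0. Proof. by rewrite -normr_gt0; case/andP: hq. Qed.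
Let hq2 : 0 < `|q ^+ 2| < 1. Proof. by apply: norm_expr_lt1. Qed.
Let hq4 : 0 < `|q ^+ 4| < 1. Proof. by apply: norm_expr_lt1. Qed.
Let q20 : q ^+ 2 != 0. Proof. by rewrite expf_neq0. Qed.
Let one0 : (1 : K) != 0. Proof. exact: oner_neq0. Qed.

Let j1 := tcoef (q ^+ 2) q.
Let j2 := dbl (tcoef (q ^+ 4) 1).
Let ej1 : entire j1. Proof. exact: entire_tcoef. Qed.
Let ej2 : entire j2. Proof. by apply: entire_dbl; exact: entire_tcoef. Qed.

(* Multiplication by [theta (q * z) (q ^+ 2) * theta (z ^+ 2) (q ^+ 4)]. *)
Definition clear_poles : (int -> K) -> int -> K := conv2 j1 j2.

Lemma dil_j2 n : (q ^+ 2) ^ n * j2 n = - j2 (n + 2).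
Proof.
elim/int_parity: n => k; rewrite /j2.
  have -> : k * 2 + 2 = (k + 1) * 2 by ring.
  have -> : (q ^+ 2) ^ (k * 2) = (q ^+ 4) ^ k.
    by rewrite (exprz_exp q 2) (exprz_exp q 4); congr (_ ^ _); ring.
  by rewrite !dbl_even (dil_tcoef hq4 _ one0) invr1 mulN1r.
have -> : k * 2 + 1 + 2 = (k + 1) * 2 + 1 by ring.
by rewrite !dbl_odd mulr0 oppr0.
Qed.

(** Under $z\mapsto q^2z$ the factor $j(qz;q^2)$ gains $z^{-1}$ and $j(z^2;q^4)$ gains $z^{-2}$, up
    to constants; hence the shift by 3. *)
Lemma clear_poles_dil d n : expgrow d ->
  (q ^+ 2) ^ n * clear_poles d n =
  q^-1 * clear_poles (fun n => (q ^+ 2) ^ n * d n) (n + 3).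
Proof.
move=> hd; have h1 m : (q ^+ 2) ^ m * j1 m = - q^-1 * j1 (m + 1) := dil_tcoef hq2 m q0.
have h2 m : (q ^+ 2) ^ m * j2 m = -1 * j2 (m + 2) by rewrite dil_j2 mulN1r.
rewrite (conv2_dil ej1 ej2 n q20 h1 h2 hd) mulNr mulrN1 opprK.
by [].
Qed.

Lemma clear_poles_dbl d : expgrow d ->
  clear_poles (dbl d) = conv j1 (dbl (conv (tcoef (q ^+ 4) 1) d)).
Proof.
move=> hd; rewrite /clear_poles /conv2 /j2 (conv_dbl hd (entire_tcoef hq4 one0) (expgrow_dbl hd)).
by [].
Qed.

(** The sequence is concentrated formally at $z^2=1$, a zero of [theta (z ^+ 2) (q ^+ 4)]: each
    convolution is the total of the theta coefficients. *)
Lemma clear_poles_one n : clear_poles (dbl (fun _ => 1)) n = 0.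
Proof.
rewrite (clear_poles_dbl (expgrow_cst 1)) convE.
apply: tsum0 => m.
suff -> : dbl (conv (tcoef (q ^+ 4) 1) (fun _ => 1)) (n - m) = 0 by rewrite mulr0.
move: (n - m) => {}n; rewrite /dbl; case: ifP => // _.
by rewrite convE -[RHS](tcoef_total hq4); apply: eq_tsum => k; rewrite mulr1.
Qed.

(** Convolution with $q^n$ evaluates the other factor at $z=1/q$, a zero of
    [theta (q * z) (q ^+ 2)]. *)
Lemma clear_poles_geo n : clear_poles (fun n => q ^ n) n = 0.
Proof.
have gq : expgrow (fun n : int => q ^ n) by exact: expgrow_expz.
have geo (a : int -> K) : entire a -> conv a (fun n => q ^ n) = (fun n => ev a q^-1 * q ^ n).
  move=> ha; apply/funext => m; have s := entire_at ha (invr_neq0 q0).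
  rewrite convE mulrC -(tsumZ _ s) ; apply: eq_tsum => k.
  by rewrite (expfzDr _ _ q0) exprz_inv mulrCA.
rewrite /clear_poles /conv2 (geo _ ej2) (convZ _ _ ej1 gq) (geo _ ej1) (theta_ev hq2 q0 (invr_neq0 q0)).
by rewrite divff// (theta1 hq2) mul0r mulr0.
Qed.

Lemma clear_poles_kap (u : K) n : `|q ^+ 4| < `|u| < 1 ->
  clear_poles (dbl (fun k => kap (q ^+ 4) u (k - 1))) n =
  qpoch (q ^+ 4) (q ^+ 4) ^+ 3 / theta u (q ^+ 4) * conv j1 (dbl (tcoef (q ^+ 4) u)) (n - 2).
Proof.
move=> hu; have gk := expgrow_kap hq4 hu.
rewrite (clear_poles_dbl (expgrow_shift (-1) gk)).
have -> : conv (tcoef (q ^+ 4) 1) (fun k => kap (q ^+ 4) u (k - 1)) =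
    (fun k => (fun k => qpoch (q ^+ 4) (q ^+ 4) ^+ 3 / theta u (q ^+ 4) * tcoef (q ^+ 4) u k) (k - 1)).
  by apply/funext => k; rewrite conv_shift (conv_kap hq4 hu).
have u0 := annulus_neq0 hq4 hu.
set C := _ / _.
have -> : dbl (fun k => (fun k => C * tcoef (q ^+ 4) u k) (k - 1)) =
    (fun n => C * dbl (tcoef (q ^+ 4) u) (n + (- 2))).
  apply/funext => m; rewrite (dbl_shift (fun k => C * tcoef (q ^+ 4) u k)).
  by move: (m - 2) => {}m; rewrite /dbl; case: ifP => _; rewrite ?mulr0.
have gt : expgrow (dbl (tcoef (q ^+ 4) u)).
  by apply: entire_expgrow; apply: entire_dbl; exact: entire_tcoef.
by rewrite (convZ _ _ ej1 (expgrow_shift (-2) gt)) conv_shift.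
Qed.

Variables x y : K.
Hypothesis hx : `|q| < `|x| < 1.
Hypothesis hy : `|q| < `|y| < 1.
Let x0 : x != 0. Proof. exact: (annulus_neq0 hq hx). Qed.
Let y0 : y != 0. Proof. exact: (annulus_neq0 hq hy). Qed.
Let w := x * y.
Let w0 : w != 0. Proof. by rewrite mulf_neq0. Qed.
Let X := q ^+ 2 * x ^+ 2.
Let Y := q ^+ 2 * y ^+ 2.

Lemma annulus_prod : `|q ^+ 2| < `|w| < 1.
Proof.
have [x1 x2] := andP hx; have [y1 y2] := andP hy; have [p0 p1] := andP hq.
rewrite /w [in X in X && _]normrX (normrM x) expr2; apply/andP; split; first by apply: ltr_pM.
by apply: lt_trans y2; rewrite -[ltRHS]mul1r ltr_pM2r//; apply: lt_trans y1.
Qed.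
Let hw := annulus_prod.

Lemma theta_w_neq0 : theta (- w) (q ^+ 2) != 0.
Proof. by apply: theta_neq0 => //; rewrite normrN; exact: hw. Qed.

(** Chosen so that [B4] times the jump $w^{-1}j(-w;q^2)$ of [lerch4_coef] at [n = 0] is [K11]. By
    [last_term] it is, up to sign and normalisation, the coefficient of the last term in the
    theorem. *)
Definition B4 : K := K11 q x y * w / theta (- w) (q ^+ 2).

Definition lhs_coef (n : int) : K :=
  dbl (even_coef q x y) n + dbl (odd_coef q x y) (n - 1).

(** The variable of the Lerch sum is $qz$, whence the factor $q^n$. *)
Definition lerch4_coef (n : int) : K := q ^ n * lerch_coef (q ^+ 2) w n.

Definition diff_coef (n : int) : K := lhs_coef n - B4 * lerch4_coef n.

Definition jump (n : int) : K :=
  - (q / w) * (dbl (fun k => kap (q ^+ 4) X (k - 1)) n + dbl (fun k => kap (q ^+ 4) Y (k - 1)) n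
    - dbl (fun _ => 1) n) + B4 / w * q ^ n.

(** Even and odd [n] come from [even_coef_rec] and [odd_coef_rec]; the term at [n = 0] disappears by
    the choice of [B4], and [jump] collects what is left. *)
Lemma diff_coef_rec n : (q ^+ 2) ^ n * diff_coef n = q / w * diff_coef (n - 1) + jump n.
Proof.
have ht : (q ^+ 2) ^ n * lerch4_coef n = q / w * lerch4_coef (n - 1) +
    w^-1 * q ^ n * ((if n == 0 then theta (- w) (q ^+ 2) else 0) - 1).
  have := lerch_coef_rec hq2 hw n; rewrite /lerch4_coef (expfzDr _ _ q0) exprN1.
  move: ((q ^+ 2) ^ n) (lerch_coef _ w n) (lerch_coef _ w (n - 1)) (q ^ n) (if n == 0 then _ else _).
  move=> A B C D E h.
  have -> : A * (D * B) = D * (A * B - w^-1 * C) + D * w^-1 * C by ring.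
  rewrite h; field; by rewrite w0 q0.
have hs : (q ^+ 2) ^ n * lhs_coef n = q / w * lhs_coef (n - 1) -
    q / w * (dbl (fun k => kap (q ^+ 4) X (k - 1)) n + dbl (fun k => kap (q ^+ 4) Y (k - 1)) n
    - dbl (fun _ => 1) n) + (if n == 0 then K11 q x y else 0).
  rewrite /lhs_coef; elim/int_parity: {ht} n => k.
    have -> : k * 2 - 1 - 1 = (k - 1) * 2 by ring.
    have -> : k * 2 - 1 = (k - 1) * 2 + 1 by ring.
    rewrite !dbl_even !dbl_odd addr0 add0r.
    have -> : (q ^+ 2) ^ (k * 2) = q ^ (4 * k) by rewrite (exprz_exp q 2); congr (_ ^ _); ring.
    have -> : (k * 2 == 0) = (k == 0) by rewrite mulf_eq0 orbF.
    have := even_coef_rec hq hx hy k; rewrite -/w -/X -/Y.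
    move: (q ^ (4 * k)) (even_coef q x y k) (odd_coef q x y (k - 1)) (kap _ X _) (kap _ Y _) (if k == 0 then _ else _).
    move=> A B C D E F h.
    have -> : A * B = (A * B - q / w * C) + q / w * C by ring.
    by rewrite h; ring.
  have -> : k * 2 + 1 - 1 = k * 2 by ring.
  have -> : k * 2 - 1 = (k - 1) * 2 + 1 by ring.
  rewrite !dbl_even !dbl_odd addr0 add0r.
  have -> : (q ^+ 2) ^ (k * 2 + 1) = q ^ (4 * k + 2) by rewrite (exprz_exp q 2); congr (_ ^ _); ring.
  have -> : (k * 2 + 1 == 0) = false by apply: odd_neq0.
  by rewrite (odd_coef_rec hq hx hy) -/w; ring.
rewrite /diff_coef /jump mulrBr (mulrCA _ B4) hs ht.
have -> : (if n == 0 then K11 q x y else 0) =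
    B4 * (w^-1 * q ^ n * (if n == 0 then theta (- w) (q ^+ 2) else 0)).
  case: eqP => [->|_]; last by rewrite !mulr0.
  rewrite expr0z mulr1 /B4; have := theta_w_neq0.
  by move: (theta (- w) _) (K11 q x y) => T C T0; field; rewrite w0 T0.
move: (dbl _ n) (dbl _ n) (dbl _ n) (q ^ n) (if n == 0 then _ else _) (lhs_coef _) (lerch4_coef _) B4.
by move=> *; ring.
Qed.

End Core.

(** * The three remaining terms: their coefficients and their values at $z=\pm1$ *)

Section Identity.
Variable R : realType.
Local Notation K := (cplx R).
Variable q : K.
Hypothesis hq : 0 < `|q| < 1.
Let q0 : q != 0. Proof. by rewrite -normr_gt0; case/andP: hq. Qed.
Let q1 : `|q| < 1. Proof. by case/andP: hq. Qed.
Let hq2 : 0 < `|q ^+ 2| < 1. Proof. by apply: norm_expr_lt1. Qed.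
Let hq4 : 0 < `|q ^+ 4| < 1. Proof. by apply: norm_expr_lt1. Qed.
Let q20 : q ^+ 2 != 0. Proof. by rewrite expf_neq0. Qed.
Let q40 : q ^+ 4 != 0. Proof. by rewrite expf_neq0. Qed.
Let one0 : (1 : K) != 0. Proof. exact: oner_neq0. Qed.
Let hqq : `|q ^+ 2| < `|q| < 1.
Proof. by rewrite q1 normrX expr2 gtr_pMr ?q1//; case/andP: hq. Qed.

Let j1 := tcoef (q ^+ 2) q.
Let j2 := dbl (tcoef (q ^+ 4) 1).
Let ej1 : entire j1. Proof. exact: entire_tcoef. Qed.
Let ej2 : entire j2. Proof. by apply: entire_dbl; exact: entire_tcoef. Qed.
Let J2 := qpoch (q ^+ 2) (q ^+ 2).
Let J4 := qpoch (q ^+ 4) (q ^+ 4).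
Let J20 : J2 != 0. Proof. exact: J_neq0. Qed.
Let J40 : J4 != 0. Proof. exact: J_neq0. Qed.

Lemma theta_sqr2 (u : K) : u != 0 ->
  theta u (q ^+ 2) * theta (- u) (q ^+ 2) = theta (u ^+ 2) (q ^+ 4) * (J2 ^+ 2 / J4).
Proof. by move=> u0; rewrite (theta_sqr hq2 u0) -exprM. Qed.

Lemma theta_q2 : theta (q ^+ 2) (q ^+ 4) = J2 ^+ 2 / J4.
Proof.
rewrite thetaF; have -> : q ^+ 4 / q ^+ 2 = q ^+ 2 by field.
have h := qpoch_split hq2 (q ^+ 2); rewrite -exprM -exprD in h.
rewrite /J2 h -/J4; move: (qpoch (q ^+ 2) (q ^+ 4)) => A; by field.
Qed.

Lemma theta_pm_q (eps : K) : eps ^+ 2 = 1 ->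
  theta (q * eps) (q ^+ 2) * th3 q eps = (J2 ^+ 2 / J4) ^+ 2.
Proof.
move=> he; have e0 : eps != 0.
  by apply/eqP => h; move: he; rewrite h expr0n => /eqP; rewrite eq_sym oner_eq0.
rewrite /th3 (theta_sqr2 (mulf_neq0 q0 e0)) exprMn he mulr1 theta_q2.
by rewrite expr2.
Qed.

Definition lerch_seq (x y : K) (k : int) : K :=
  tcoef (q ^+ 2) (- (q * y)) k * kap (q ^+ 2) x k.

(** A side term times the clearing factor, up to a constant: $j(z^2;q^4)$ cancels, and
    $j(q^2y^2z^2;q^4)/j(-qyz;q^2)$ is a multiple of $j(qyz;q^2)$. The index [n - 1] accounts for the
    prefactor $z$. *)
Definition prod_coef (x y : K) (n : int) : K :=
  conv2 j1 (tcoef (q ^+ 2) (q * y)) (lerch_seq x y) (n - 1).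

Lemma entire_lerch_seq (x y : K) : `|q| < `|x| < 1 -> y != 0 -> entire (lerch_seq x y).
Proof.
move=> hx y0; have [M M0 hM] := kap_bound hq2 (annulus_q2 hq hx).
have ny0 : - (q * y) != 0 by rewrite oppr_eq0 mulf_neq0.
apply: (entireM_bounded (entire_tcoef hq2 ny0) M0) => n.
by have [] := hM n.
Qed.

(** Dilation turns [kap] into $x^{-1}$ times [kap - 1], so the Lerch series reproduces itself up to
    a theta series; the latter merges with $j(qyz;q^2)$ into a theta function of nome $q^4$. *)
Lemma prod_coef_rec (x y : K) n : `|q| < `|x| < 1 -> y != 0 ->
  (q ^+ 2) ^ n * prod_coef x y n = (x * y)^-1 * (prod_coef x y (n + 2)
    - J2 ^+ 2 / J4 * conv j1 (dbl (tcoef (q ^+ 4) (q ^+ 2 * y ^+ 2))) (n + 1)).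
Proof.
move=> hx y0; have x0 := annulus_neq0 hq hx.
have qy0 : q * y != 0 by rewrite mulf_neq0.
have nqy0 : - (q * y) != 0 by rewrite oppr_eq0.
have Y0 : q ^+ 2 * y ^+ 2 != 0 by rewrite mulf_neq0 ?expf_neq0.
have eg := entire_tcoef hq2 qy0; have et := entire_tcoef hq2 nqy0.
have ephi := entire_lerch_seq hx y0.
have gphi := entire_expgrow ephi; have gt := entire_expgrow et.
have gdt : expgrow (dbl (tcoef (q ^+ 4) (q ^+ 2 * y ^+ 2))).
  by apply: entire_expgrow; apply: entire_dbl; exact: entire_tcoef.
have h1 m : (q ^+ 2) ^ m * j1 m = - q^-1 * j1 (m + 1) := dil_tcoef hq2 m q0.
have h2 m : (q ^+ 2) ^ m * tcoef (q ^+ 2) (q * y) m = - (q * y)^-1 * tcoef (q ^+ 2) (q * y) (m + 1) :=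
  dil_tcoef hq2 m qy0.
have hphi : (fun m => (q ^+ 2) ^ m * lerch_seq x y m) =
    (fun m => x^-1 * (lerch_seq x y m + -1 * tcoef (q ^+ 2) (- (q * y)) m)).
  apply/funext => m; rewrite /lerch_seq.
  have := kap_den_neq0 hq2 m (annulus_q2 hq hx).
  have -> : kap (q ^+ 2) x m = (1 - (q ^+ 2) ^ m * x)^-1 by [].
  by move: ((q ^+ 2) ^ m) (tcoef _ _ m) => A B A0; field; rewrite x0 A0.
have hc : conv (tcoef (q ^+ 2) (q * y)) (tcoef (q ^+ 2) (- (q * y))) =
    (fun n => J2 ^+ 2 / J4 * dbl (tcoef (q ^+ 4) (q ^+ 2 * y ^+ 2)) n).
  by rewrite (conv_tcoef_opp hq2 qy0 hqq) -exprM exprMn.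
have gneg := expgrowM (expgrow_cst (-1)) gt.
rewrite /prod_coef.
have -> : (q ^+ 2) ^ n = q ^+ 2 * (q ^+ 2) ^ (n - 1).
  by rewrite (expfzDr _ _ q20) exprN1; move: ((q ^+ 2) ^ n) => A; field.
rewrite -[LHS]mulrA (conv2_dil ej1 eg (n - 1) q20 h1 h2 gphi) hphi.
rewrite (conv2Z ej1 eg _ _ (expgrowD gphi gneg)) (conv2D ej1 eg _ gphi gneg) (conv2Z ej1 eg _ _ gt).
have -> : n - 1 + (1 + 1) = n + 1 by ring.
have -> : n + 2 - 1 = n + 1 by ring.
have -> : conv2 j1 (tcoef (q ^+ 2) (q * y)) (tcoef (q ^+ 2) (- (q * y))) (n + 1) =
    J2 ^+ 2 / J4 * conv j1 (dbl (tcoef (q ^+ 4) (q ^+ 2 * y ^+ 2))) (n + 1).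
  by rewrite /conv2 hc (convZ _ _ ej1 gdt).
move: (conv2 _ _ _ _) (conv _ _ _) => A B; by field; rewrite x0 y0 q0 J40.
Qed.

Lemma prod_coef_ev (x y z : K) : `|q| < `|x| < 1 -> y != 0 -> z != 0 ->
  absum_at (prod_coef x y) z /\ ev (prod_coef x y) z =
    z * (theta (q * z) (q ^+ 2) * (theta (q * y * z) (q ^+ 2) * lerch q x (y * z))).
Proof.
move=> hx y0 z0; have qy0 : q * y != 0 by rewrite mulf_neq0.
have eg := entire_tcoef hq2 qy0; have ephi := entire_lerch_seq hx y0.
have [s1 e1] := ev_conv z0 eg (entire_at ephi z0).
have [s2 e2] := ev_conv z0 ej1 s1.
have [s3 e3] := ev_shift z0 s2.
split; first exact: s3.
rewrite /prod_coef /conv2 e3 e2 e1 (theta_ev hq2 q0 z0) (theta_ev hq2 qy0 z0).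
congr (_ * (_ * (_ * _))); apply: eq_tsum => k; rewrite /lerch_seq.
have -> : - (q * (y * z)) = - (q * y) * z by ring.
by rewrite -tcoef_scale mulrAC.
Qed.

Variables x y : K.
Hypothesis hx : `|q| < `|x| < 1.
Hypothesis hy : `|q| < `|y| < 1.
Let x0 : x != 0. Proof. exact: (annulus_neq0 hq hx). Qed.
Let y0 : y != 0. Proof. exact: (annulus_neq0 hq hy). Qed.
Let w := x * y.
Let w0 : w != 0. Proof. by rewrite mulf_neq0. Qed.
Let hw : `|q ^+ 2| < `|w| < 1. Proof. exact: annulus_prod. Qed.
Let X := q ^+ 2 * x ^+ 2.
Let Y := q ^+ 2 * y ^+ 2.
Let hX : `|q ^+ 4| < `|X| < 1. Proof. exact: annulus_q4. Qed.
Let hY : `|q ^+ 4| < `|Y| < 1. Proof. exact: annulus_q4. Qed.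
Let tX0 : theta X (q ^+ 4) != 0. Proof. exact: theta_neq0. Qed.
Let tY0 : theta Y (q ^+ 4) != 0. Proof. exact: theta_neq0. Qed.

Definition pair_coef (n : int) : K := conv (tcoef (q ^+ 2) (q * x)) (tcoef (q ^+ 2) (q * y)) (n - 1).

Let qx0 : q * x != 0. Proof. by rewrite mulf_neq0. Qed.
Let qy0 : q * y != 0. Proof. by rewrite mulf_neq0. Qed.
Let egx : entire (tcoef (q ^+ 2) (q * x)). Proof. exact: entire_tcoef. Qed.
Let egy : entire (tcoef (q ^+ 2) (q * y)). Proof. exact: entire_tcoef. Qed.

Lemma pair_coef_rec n : (q ^+ 2) ^ n * pair_coef n = w^-1 * pair_coef (n + 2).
Proof.
rewrite /pair_coef.
have -> : (q ^+ 2) ^ n = q ^+ 2 * (q ^+ 2) ^ (n - 1).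
  by rewrite (expfzDr _ _ q20) exprN1; move: ((q ^+ 2) ^ n) => A; field.
have gy := entire_expgrow egy.
rewrite -[LHS]mulrA (conv_dil _ q20 egx gy).
have -> : (fun n => (q ^+ 2) ^ n * tcoef (q ^+ 2) (q * x) n) =
    (fun n => - (q * x)^-1 * tcoef (q ^+ 2) (q * x) (n + 1)).
  by apply/funext => m; exact: (dil_tcoef hq2 m qx0).
have -> : (fun n => (q ^+ 2) ^ n * tcoef (q ^+ 2) (q * y) n) =
    (fun n => - (q * y)^-1 * tcoef (q ^+ 2) (q * y) (n + 1)).
  by apply/funext => m; exact: (dil_tcoef hq2 m qy0).
have e' := entire_shift 1 egx; have g' := expgrow_shift 1 gy.
rewrite (convZl _ _ e' (expgrowM (expgrow_cst _) g')) (convZ _ _ e' g').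
rewrite (conv_shift (fun n => tcoef (q ^+ 2) (q * x) (n + 1)) (tcoef (q ^+ 2) (q * y))) (conv_shiftl _ _ egx gy).
have -> : n - 1 + 1 + 1 = n + 2 - 1 by ring.
by move: (conv _ _ _) => A; rewrite /w; field; rewrite x0 y0 q0.
Qed.

Lemma pair_coef_ev (z : K) : z != 0 -> absum_at pair_coef z /\
  ev pair_coef z = z * (theta (q * x * z) (q ^+ 2) * theta (q * y * z) (q ^+ 2)).
Proof.
move=> z0; have [s1 e1] := ev_conv z0 egx (entire_at egy z0).
have [s3 e3] := ev_shift z0 s1.
split; first exact: s3.
by rewrite /pair_coef e3 e1 (theta_ev hq2 qx0 z0) (theta_ev hq2 qy0 z0).
Qed.

(** [c1] is $J_4^3$ divided by the constant $J_2^2/J_4$ of [theta_sqr2]; [c3] is the negative of the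
    factor isolated by [triple_product_term]. *)
Let c1 := J4 ^+ 4 / J2 ^+ 2.
Let c3 := - (J2 ^+ 3 * J4 ^+ 3 * theta w (q ^+ 2) /
  (theta x (q ^+ 2) * theta y (q ^+ 2) * (theta X (q ^+ 4) * theta Y (q ^+ 4)))).

Definition rhs_coef (n : int) : K :=
  c1 / theta Y (q ^+ 4) * prod_coef x y n + c1 / theta X (q ^+ 4) * prod_coef y x n
  + c3 * pair_coef n.

Definition rhs_value (z : K) : K :=
  z * (c1 * theta (q * z) (q ^+ 2) * (theta (q * y * z) (q ^+ 2) * lerch q x (y * z) / theta Y (q ^+ 4)
     + theta (q * x * z) (q ^+ 2) * lerch q y (x * z) / theta X (q ^+ 4))
  + c3 * (theta (q * x * z) (q ^+ 2) * theta (q * y * z) (q ^+ 2))).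

Lemma rhs_coef_ev (z : K) : z != 0 -> absum_at rhs_coef z /\ ev rhs_coef z = rhs_value z.
Proof.
move=> z0; have [s1 e1] := prod_coef_ev hx y0 z0; have [s2 e2] := prod_coef_ev hy x0 z0.
have [s3 e3] := pair_coef_ev z0.
have [s1' e1'] := evZ (c1 / theta Y (q ^+ 4)) s1.
have [s2' e2'] := evZ (c1 / theta X (q ^+ 4)) s2.
have [s3' e3'] := evZ c3 s3.
have [s4 e4] := evD s1' s2'; have [s5 e5] := evD s4 s3'.
split; first exact: s5.
rewrite /rhs_coef e5 e4 e1' e2' e3' e1 e2 e3 /rhs_value.
move: (theta _ _) (theta _ _) (theta _ _) (theta _ _) (theta _ _) c1 c3 => *; ring.
Qed.

Let error_term n := J4 ^+ 3 / theta X (q ^+ 4) * conv j1 (dbl (tcoef (q ^+ 4) X)) n +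
  J4 ^+ 3 / theta Y (q ^+ 4) * conv j1 (dbl (tcoef (q ^+ 4) Y)) n.

(** The inhomogeneity $J_2^2/J_4$ of [prod_coef_rec] times [c1] is $J_4^3$, which makes it equal to
    the one in [cleared_rec]. *)
Lemma rhs_coef_rec n : (q ^+ 2) ^ n * rhs_coef n =
  w^-1 * (rhs_coef (n + 2) - error_term (n + 1)).
Proof.
rewrite /rhs_coef !mulrDr !(mulrCA ((q ^+ 2) ^ n)) pair_coef_rec.
rewrite (prod_coef_rec n hx y0) (prod_coef_rec n hy x0) (mulrC y x) -/w -/X -/Y /error_term /c1.
move: (conv _ _ _) (conv _ _ _) (prod_coef _ _ _) (prod_coef _ _ _) (pair_coef _) c3 tX0 tY0.
move: (theta X _) (theta Y _) => A B C D E F G H A0 B0.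
by field; rewrite w0 A0 B0 J20 J40.
Qed.

(** At $z=\pm1$ each $j(quz;q^2)$ is a constant multiple of $j(q^2u^2;q^4)$ over [th3 q (z * u)].
    Over a common denominator the two Lerch sums take exactly the form of [th3_product]. *)
Lemma rhs_value_pm1 (eps : K) : eps ^+ 2 = 1 ->
  rhs_value eps = eps * (J4 ^+ 3 * theta (q * eps) (q ^+ 2)).
Proof.
move=> he; have e0 : eps != 0.
  by apply/eqP => h; move: he; rewrite h expr0n => /eqP; rewrite eq_sym oner_eq0.
have h := th3_product hq hx hy he.
rewrite (kronecker hq2 (annulus_q2 hq hx) (annulus_q2 hq hy)) -/J2 -/w in h.
have hT (u : K) : u != 0 -> theta (q * u * eps) (q ^+ 2) * th3 q (eps * u) =
    theta (q ^+ 2 * u ^+ 2) (q ^+ 4) * (J2 ^+ 2 / J4).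
  move=> u0; have qu0 : q * (eps * u) != 0 by rewrite !mulf_neq0.
  have -> : q * u * eps = q * (eps * u) by ring.
  by rewrite /th3 (theta_sqr2 qu0) !exprMn he mul1r.
have hTx := hT _ x0; have hTy := hT _ y0; rewrite -/X -/Y in hTx hTy.
have c24 : J2 ^+ 2 / J4 != 0 by rewrite mulf_neq0 ?invr_neq0 ?expf_neq0.
have t0 (u v : K) a : u * v = a * (J2 ^+ 2 / J4) -> a != 0 -> (u != 0) && (v != 0).
  by move=> huv a0; rewrite -negb_or -mulf_eq0 huv mulf_neq0.
have /andP[ux0 vx0] := t0 _ _ _ hTx tX0; have /andP[uy0 vy0] := t0 _ _ _ hTy tY0.
have ht := theta_pm_q he.
have tx0 := theta_neq0 hq2 (annulus_q2 hq hx); have ty0 := theta_neq0 hq2 (annulus_q2 hq hy).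
rewrite /rhs_value /c1 /c3.
have -> : theta (q * x * eps) (q ^+ 2) = theta X (q ^+ 4) * (J2 ^+ 2 / J4) / th3 q (eps * x).
  by rewrite -hTx mulfK.
have -> : theta (q * y * eps) (q ^+ 2) = theta Y (q ^+ 4) * (J2 ^+ 2 / J4) / th3 q (eps * y).
  by rewrite -hTy mulfK.
rewrite (mulrC y eps) (mulrC x eps).
move: (theta (q * eps) _) (th3 q eps) (th3 q (eps * x)) (th3 q (eps * y)) (theta X _) (theta Y _)
  (theta x _) (theta y _) (theta w _) (lerch q x _) (lerch q y _) J2 J4 J20 J40
  vx0 vy0 tX0 tY0 tx0 ty0 h ht.
move=> A B C D E F G H I L M N P N0 P0 C0 D0 E0 F0 G0 H0 h ht.
congr (_ * _).
transitivity (P ^+ 3 * (A * (C * L + D * M) - (A * B) * (N ^+ 3 * I / (G * H))) / (C * D)).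
  rewrite ht; field; by rewrite N0 P0 C0 D0 E0 F0 G0 H0.
(* The lattice identity enters here; its Kronecker part cancels the product term, and only [C * D]
   survives. *)
have -> : C * L + D * M = C * D + B * (N ^+ 3 * I / (G * H)) by rewrite -h; ring.
by field; rewrite ?N0 ?P0 ?C0 ?D0 ?G0 ?H0.
Qed.

End Identity.

(** * Uniqueness of the Laurent coefficients *)

Section Uniqueness.
Variable R : realType.
Local Notation K := (cplx R).
Variable q : K.
Hypothesis hq : 0 < `|q| < 1.
Let q0 : q != 0. Proof. by rewrite -normr_gt0; case/andP: hq. Qed.
Let q1 : `|q| < 1. Proof. by case/andP: hq. Qed.
Let hq2 : 0 < `|q ^+ 2| < 1. Proof. by apply: norm_expr_lt1. Qed.
Let hq4 : 0 < `|q ^+ 4| < 1. Proof. by apply: norm_expr_lt1. Qed.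
Let q20 : q ^+ 2 != 0. Proof. by rewrite expf_neq0. Qed.
Let q40 : q ^+ 4 != 0. Proof. by rewrite expf_neq0. Qed.
Let one0 : (1 : K) != 0. Proof. exact: oner_neq0. Qed.
Let ej1 : entire (tcoef (q ^+ 2) q). Proof. exact: entire_tcoef. Qed.
Let ej2 : entire (dbl (tcoef (q ^+ 4) 1)). Proof. by apply: entire_dbl; exact: entire_tcoef. Qed.

(** Even and odd indices decouple, so [v] is determined by [v 0] and [v 1]; the basis consists of
    the coefficients of $j(-wz^2;q^4)$ and $z\,j(-q^2wz^2;q^4)$. *)
Lemma dilation_solution (w : K) (v : int -> K) : w != 0 ->
  (forall n, (q ^+ 2) ^ n * v n = w^-1 * v (n + 2)) ->
  v = (fun n => v 0 * dbl (tcoef (q ^+ 4) (- w)) n +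
     v 1 * (fun m => dbl (tcoef (q ^+ 4) (- (q ^+ 2 * w))) (m - 1)) n).
Proof.
move=> w0 hv.
have hv' n : v (n + 2) = w * (q ^+ 2) ^ n * v n by rewrite -mulrA hv mulrA divff// mul1r.
have t0 (a : K) : tcoef (q ^+ 4) a 0 = 1 by rewrite /tcoef !expr0z !mulr1.
have nw0 : - w != 0 by rewrite oppr_eq0.
have nqw0 : - (q ^+ 2 * w) != 0 by rewrite oppr_eq0 mulf_neq0.
apply/funext; apply: int_ind2 => [||n].
- have := dbl_even (tcoef (q ^+ 4) (- w)) 0; rewrite mul0r => ->.
  have := dbl_odd (tcoef (q ^+ 4) (- (q ^+ 2 * w))) (-1).
  have -> : -1 * 2 + 1 = 0 - 1 :> int by [].
  by move=> ->; rewrite mulr0 addr0 t0 mulr1.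
- have := dbl_odd (tcoef (q ^+ 4) (- w)) 0; rewrite mul0r add0r => ->.
  have := dbl_even (tcoef (q ^+ 4) (- (q ^+ 2 * w))) 0; rewrite mul0r subrr => ->.
  by rewrite mulr0 add0r t0 mulr1.
have -> : v 0 * dbl (tcoef (q ^+ 4) (- w)) (n + 2) +
     v 1 * dbl (tcoef (q ^+ 4) (- (q ^+ 2 * w))) (n + 2 - 1) =
   w * (q ^+ 2) ^ n * (v 0 * dbl (tcoef (q ^+ 4) (- w)) n +
     v 1 * dbl (tcoef (q ^+ 4) (- (q ^+ 2 * w))) (n - 1)).
  elim/int_parity: n => k.
    have -> : k * 2 + 2 = (k + 1) * 2 by ring.
    have -> : (k + 1) * 2 - 1 = k * 2 + 1 by ring.
    have -> : k * 2 - 1 = (k - 1) * 2 + 1 by ring.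
    rewrite !dbl_even !dbl_odd !mulr0 !addr0 (tcoefS _ q40 nw0) opprK (exprz_exp q 2) (exprz_exp q 4).
    have -> : 2 * (k * 2) = 4 * k by ring.
    by move: (q ^ (4 * k)) (tcoef _ _ k) => A B; ring.
  have -> : k * 2 + 1 + 2 - 1 = (k + 1) * 2 by ring.
  have -> : k * 2 + 1 + 2 = (k + 1) * 2 + 1 by ring.
  have -> : k * 2 + 1 - 1 = k * 2 by ring.
  rewrite !dbl_even !dbl_odd !mulr0 !add0r (tcoefS _ q40 nqw0) opprK (exprz_exp q 2) (exprz_exp q 4).
  rewrite mulrDr (expfzDr _ _ q0).
  have -> : 2 * (k * 2) = 4 * k by ring.
  have -> : q ^ (2 * 1) = q ^+ 2 by [].
  by move: (q ^ (4 * k)) (tcoef _ _ k) => A B; ring.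
rewrite hv'; split=> [->//|].
by apply: mulfI; rewrite mulf_neq0// expfz_neq0.
Qed.

Variables x y : K.
Hypothesis hx : `|q| < `|x| < 1.
Hypothesis hy : `|q| < `|y| < 1.
Let x0 : x != 0. Proof. exact: (annulus_neq0 hq hx). Qed.
Let y0 : y != 0. Proof. exact: (annulus_neq0 hq hy). Qed.
Let w := x * y.
Let w0 : w != 0. Proof. by rewrite mulf_neq0. Qed.
Let hw : `|q ^+ 2| < `|w| < 1. Proof. exact: annulus_prod. Qed.
Let X := q ^+ 2 * x ^+ 2.
Let Y := q ^+ 2 * y ^+ 2.
Let hX : `|q ^+ 4| < `|X| < 1. Proof. exact: annulus_q4. Qed.
Let hY : `|q ^+ 4| < `|Y| < 1. Proof. exact: annulus_q4. Qed.
Let J4 := qpoch (q ^+ 4) (q ^+ 4).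

Lemma even_coef_at (Z : K) : `|q ^+ 2| < `|Z| -> `|q ^+ 2 * Z| < 1 ->
  absum_at (even_coef q x y) Z.
Proof.
move=> h1 h2; apply: absum_eq (absum_tsum (absum_even_term hq hx hy h1 h2)) => k /=.
rewrite /even_coef mulrC -(tsumZ _ (absum_even hq hx hy k)); apply: eq_tsum => ab.
exact: mulrC.
Qed.

Lemma odd_coef_red_at (Z : K) : `|q ^+ 2| < `|Z| -> `|q ^+ 2 * Z| < 1 ->
  absum_at (odd_coef_red q x y) Z.
Proof.
move=> h1 h2; apply: absum_eq (absum_tsum (absum_odd_term_red hq hx hy h1 h2)) => k /=.
rewrite /odd_coef_red mulrC -(tsumZ _ (absum_odd_red hq hx hy k)); apply: eq_tsum => ab.
exact: mulrC.
Qed.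

Definition lhs_red (n : int) : K :=
  dbl (even_coef q x y) n + (fun m => dbl (odd_coef_red q x y) (m - 1)) n.

Lemma lhs_coefE n : lhs_coef q x y n = lhs_red n + dbl (step R) (n - 1).
Proof.
rewrite /lhs_coef /lhs_red -addrA; congr (_ + _).
have h k : odd_coef q x y k = odd_coef_red q x y k + step R k := odd_coefE hq hx hy k.
by rewrite /dbl; case: ifP => _; rewrite ?h ?addr0.
Qed.

Section WideAnnulus.
Variable z : K.
Hypothesis z1 : `|q| < `|z|.
Hypothesis z2 : `|q * z| < 1.
Let z0 : z != 0. Proof. by rewrite -normr_gt0; apply: lt_trans z1; case/andP: hq. Qed.
Let zz0 : z ^+ 2 != 0. Proof. by rewrite expf_neq0. Qed.

Let hZ1 : `|q ^+ 2| < `|z ^+ 2|.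
Proof. by rewrite !normrX ltrXn2r// nnegrE. Qed.
Let hZ2 : `|q ^+ 2 * z ^+ 2| < 1.
Proof. by rewrite -exprMn normrX exprn_ilt1. Qed.

Lemma lhs_red_at : absum_at lhs_red z.
Proof.
have [s1 _] := ev_dbl (even_coef_at hZ1 hZ2).
have [s2 _] := ev_dbl (odd_coef_red_at hZ1 hZ2).
have [s3 _] := ev_shift z0 s2.
by have [s4 _] := evD s1 s3.
Qed.

Lemma lerch4_at : absum_at (lerch4_coef q x y) z /\
  ev (lerch4_coef q x y) z = lerch q (q * z) (q * w).
Proof.
have hqz : `|q ^+ 2| < `|q * z| < 1.
  by rewrite z2 andbT normrX normrM expr2 ltr_pM2l//; case/andP: hq.
have [s e] := lerch_ev hq2 hw hqz.
have E n : lerch_coef (q ^+ 2) w n * (q * z) ^ n = lerch4_coef q x y n * z ^ n.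
  by rewrite /lerch4_coef -/w expfzMl mulrA (mulrC _ (q ^ n)).
split; first by apply: absum_eq s => n; rewrite -E.
rewrite /ev -(eq_tsum E) -[LHS]/(ev (lerch_coef (q ^+ 2) w) (q * z)) -e /lerch.
by apply: eq_tsum => k; rewrite mulrA -expr2.
Qed.

(** Its series converges for $|q|<|z|<1/|q|$, an annulus containing $\pm1$. *)
Definition diff_red (n : int) : K := lhs_red n + (- B4 q x y) * lerch4_coef q x y n.

Lemma diff_red_at : absum_at diff_red z.
Proof.
have [s1 _] := lerch4_at; have [s2 _] := evZ (- B4 q x y) s1.
by have [] := evD lhs_red_at s2.
Qed.

End WideAnnulus.

Lemma diff_coefE n : diff_coef q x y n = diff_red n + (fun m => dbl (step R) (m - 1)) n.
Proof. by rewrite /diff_coef /diff_red lhs_coefE mulNr addrAC. Qed.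

Let q_x1 : `|q * x| < 1.
Proof. by rewrite normrM mulr_ilt1//; case/andP: hx. Qed.

Let grow_red : expgrow diff_red.
Proof. by apply: (expgrow_at x0); apply: diff_red_at => //; case/andP: hx. Qed.

Let grow_step : expgrow (fun m => dbl (step R) (m - 1)).
Proof. by apply: (expgrow_shift (-1)); apply: expgrow_dbl; exact: expgrow_step. Qed.

Lemma expgrow_diff : expgrow (diff_coef q x y).
Proof.
have -> : diff_coef q x y = (fun n => diff_red n + (fun m => dbl (step R) (m - 1)) n).
  by apply/funext => n; exact: diff_coefE.
exact: (expgrowD grow_red grow_step).
Qed.

(** The part [step] of the difference may diverge at [z], but its convolution with the theta
    coefficients is the entire sequence [theta_red]; the evaluation is therefore valid on the unit
    circle too. *)
Lemma cleared_at (z : K) : `|q| < `|z| -> `|q * z| < 1 ->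
  absum_at (clear_poles q (diff_coef q x y)) z /\
  ev (clear_poles q (diff_coef q x y)) z =
  theta (q * z) (q ^+ 2) * (theta (z ^+ 2) (q ^+ 4) * ev diff_red z
    + z * ev (theta_red (q ^+ 4)) (z ^+ 2)).
Proof.
move=> z1 z2; have z0 : z != 0 by rewrite -normr_gt0; apply: lt_trans z1; case/andP: hq.
have zz0 : z ^+ 2 != 0 by rewrite expf_neq0.
have e0 := entire_theta_red hq4.
have [s1 e1] := ev_dbl (entire_at e0 zz0).
have [s2 e2] := ev_shift z0 s1.
have [s3 e3] := ev_conv z0 ej2 (diff_red_at z1 z2).
have [s3' e3'] := ev_dbl (entire_at (entire_tcoef hq4 one0) zz0).
have [s4 e4] := evD s3 s2.
have [s5 e5] := ev_conv z0 ej1 s4.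
have E : clear_poles q (diff_coef q x y) = conv (tcoef (q ^+ 2) q) (fun n =>
    conv (dbl (tcoef (q ^+ 4) 1)) diff_red n + (fun m => dbl (theta_red (q ^+ 4)) (m - 1)) n).
  rewrite /clear_poles /conv2; congr conv; apply/funext => n.
  have -> : diff_coef q x y = (fun n => diff_red n + (fun m => dbl (step R) (m - 1)) n).
    by apply/funext => m; exact: diff_coefE.
  rewrite (convD n ej2 grow_red grow_step); congr (_ + _).
  rewrite (conv_shift _ (dbl (step R)) (-1)).
  by rewrite (conv_dbl (expgrow_step R) (entire_tcoef hq4 one0) (expgrow_dbl (expgrow_step R))).
rewrite E; split; first exact: s5.
by rewrite e5 e4 e3 e2 e1 e3' (theta_ev hq2 q0 z0) (theta_ev hq4 one0 zz0) mul1r.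
Qed.

Let error_term n := J4 ^+ 3 / theta X (q ^+ 4) * conv (tcoef (q ^+ 2) q) (dbl (tcoef (q ^+ 4) X)) n +
  J4 ^+ 3 / theta Y (q ^+ 4) * conv (tcoef (q ^+ 2) q) (dbl (tcoef (q ^+ 4) Y)) n.

(** Clearing is applied to [diff_coef_rec]: the constants and the multiple of $q^n$ vanish, and only
    the two Kronecker sequences survive. *)
Lemma cleared_rec n : (q ^+ 2) ^ n * clear_poles q (diff_coef q x y) n =
  w^-1 * (clear_poles q (diff_coef q x y) (n + 2) - error_term (n + 1)).
Proof.
have gd := expgrow_diff.
have g1 : expgrow (fun n => diff_coef q x y (n - 1)) := expgrow_shift (-1) gd.
have gX : expgrow (dbl (fun k => kap (q ^+ 4) X (k - 1))).
  by apply: expgrow_dbl; exact: (expgrow_shift (-1) (expgrow_kap hq4 hX)).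
have gY : expgrow (dbl (fun k => kap (q ^+ 4) Y (k - 1))).
  by apply: expgrow_dbl; exact: (expgrow_shift (-1) (expgrow_kap hq4 hY)).
have g0 : expgrow (dbl (fun _ => 1 : K)) by apply: expgrow_dbl; exact: expgrow_cst.
have gq : expgrow (fun n : int => q ^ n) := expgrow_expz q0.
have gXY := expgrowD gX gY.
have g0' := expgrowM (expgrow_cst (-1)) g0.
have gA := expgrowD gXY g0'.
have gA' := expgrowM (expgrow_cst (- (q / w))) gA.
have gq' := expgrowM (expgrow_cst (B4 q x y / w)) gq.
have gJ := expgrowD gA' gq'.
have g1' := expgrowM (expgrow_cst (q / w)) g1.
rewrite (clear_poles_dil hq n gd).
have -> : (fun n => (q ^+ 2) ^ n * diff_coef q x y n) = (fun n => q / w * diff_coef q x y (n - 1) +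
    (- (q / w) * (dbl (fun k => kap (q ^+ 4) X (k - 1)) n + dbl (fun k => kap (q ^+ 4) Y (k - 1)) n
     + -1 * dbl (fun _ => 1) n) + B4 q x y / w * q ^ n)).
  by apply/funext => m; rewrite (diff_coef_rec hq hx hy) /jump mulN1r.
rewrite [in LHS]/clear_poles (conv2D ej1 ej2 _ g1' gJ) (conv2Z ej1 ej2 _ _ g1).
rewrite (conv2D ej1 ej2 _ gA' gq') (conv2Z ej1 ej2 _ _ gA) (conv2Z ej1 ej2 _ _ gq).
rewrite (conv2D ej1 ej2 _ gXY g0') (conv2Z ej1 ej2 _ _ g0) (conv2D ej1 ej2 _ gX gY).
rewrite (conv2_shift _ _ (diff_coef q x y) (-1)).
rewrite -/(clear_poles q) (clear_poles_one hq) (clear_poles_geo hq).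
rewrite (clear_poles_kap hq _ hX) (clear_poles_kap hq _ hY).
have -> : n + 3 - 2 = n + 1 by ring.
have -> : n + 3 - 1 = n + 2 by ring.
rewrite /error_term -/J4.
have alg (A B C D : K) : q^-1 * (q / w * A + (- (q / w) * (B + C + -1 * 0) + D * 0)) =
    w^-1 * (A - (B + C)) by field; rewrite w0 q0.
exact: alg.
Qed.

Theorem cleared_identity : clear_poles q (diff_coef q x y) = rhs_coef q x y.
Proof.
set e := clear_poles q _; set r := rhs_coef q x y.
pose v n := e n - r n.
have hv n : (q ^+ 2) ^ n * v n = w^-1 * v (n + 2).
  rewrite /v mulrBr cleared_rec (rhs_coef_rec hq hx hy n) -/w -/e -/r.
  by rewrite /error_term -mulrBr opprB addrA subrK.
have vE := dilation_solution w0 hv.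
have nw0 : - w != 0 by rewrite oppr_eq0.
have nqw0 : - (q ^+ 2 * w) != 0 by rewrite oppr_eq0 mulf_neq0.
have eval (eps : K) : eps ^+ 2 = 1 ->
    v 0 * theta (- w) (q ^+ 4) + eps * (v 1 * theta (- (q ^+ 2 * w)) (q ^+ 4)) = 0.
  move=> he; have e0 : eps != 0.
    by apply/eqP => h; move: he; rewrite h expr0n => /eqP; rewrite eq_sym oner_eq0.
  have ee0 : eps ^+ 2 != 0 by rewrite he.
  have ne : `|eps| = 1.
    by apply/eqP; rewrite -(@pexpr_eq1 _ _ 2)// -normrX he normr1.
  have z1 : `|q| < `|eps| by rewrite ne.
  have z2 : `|q * eps| < 1 by rewrite normrM ne mulr1.
  have [s1 e1] := cleared_at z1 z2.
  have [s2 e2] := rhs_coef_ev hq hx hy e0.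
  have [s2' e2'] := evZ (-1) s2.
  have [_ e3] := evD s1 s2'.
  have [t1 f1] := ev_dbl (entire_at (entire_tcoef hq4 nw0) ee0).
  have [t2 f2] := ev_dbl (entire_at (entire_tcoef hq4 nqw0) ee0).
  have [t3 f3] := ev_shift e0 t2.
  have [t4 f4] := evZ (v 0) t1; have [t5 f5] := evZ (v 1) t3.
  have [_ f6] := evD t4 t5.
  (* At $z=\pm1$ both sides equal $zJ_4^3j(qz;q^2)$: on the left the convergent part is killed by
     the zero of theta, and [theta_red] contributes the cube. *)
  have Ev : ev v eps = 0.
    have -> : v = (fun n => e n + -1 * r n) by apply/funext => n; rewrite mulN1r.
    rewrite e3 e2' e2 e1 he (theta1 hq4) (ev_theta_red1 hq4) (rhs_value_pm1 hq hx hy he) -/J4.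
    by move: (theta _ _) => A; ring.
  move: Ev; rewrite {1}vE f6 f4 f5 f3 f1 f2 he (theta_ev hq4 nw0 one0) (theta_ev hq4 nqw0 one0).
  by rewrite !mulr1 (mulrCA (v 1)).
have n1 : (-1) ^+ 2 = 1 :> K by rewrite sqrrN expr1n.
have h1 := eval 1 (expr1n _ _); have h2 := eval (-1) n1.
have q2p : 0 < `|q ^+ 2| by case/andP: hq2.
have q4E : `|q ^+ 4| = `|q ^+ 2| * `|q ^+ 2| by rewrite -normrM -exprD.
have [hw1 hw2] := andP hw.
(* The two evaluations separate the even and the odd part; each constant vanishes because its theta
   factor lies in the zero-free annulus of nome $q^4$. *)
have tw : theta (- w) (q ^+ 4) != 0.
  apply: (theta_neq0 hq4); rewrite normrN hw2 andbT; apply: lt_trans hw1.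
  by rewrite q4E gtr_pMr//; case/andP: hq2.
have tqw : theta (- (q ^+ 2 * w)) (q ^+ 4) != 0.
  apply: (theta_neq0 hq4); rewrite normrN (normrM (q ^+ 2) w) q4E ltr_pM2l// hw1 /=.
  by rewrite mulr_ilt1//; case/andP: hq2.
have pm0 (A B : K) : A + 1 * B = 0 -> A + -1 * B = 0 -> A = 0 /\ B = 0.
  rewrite mul1r mulN1r => hA /eqP; rewrite subr_eq0 => /eqP AB; move: hA; rewrite AB.
  by move=> /eqP; rewrite -mulr2n mulrn_eq0 /= => /eqP.
have [/eqP hA /eqP hB] := pm0 _ _ h1 h2.
have v00 : v 0 = 0 by move: hA; rewrite mulf_eq0 (negbTE tw) orbF => /eqP.
have v10 : v 1 = 0 by move: hB; rewrite mulf_eq0 (negbTE tqw) orbF => /eqP.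
apply/funext => n; apply/eqP; rewrite -subr_eq0; apply/eqP.
transitivity (v n) => //; by rewrite vE v00 v10 !mul0r addr0.
Qed.

(** For $|z|<1$ the split-off series $z/(1-z^2)$ converges as well, so the identity of coefficients
    can be evaluated. *)
Theorem core_identity (z : K) : `|q| < `|z| < 1 ->
  absum_at (lhs_coef q x y) z /\
  theta (q * z) (q ^+ 2) * theta (z ^+ 2) (q ^+ 4) *
   (ev (lhs_coef q x y) z - B4 q x y * lerch q (q * z) (q * w)) = rhs_value q x y z.
Proof.
move=> /[dup] hz /andP[z1 zlt1]; have z0 := annulus_neq0 hq hz.
have zz0 : z ^+ 2 != 0 by rewrite expf_neq0.
have z2 : `|q * z| < 1 by rewrite normrM mulr_ilt1.
have [st est] : absum_at (dbl (step R)) z /\ ev (dbl (step R)) z = ev (step R) (z ^+ 2).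
  apply: ev_dbl; have zz1 : `|z ^+ 2| < 1 by rewrite normrX exprn_ilt1.
  apply: absum_eq (absum_geo_half zz1) => n.
  by rewrite /step; case: ifP => _; rewrite ?mul1r ?mul0r.
have [st' _] := ev_shift z0 st.
have [sl _] := evD (lhs_red_at z1 z2) st'.
have sL : absum_at (lhs_coef q x y) z.
  by apply: absum_eq sl => n; rewrite lhs_coefE.
split; first exact: sL.
have [s4 e4] := lerch4_at z1 z2; have [s5 e5] := evZ (- B4 q x y) s4.
have [s6 e6] := evD sL s5.
have sd : absum_at (diff_coef q x y) z.
  by apply: absum_eq s6 => n; rewrite /diff_coef mulNr.
have [s7 e7] := ev_conv z0 ej2 sd.
have [s8 e8] := ev_conv z0 ej1 s7.
have [_ <-] := rhs_coef_ev hq hx hy z0.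
have [_ f1] := ev_dbl (entire_at (entire_tcoef hq4 one0) zz0).
rewrite -cleared_identity [in RHS]/clear_poles /conv2 e8 e7 f1.
rewrite (theta_ev hq2 q0 z0) (theta_ev hq4 one0 zz0) mul1r -mulrA; congr (_ * (_ * _)).
have -> : diff_coef q x y = (fun n => lhs_coef q x y n + - B4 q x y * lerch4_coef q x y n).
  by apply/funext => n; rewrite /diff_coef mulNr.
by rewrite e6 e5 e4 mulNr.
Qed.

End Uniqueness.

(** * The triple sum as a Laurent series in $z$ *)

Lemma sg_double (a : int) (b : bool) : sg (a * 2 + b%:Z) = sg a.
Proof. by rewrite /sg; congr (if _ then _ else _); case: b; lia. Qed.

Lemma halves_injective : injective (fun p : int * int * int =>
  (((p.2 %/ 2)%Z, ((p.1.1 %/ 2)%Z, (p.1.2 %/ 2)%Z)),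
   ((p.2 %% 2)%Z == 0, ((p.1.1 %% 2)%Z == 0, (p.1.2 %% 2)%Z == 0)))).
Proof.
by move=> [[r s] t] [[r' s'] t'] /= [h1 h2 h3 h4 h5 h6]; congr (_, _, _); lia.
Qed.

Lemma parity_injective (u v d : bool) : injective (fun p : int * (int * int) =>
  (p.2.1 * 2 + u%:Z, p.2.2 * 2 + v%:Z, p.1 * 2 + d%:Z)).
Proof.
by move=> [k [a b]] [k' [a' b']] [] /= e1 e2 e3; congr (_, (_, _)); lia.
Qed.

Section TripleSum.
Variable R : realType.
Local Notation K := (cplx R).
Variables q x y z : K.
Hypothesis hq : 0 < `|q| < 1.
Hypothesis hx : `|q| < `|x| < 1.
Hypothesis hy : `|q| < `|y| < 1.
Hypothesis hz : `|q| < `|z| < 1.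
Let x0 : x != 0. Proof. exact: (annulus_neq0 hq hx). Qed.
Let y0 : y != 0. Proof. exact: (annulus_neq0 hq hy). Qed.
Let z0 : z != 0. Proof. exact: (annulus_neq0 hq hz). Qed.

Definition triple_term (p : int * int * int) : K := let: (r, s, t) := p in
  if [&& sg r == sg s, sg s == sg t, (r == s %[mod 2])%Z & (s != t %[mod 2])%Z]
  then q ^ (r * s + r * t + s * t) * x ^ r * y ^ s * z ^ t else 0.

Arguments triple_term : simpl never.

Lemma sg_chi (k a b : int) : chi R k a b = if (sg a == sg b) && (sg b == sg k) then 1 else 0.
Proof.
by rewrite /chi /sg; case: (leP 0 k) => _; case: (leP 0 a) => _; case: (leP 0 b) => _.
Qed.

Lemma modz_double (a : int) (b : bool) : ((a * 2 + b%:Z) %% 2)%Z = b%:Z.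
Proof. by rewrite modzMDl; case: b. Qed.

Lemma triple_term_parity (a b k : int) (u v d : bool) :
  triple_term (a * 2 + u%:Z, b * 2 + v%:Z, k * 2 + d%:Z) =
  if (u == v) && (v != d) then
    if d then z * (odd_term q x y k (a, b) * (z ^+ 2) ^ k)
    else even_term q x y k (a, b) * (z ^+ 2) ^ k
  else 0.
Proof.
rewrite /triple_term !sg_double !modz_double.
have dbl2 (c : K) (m : int) : c ^ (m * 2) = (c ^+ 2) ^ m by rewrite mulrC -exprz_exp.
case: u; case: v; case: d => //=; rewrite ?andbF ?andbT //=.
  rewrite /even_term /= sg_chi; case: ifP => _; last by rewrite !mul0r.
  rewrite !addr0 (expfzDr _ _ x0) (expfzDr _ _ y0) !expr1z !dbl2.
  set e := 2 * k * _ + _; have -> : (a * 2 + 1) * (b * 2 + 1) + (a * 2 + 1) * (k * 2) + (b * 2 + 1) * (k * 2) = e.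
    by rewrite /e; ring.
  by move: (q ^ e) ((x ^+ 2) ^ a) ((y ^+ 2) ^ b) ((z ^+ 2) ^ k) => *; ring.
rewrite /odd_term /= sg_chi; case: ifP => _; last by rewrite !mul0r mulr0.
rewrite !addr0 (expfzDr _ _ z0) !expr1z !dbl2.
set e := (2 * k + 1) * _ + _; have -> : a * 2 * (b * 2) + a * 2 * (k * 2 + 1) + b * 2 * (k * 2 + 1) = e.
  by rewrite /e; ring.
by move: (q ^ e) ((x ^+ 2) ^ a) ((y ^+ 2) ^ b) ((z ^+ 2) ^ k) => *; ring.
Qed.

Lemma int_parityE (n : int) : exists (k : int) (b : bool), n = k * 2 + b%:Z.
Proof.
by elim/int_parity: n => k; [exists k, false; rewrite addr0|exists k, true].
Qed.

Let hZ1 : `|q ^+ 2| < `|z ^+ 2|.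
Proof. by rewrite !normrX ltrXn2r// ?nnegrE//; case/andP: hz. Qed.
Let hZ2 : `|q ^+ 2 * z ^+ 2| < 1.
Proof.
rewrite -exprMn normrX exprn_ilt1// normrM mulr_ilt1//; [by case/andP: hq|by case/andP: hz].
Qed.
Let zz1 : `|z ^+ 2| < 1.
Proof. by rewrite normrX exprn_ilt1//; case/andP: hz. Qed.

Let s_even := absum_even_term hq hx hy hZ1 hZ2.

Lemma absum_odd_term : absum (fun p : int * (int * int) => odd_term q x y p.1 p.2 * (z ^+ 2) ^ p.1).
Proof.
have h := absum_prod (absum_geo_half zz1) (absum_delta ((0, 0) : int * int) (1 : K)).
apply: absum_eq (absumD (absum_odd_term_red hq hx hy hZ1 hZ2) h) => -[k ab] /=.
rewrite odd_term_split mulrDl; congr (_ + _); rewrite /origin_term.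
by case: (0 <= k); case: (ab == (0, 0)); rewrite /= ?mul1r ?mulr1 ?mul0r ?mulr0.
Qed.

(** Halves and parities determine the indices, and a nonzero term is the member of one of the two
    parity families at the halved indices; the sum of both families is a majorant. *)
Lemma absum_triple_term : absum triple_term.
Proof.
have h := absumD (absum_norm s_even) (absumZ `|z| (absum_norm absum_odd_term)).
have h' := absum_inj halves_injective (absum_prod h (absum_fin (fun _ : bool * (bool * bool) => 1 : K))).
apply: absum_le h' => -[[r s] t] /=; rewrite mulr1.
have [a [u ->]] := int_parityE r; have [b [v ->]] := int_parityE s; have [k [d ->]] := int_parityE t.
have dv (m : int) (c : bool) : ((m * 2 + c%:Z) %/ 2)%Z = m by rewrite divzMDl// divz_small ?addr0//; case: c.
rewrite !dv triple_term_parity; case: ifP => _; last by rewrite normr0.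
rewrite (ger0_norm (_ : 0 <= _ + _)); last by rewrite addr_ge0// mulr_ge0.
by case: d; rewrite ?normrM ?lerDl ?lerDr// ?mulr_ge0// mulr_ge0.
Qed.

Lemma triple_sum : tsum triple_term = ev (lhs_coef q x y) z.
Proof.
have st := absum_triple_term.
(* Once the parity of [t] is fixed, the nonzero terms lie in a single parity class of the three
   indices. *)
pose P (p : int * int * int) := (p.2 %% 2)%Z == 0.
have s1 := absum_if P st; have s2 := absum_if (predC P) st.
have hP (a b k : int) (u v d : bool) : P (a * 2 + u%:Z, b * 2 + v%:Z, k * 2 + d%:Z) = ~~ d.
  by rewrite /P /= modz_double; case: d.
have -> : tsum triple_term = tsum (fun p => if P p then triple_term p else 0) +
    tsum (fun p => if predC P p then triple_term p else 0).
  rewrite -(tsumD s1 s2); apply: eq_tsum => p /=; case: (P p); rewrite ?addr0 ?add0r//.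
have par3 (Q : int * int * int -> Prop) : (forall (a b k : int) (u v d : bool), Q (a * 2 + u%:Z, b * 2 + v%:Z, k * 2 + d%:Z)) ->
    forall p, Q p.
  move=> hQ [[r s] t].
  by have [a [u ->]] := int_parityE r; have [b [v ->]] := int_parityE s; have [k [d ->]] := int_parityE t.
pose h1 (p : int * (int * int)) := (p.2.1 * 2 + true%:Z, p.2.2 * 2 + true%:Z, p.1 * 2 + false%:Z).
pose h2 (p : int * (int * int)) := (p.2.1 * 2 + false%:Z, p.2.2 * 2 + false%:Z, p.1 * 2 + true%:Z).
have i1 : injective h1 := parity_injective (u := true) (v := true) (d := false).
have i2 : injective h2 := parity_injective (u := false) (v := false) (d := true).
rewrite (tsum_reindex i1 s1); last first.
  apply: par3 => a b k u v d hne; rewrite /= hP triple_term_parity.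
  move: (hne (k, (a, b))); rewrite /h1 {hne} /=.
  by case: u; case: v; case: d => // /eqP[].
rewrite (tsum_reindex i2 s2); last first.
  apply: par3 => a b k u v d hne; rewrite /= hP triple_term_parity.
  move: (hne (k, (a, b))); rewrite /h2 {hne} /=.
  by case: u; case: v; case: d => // /eqP[].
have E1 p : (if P (h1 p) then triple_term (h1 p) else 0) = even_term q x y p.1 p.2 * (z ^+ 2) ^ p.1.
  by case: p => k [a b]; rewrite hP triple_term_parity.
have E2 p : (if predC P (h2 p) then triple_term (h2 p) else 0) =
    z * (odd_term q x y p.1 p.2 * (z ^+ 2) ^ p.1).
  by case: p => k [a b]; rewrite /= hP triple_term_parity.
rewrite (eq_tsum E1) (eq_tsum E2) (tsumZ _ absum_odd_term) (tsum_pair s_even) (tsum_pair absum_odd_term).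
have F1 k : tsum (fun ab => even_term q x y k ab * (z ^+ 2) ^ k) = even_coef q x y k * (z ^+ 2) ^ k.
  by rewrite mulrC -(tsumZ _ (absum_even hq hx hy k)); apply: eq_tsum => ab; exact: mulrC.
have F2 k : tsum (fun ab => odd_term q x y k ab * (z ^+ 2) ^ k) = odd_coef q x y k * (z ^+ 2) ^ k.
  by rewrite mulrC -(tsumZ _ (absum_odd hq hx hy k)); apply: eq_tsum => ab; exact: mulrC.
have a1 : absum_at (even_coef q x y) (z ^+ 2).
  by apply: absum_eq (absum_tsum s_even) => k; rewrite -F1.
have a2 : absum_at (odd_coef q x y) (z ^+ 2).
  by apply: absum_eq (absum_tsum absum_odd_term) => k; rewrite -F2.
have [b1 c1] := ev_dbl a1; have [b2 c2] := ev_dbl a2; have [b3 c3] := ev_shift z0 b2.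
have [_ c4] := evD b1 b3.
rewrite /lhs_coef c4 c3 c1 c2 /ev (eq_tsum F1) (eq_tsum F2).
by [].
Qed.

End TripleSum.

(** * Continuity and the removable singularities *)

Local Transparent kap.

Section Continuity.
Variable R : realType.
Local Notation K := (cplx R).

Lemma near_norm_lt (T : Type) (F : set_system T) (a : T -> K) (x r : K) : Filter F ->
  a t @[t --> F] --> x -> `|x| < r -> \forall t \near F, `|a t| < r.
Proof.
move=> FF ax xr; have /cvgrPdist_lt h := ax.
have e0 : 0 < r - `|x| by rewrite subr_gt0.
near=> t; have : `|x - a t| < r - `|x| by near: t; exact: h.
move=> ht; have -> : a t = x - (x - a t) by ring.
apply: le_lt_trans (ler_normB _ _) _.
by rewrite -[ltRHS](subrK `|x|) addrC ltrD2r.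
Unshelve. all: by end_near.
Qed.

Lemma near_norm_gt (T : Type) (F : set_system T) (a : T -> K) (x r : K) : Filter F ->
  a t @[t --> F] --> x -> r < `|x| -> \forall t \near F, r < `|a t|.
Proof.
move=> FF ax xr; have /cvgrPdist_lt h := ax.
have e0 : 0 < `|x| - r by rewrite subr_gt0.
near=> t; have : `|x - a t| < `|x| - r by near: t; exact: h.
move=> ht; have h2 : `|x| <= `|x - a t| + `|a t|.
  by rewrite -{1}(subrK (a t) x); exact: ler_normD.
have : `|x| < `|x| - r + `|a t| by apply: le_lt_trans h2 _; rewrite ltrD2r.
by rewrite -addrA ltrDl addrC subr_gt0.
Unshelve. all: by end_near.
Qed.

Lemma cvg_expz (T : Type) (F : set_system T) (a : T -> K) (x : K) (n : int) : Filter F ->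
  a t @[t --> F] --> x -> x != 0 -> a t ^ n @[t --> F] --> x ^ n.
Proof.
move=> FF ax x0.
have hn (m : nat) : a t ^+ m @[t --> F] --> x ^+ m.
  elim: m => [|m IH]; first exact: cvg_cst.
  have -> : (fun t => a t ^+ m.+1) = (fun t => a t * a t ^+ m).
    by apply/funext => t; exact: exprS.
  have -> : x ^+ m.+1 = x * x ^+ m by exact: exprS.
  exact: (cvgM ax IH).
case: n => n; first exact: hn.
have -> : (fun t => a t ^ Negz n) = (fun t => (a t ^+ n.+1)^-1) by [].
have -> : x ^ Negz n = (x ^+ n.+1)^-1 by [].
exact: (cvgV (expf_neq0 _ x0) (hn n.+1)).
Qed.

Lemma cvg_tcoef (T : Type) (F : set_system T) (p : K) (u : T -> K) (l : K) (n : int) : Filter F ->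
  u t @[t --> F] --> l -> l != 0 -> tcoef p (u t) n @[t --> F] --> tcoef p l n.
Proof.
move=> FF ul l0; rewrite /tcoef; have h := @cvg_expz _ _ _ _ n FF ul l0.
exact: (cvgM (cvg_cst _) h).
Qed.

Lemma absum_quad (p B : K) : `|p| < 1 ->
  absum (fun n : int => `|p| ^+ 'C(`|n|, 2) * B ^+ `|n|).
Proof.
move=> p1; have [C hC] := quad_bound (2 * B) p1.
have h2 : `|2^-1 : K| < 1 by rewrite ger0_norm ?invr_ge0// invf_lt1// ltr1n.
apply: absum_le (absumZ C (absum_geo h2)) => n.
have C0 : 0 <= C by apply: le_trans (hC 0%N); rewrite mulr_ge0 ?exprn_ge0.
rewrite (normrM C) (ger0_norm C0) exprVn normfV normrX normr_nat ler_pdivlMr ?exprn_gt0//.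
apply: le_trans (hC `|n|%N); rewrite (normrM 2) normr_nat exprMn.
rewrite (normrM (_ ^+ _)) !normrX normr_id -mulrA.
by rewrite (mulrC (`|B| ^+ `|n|)).
Qed.

(** Eventually $|l|/2<|u|<2|l|$, so the displayed base dominates $|u|+|u|^{-1}$ and gives a majorant
    that does not depend on [t]. *)
Lemma tcoef_near_bound (T : Type) (F : set_system T) (p : K) (u : T -> K) (l : K) : Filter F ->
  0 < `|p| < 1 -> u t @[t --> F] --> l -> l != 0 ->
  \forall t \near F, u t != 0 /\ forall n,
    `|tcoef p (u t) n| <= `|p| ^+ 'C(`|n|, 2) * (2 * `|l| + 2 / `|l|) ^+ `|n|.
Proof.
move=> FF hp ul l0; have nl : 0 < `|l| by rewrite normr_gt0.
have h1 : `|l| < 2 * `|l| by rewrite ltr_pMl// ltr1n.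
have h2 : `|l| / 2 < `|l| by rewrite gtr_pMr// invf_lt1// ltr1n.
near=> t.
have t1 : `|u t| < 2 * `|l| by near: t; exact: near_norm_lt _ ul h1.
have t2 : `|l| / 2 < `|u t| by near: t; exact: near_norm_gt _ ul h2.
have u0 : 0 < `|u t| by apply: lt_trans t2; rewrite divr_gt0.
split=> [|n]; first by rewrite -normr_gt0.
apply: le_trans (tcoef_norm_le _ hp _) _; first by rewrite -normr_gt0.
rewrite ler_wpM2l ?exprn_ge0// lerXn2r ?nnegrE ?addr_ge0 ?mulr_ge0 ?invr_ge0//.
apply: lerD; first exact: ltW.
by rewrite -[2 / _]invrK invf_div lef_pV2 ?posrE ?divr_gt0// ltW.
Unshelve. all: by end_near.
Qed.

Lemma cvg_theta (T : Type) (F : set_system T) (p : K) (u : T -> K) (l : K) : ProperFilter F ->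
  0 < `|p| < 1 -> u t @[t --> F] --> l -> l != 0 -> theta (u t) p @[t --> F] --> theta l p.
Proof.
move=> FF hp ul l0; have hb := tcoef_near_bound _ hp ul l0.
have [_ p1] := andP hp.
have h : tsum (tcoef p (u t)) @[t --> F] --> tsum (tcoef p l).
  apply: (tannery (g := fun n : int => `|p| ^+ 'C(`|n|, 2) * (2 * `|l| + 2 / `|l|) ^+ `|n|)).
  - exact: absum_quad.
  - near=> t => n; have [_ hn] : u t != 0 /\ forall n,
      `|tcoef p (u t) n| <= `|p| ^+ 'C(`|n|, 2) * (2 * `|l| + 2 / `|l|) ^+ `|n|
      by near: t; exact: hb.
    apply: le_trans (hn n) _; apply: real_ler_norm.
    by rewrite realE mulr_ge0// exprn_ge0// addr_ge0// ?mulr_ge0// invr_ge0.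
  - move=> n; exact: cvg_tcoef.
rewrite (thetaE hp l0); move/cvgrPdist_lt : h => h; apply/cvgrPdist_lt => e e0.
near=> t; have [u0 _] : u t != 0 /\ forall n,
      `|tcoef p (u t) n| <= `|p| ^+ 'C(`|n|, 2) * (2 * `|l| + 2 / `|l|) ^+ `|n|
      by near: t; exact: hb.
by rewrite (thetaE hp u0); near: t; exact: h.
Unshelve. all: by end_near.
Qed.

(** The bound depends on [a] only through [r] and [s], which keep $|a|$ away from both ends of the
    annulus; it is thus locally uniform. *)
Lemma kap_uniform_bound (p a r s : K) (n : int) : 0 < `|p| < 1 -> a != 0 ->
  `|a| <= r -> r < 1 -> `|p| / `|a| <= s -> s < 1 ->
  `|kap p a n| <= (1 - r)^-1 + (1 - s)^-1.
Proof.
move=> hp a0 ar r1 ps s1; have [pp p1] := andP hp.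
have p0 : p != 0 by rewrite -normr_gt0.
have R0 : 0 <= (1 - r)^-1 by rewrite invr_ge0 subr_ge0 ltW.
have S0 : 0 <= (1 - s)^-1 by rewrite invr_ge0 subr_ge0 ltW.
have [n0|n0] := leP 0 n.
  have [m ->] := int_ge0_nat n0.
  apply: le_trans (_ : _ <= (1 - r)^-1) _; last by rewrite lerDl.
  apply: inv_1B_bound r1; rewrite -exprnP (normrM (p ^+ m)) normrX.
  by apply: le_trans ar; rewrite ler_piMl// exprn_ile1// ltW.
have [m ->] := int_lt0_nat n0.
set u := p ^+ m.+1 / a.
have us : `|u| <= s.
  apply: le_trans ps; rewrite /u normf_div ler_pM2r ?invr_gt0 ?normr_gt0// normrX exprS.
  by rewrite ler_piMr// exprn_ile1// ltW.
have u0 : u != 0 by rewrite mulf_neq0 ?invr_eq0// expf_neq0.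
have u1 : 1 - u != 0.
  rewrite subr_eq0 eq_sym; apply/eqP => h; move: us; rewrite h normr1 => /(lt_le_trans s1).
  by rewrite ltxx.
have -> : kap p a (- m.+1%:Z) = - (u * (1 - u)^-1).
  rewrite /kap -exprnN; have -> : p ^- m.+1 * a = u^-1 by rewrite /u invf_div mulrC.
  have alg (v : K) : v != 0 -> (1 - v^-1)^-1 = - (v * (1 - v)^-1).
    move=> v0; have -> : 1 - v^-1 = - ((1 - v) / v) by field.
    by rewrite invrN invf_div.
  exact: alg.
rewrite normrN (normrM u) -[leLHS]addr0 addrC.
apply: lerD => //; rewrite -[leRHS]mul1r; apply: ler_pM => //.
  by apply: le_trans us _; exact: ltW.
exact: inv_1B_bound.
Qed.

Lemma cvg_kap (T : Type) (F : set_system T) (p : K) (a : T -> K) (x : K) (n : int) : Filter F ->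
  0 < `|p| < 1 -> `|p| < `|x| < 1 -> a t @[t --> F] --> x ->
  kap p (a t) n @[t --> F] --> kap p x n.
Proof.
move=> FF hp hx ax; exact: (cvgV (kap_den_neq0 hp n hx) (cvgB (cvg_cst _) (cvgM (cvg_cst _) ax))).
Qed.

Lemma cvg_lerch (T : Type) (F : set_system T) (q : K) (a w : T -> K) (x l : K) : ProperFilter F ->
  0 < `|q| < 1 -> `|q ^+ 2| < `|x| < 1 -> l != 0 ->
  a t @[t --> F] --> x -> w t @[t --> F] --> l ->
  lerch q (a t) (w t) @[t --> F] --> lerch q x l.
Proof.
move=> FF hq hx l0 ax wl.
have q0 : q != 0 by rewrite -normr_gt0; case/andP: hq.
have hp : 0 < `|q ^+ 2| < 1.
  by case/andP: hq => h1 h2; rewrite normrX exprn_gt0//= exprn_ilt1.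
have [_ p1] := andP hp; have [px x1] := andP hx.
have ul : - (q * w t) @[t --> F] --> - (q * l).
  exact: (cvgN (cvgM (cvg_cst _) wl)).
have L0 : - (q * l) != 0 by rewrite oppr_eq0 mulf_neq0.
have hb := tcoef_near_bound _ hp ul L0.
have nx : 0 < `|x| by apply: lt_trans px; case/andP: hp.
have x0 : x != 0 by rewrite -normr_gt0.
have [xr r1] := midf_lt x1.
have sx1 : `|q ^+ 2| / `|x| < 1 by rewrite ltr_pdivrMr// mul1r.
have [xs s1] := midf_lt sx1.
(* Midpoints that leave room at both ends of the annulus: eventually $|a|<r$ and $|q^2|/|a|\le
   s$. *)
set r := (`|x| + 1) / 2 in xr r1; set s := (_ + 1) / 2 in xs s1.
set M := (1 - r)^-1 + (1 - s)^-1.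
have M0 : 0 <= M by rewrite addr_ge0// invr_ge0 subr_ge0 ltW.
have s0 : 0 < s by apply: le_lt_trans xs; rewrite divr_ge0.
have xs' : `|q ^+ 2| / s < `|x|.
  by rewrite ltr_pdivrMr// mulrC -ltr_pdivrMr.
apply: (tannery (g := fun n : int =>
    M * (`|q ^+ 2| ^+ 'C(`|n|, 2) * (2 * `|- (q * l)| + 2 / `|- (q * l)|) ^+ `|n|))).
- by apply: absumZ; exact: absum_quad.
- near=> t => n.
  have [_ hn] : - (q * w t) != 0 /\ forall n, `|tcoef (q ^+ 2) (- (q * w t)) n| <=
      `|q ^+ 2| ^+ 'C(`|n|, 2) * (2 * `|- (q * l)| + 2 / `|- (q * l)|) ^+ `|n|
      by near: t; exact: hb.
  have ar : `|a t| < r by near: t; exact: near_norm_lt _ ax xr.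
  have as' : `|q ^+ 2| / s < `|a t| by near: t; exact: near_norm_gt _ ax xs'.
  have a0 : 0 < `|a t| by apply: le_lt_trans as'; rewrite divr_ge0// ltW.
  have hk : `|kap (q ^+ 2) (a t) n| <= M.
    apply: kap_uniform_bound => //; first by rewrite -normr_gt0.
      exact: ltW.
    by rewrite ler_pdivrMr// mulrC -ler_pdivrMr// ltW.
  set g := _ ^+ _ * _ in hn *.
  rewrite (normrM (tcoef _ _ _)) mulrC (normrM M) (ger0_norm M0).
  apply: ler_pM => //; apply: le_trans (hn n) _; apply: real_ler_norm.
  by rewrite realE mulr_ge0// exprn_ge0// addr_ge0// ?mulr_ge0// invr_ge0.
- move=> n; exact: (cvgM (cvg_tcoef _ ul L0) (cvg_kap _ hp hx ax)).
Unshelve. all: by end_near.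
Qed.

End Continuity.

(** * Appell-Lerch functions as Lerch sums, and the cancelled side terms *)

Section SideTerms.
Variable R : realType.
Local Notation K := (cplx R).
Variable q : K.
Hypothesis hq : 0 < `|q| < 1.
Let q0 : q != 0. Proof. by rewrite -normr_gt0; case/andP: hq. Qed.
Let q1 : `|q| < 1. Proof. by case/andP: hq. Qed.
Let hq2 : 0 < `|q ^+ 2| < 1. Proof. by apply: norm_expr_lt1. Qed.
Let hq4 : 0 < `|q ^+ 4| < 1. Proof. by apply: norm_expr_lt1. Qed.
Let q20 : q ^+ 2 != 0. Proof. by rewrite expf_neq0. Qed.
Let J2 := qpoch (q ^+ 2) (q ^+ 2).
Let J4 := qpoch (q ^+ 4) (q ^+ 4).
Let J20 : J2 != 0. Proof. exact: J_neq0. Qed.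
Let J40 : J4 != 0. Proof. exact: J_neq0. Qed.

Lemma appell_lerch (a w : K) : w != 0 ->
  appell (- (q * a / w)) (q ^+ 2) (- (q * w)) = (theta (- (q * w)) (q ^+ 2))^-1 * lerch q a w.
Proof.
move=> w0; rewrite /appell /lerch; congr (_ * _); apply: eq_tsum => r.
rewrite /kap /tcoef; congr (_ / (1 - _)).
rewrite (expfzDr _ _ q20) exprN1.
by move: ((q ^+ 2) ^ r) => P; field; rewrite w0 q0.
Qed.

Lemma absum_tcoef_kap (u a : K) : u != 0 -> `|q ^+ 2| < `|a| < 1 ->
  absum (fun k => tcoef (q ^+ 2) u k * kap (q ^+ 2) a k).
Proof.
move=> u0 ha; have [M M0 hM] := kap_bound hq2 ha.
apply: absum_le (absumZ M (absum_tcoef hq2 u0)) => k; have [h _ _] := hM k.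
by rewrite mulrC (normrM M) (normrM (kap _ _ _)) (ger0_norm M0) ler_wpM2r.
Qed.

(** Moving the summation index by one replaces the theta argument $-w$ by $-q^2w$ and releases a
    factor $w$, which matches the variables of the Lerch sum in [lerch4_at]. *)
Lemma appell_lerch_shift (a w : K) : w != 0 -> `|q ^+ 2| < `|q * a| < 1 ->
  appell (- (q * a / w)) (q ^+ 2) (- w) = (theta (- w) (q ^+ 2))^-1 * (w * lerch q (q * a) (q * w)).
Proof.
move=> w0 ha; rewrite /appell /lerch; congr (_ * _).
have nw0 : - w != 0 by rewrite oppr_eq0.
have u0 : - (q * (q * w)) != 0 by rewrite oppr_eq0 !mulf_neq0.
rewrite -(tsumZ _ (absum_tcoef_kap u0 ha)).
pose f r := tcoef (q ^+ 2) (- w) r * kap (q ^+ 2) (q * a) (r - 1).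
have fE k : f (k + 1) = w * (tcoef (q ^+ 2) (- (q * (q * w))) k * kap (q ^+ 2) (q * a) k).
  rewrite /f addrK (tcoefS _ q20 nw0).
  have -> : tcoef (q ^+ 2) (- (q * (q * w))) k = (q ^+ 2) ^ k * tcoef (q ^+ 2) (- w) k.
    have -> : - (q * (q * w)) = q ^+ 2 * - w by ring.
    by rewrite /tcoef (expfzMl (q ^+ 2)) mulrCA.
  by move: (kap _ _ _) (tcoef _ _ _) ((q ^+ 2) ^ k) => *; ring.
have s : absum f.
  have := absum_shift (-1) (absumZ w (absum_tcoef_kap u0 ha)).
  by apply: absum_eq => k; rewrite -fE subrK.
rewrite -(eq_tsum fE) (tsum_shift 1 s); apply: eq_tsum => r.
rewrite /f /kap /tcoef; congr (_ / (1 - _)).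
by move: ((q ^+ 2) ^ (r - 1)) => P; field; rewrite w0.
Qed.

Definition side_formula (a b c : K) : K :=
  c * (Jprod q 4 ^+ 3 * theta (q ^+ 2 * b ^+ 2 * c ^+ 2) (q ^+ 4)
       / (theta (q ^+ 2 * b ^+ 2) (q ^+ 4) * theta (c ^+ 2) (q ^+ 4)))
    * appell (- (q * a / (b * c))) (q ^+ 2) (- (q * b * c)).

(* [side_formula] with the common zero of [theta (q ^+ 2 * b ^+ 2 * c ^+ 2) (q ^+ 4)]
   and [theta (- (q * b * c)) (q ^+ 2)] at [b * c = - q] cancelled. *)
Definition side_value (a b c : K) : K :=
  c * (J4 ^+ 4 / J2 ^+ 2 * theta (q * b * c) (q ^+ 2) * lerch q a (b * c)
       / (theta (q ^+ 2 * b ^+ 2) (q ^+ 4) * theta (c ^+ 2) (q ^+ 4))).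

(** In the product expansion only the factor $1+q/w$ can vanish when $|q^2|<|w|<1$; all others
    differ from 1 by less than 1 in modulus. *)
Lemma theta_side_neq0 (w : K) : `|q ^+ 2| < `|w| < 1 -> w != - q ->
  theta (- (q * w)) (q ^+ 2) != 0.
Proof.
move=> hw wq; have w0 := annulus_neq0 hq2 hw; have [w1 w2] := andP hw.
have [q00 _] := andP hq; have [p0 p1] := andP hq2.
have nz u : `|u| < 1 -> qpoch u (q ^+ 2) != 0.
  move=> u1; apply: qpoch_neq0 => // i; apply/eqP => /(congr1 Num.norm) /eqP.
  rewrite (normrM (_ ^+ i)) normr1 normrX lt_eqF//.
  by apply: le_lt_trans u1; rewrite ler_piMl// exprn_ile1// ltW.
rewrite thetaF; apply: mulf_neq0; last exact: J_neq0.
apply: mulf_neq0; first by apply: nz; rewrite normrN (normrM q) mulr_ilt1.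
have -> : q ^+ 2 / - (q * w) = - (q / w) by field; rewrite w0 q0.
apply: qpoch_neq0 => // -[|i]; apply/eqP.
  rewrite expr0 mul1r => h; move/eqP: wq; apply; rewrite -[w]mul1r -h.
  by field.
move/(congr1 Num.norm)/eqP; rewrite (normrM (_ ^+ _)) normrN normr1 lt_eqF//.
have hi : `|(q ^+ 2) ^+ i.+1| <= `|q ^+ 2|.
  by rewrite normrX exprS ler_piMr// exprn_ile1// ltW.
apply: le_lt_trans (ler_wpM2r (normr_ge0 _) hi) _.
rewrite normf_div mulrA ltr_pdivrMr ?normr_gt0// mul1r; apply: le_lt_trans w1.
by rewrite ler_piMr// ltW.
Qed.

Lemma side_formulaE (a b c : K) : b != 0 -> c != 0 -> `|q ^+ 2| < `|b * c| < 1 ->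
  b * c != - q -> side_formula a b c = side_value a b c.
Proof.
move=> b0 c0 hbc bcq; have w0 : b * c != 0 by exact: mulf_neq0.
have u0 : q * b * c != 0 by rewrite !mulf_neq0.
have t0 := theta_side_neq0 hbc bcq.
rewrite /side_formula /side_value (JprodE hq)// -/J4.
have -> : - (q * b * c) = - (q * (b * c)) by rewrite mulrA.
rewrite (appell_lerch a w0).
have h := theta_sqr2 hq u0; rewrite -/J2 -/J4 in h.
have e1 : (q * b * c) ^+ 2 = q ^+ 2 * b ^+ 2 * c ^+ 2 by ring.
have e2 : - (q * b * c) = - (q * (b * c)) by rewrite mulrA.
rewrite e1 e2 in h.
have -> : theta (q ^+ 2 * b ^+ 2 * c ^+ 2) (q ^+ 4) =
    theta (q * b * c) (q ^+ 2) * theta (- (q * (b * c))) (q ^+ 2) / (J2 ^+ 2 / J4).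
  by rewrite h mulfK// mulf_neq0 ?invr_eq0// expf_neq0.
have alg (j2 j4 t s d l : K) : j2 != 0 -> j4 != 0 -> s != 0 ->
    c * (j4 ^+ 3 * (t * s / (j2 ^+ 2 / j4)) / d) * (s^-1 * l) =
    c * (j4 ^+ 4 / j2 ^+ 2 * t * l / d).
  move=> h2 h4 hs; rewrite !(mulrA _ _ d^-1) -/(_ / d).
  by move: d^-1 => D; field; rewrite h2 h4 hs.
exact: alg.
Qed.

End SideTerms.

(** * Matching the terms of the statement with the proved identity *)

Section Assembly.
Variable R : realType.
Local Notation K := (cplx R).
Variable q : K.
Hypothesis hq : 0 < `|q| < 1.
Let q0 : q != 0. Proof. by rewrite -normr_gt0; case/andP: hq. Qed.
Let q1 : `|q| < 1. Proof. by case/andP: hq. Qed.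
Let hq2 : 0 < `|q ^+ 2| < 1. Proof. by apply: norm_expr_lt1. Qed.
Let hq4 : 0 < `|q ^+ 4| < 1. Proof. by apply: norm_expr_lt1. Qed.
Let q20 : q ^+ 2 != 0. Proof. by rewrite expf_neq0. Qed.

Lemma annulus_mul (b c : K) : `|q| < `|b| < 1 -> `|q| < `|c| < 1 -> `|q ^+ 2| < `|b * c| < 1.
Proof.
move=> /andP[b1 b2] /andP[c1 c2]; rewrite normrX (normrM b) expr2.
by apply/andP; split; [exact: ltr_pM|exact: mulr_ilt1].
Qed.

Lemma theta_sq_neq0 (z : K) : `|q| < `|z| < 1 -> theta (z ^+ 2) (q ^+ 4) != 0.
Proof.
move=> /(annulus_sqr) h; apply: theta_neq0 => //.
have [h1 h2] := andP h; rewrite h2 andbT; apply: le_lt_trans h1.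
have -> : q ^+ 4 = q ^+ 2 * q ^+ 2 by ring.
by rewrite (normrM (q ^+ 2)) ler_piMl// ltW//; case/andP: hq2.
Qed.

Lemma cvg_side_value (T : Type) (F : set_system T) (a b c : T -> K) (x y z : K) :
  ProperFilter F -> `|q| < `|x| < 1 -> `|q| < `|y| < 1 -> `|q| < `|z| < 1 ->
  a t @[t --> F] --> x -> b t @[t --> F] --> y -> c t @[t --> F] --> z ->
  side_value q (a t) (b t) (c t) @[t --> F] --> side_value q x y z.
Proof.
move=> FF hx hy hz ax by_ cz.
have y0 := annulus_neq0 hq hy; have z0 := annulus_neq0 hq hz.
have b2 : b t ^+ 2 @[t --> F] --> y ^+ 2 by exact: (cvgM by_ by_).
have c2 : c t ^+ 2 @[t --> F] --> z ^+ 2 by exact: (cvgM cz cz).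
have bc : b t * c t @[t --> F] --> y * z by exact: (cvgM by_ cz).
have qbc : q * b t * c t @[t --> F] --> q * y * z by exact: (cvgM (cvgM (cvg_cst q) by_) cz).
have qb : q ^+ 2 * b t ^+ 2 @[t --> F] --> q ^+ 2 * y ^+ 2 by exact: (cvgM (cvg_cst _) b2).
have t1 := cvg_theta FF hq2 qbc (mulf_neq0 (mulf_neq0 q0 y0) z0).
have t2 := cvg_lerch FF hq (annulus_q2 hq hx) (mulf_neq0 y0 z0) ax bc.
have t3 := cvg_theta FF hq4 qb (mulf_neq0 q20 (expf_neq0 2 y0)).
have t4 := cvg_theta FF hq4 c2 (expf_neq0 2 z0).
have d0 := mulf_neq0 (theta_neq0 hq4 (annulus_q4 hq hy)) (theta_sq_neq0 hz).
exact: (cvgM cz (cvgM (cvgM (cvgM (cvg_cst _) t1) t2) (cvgV d0 (cvgM t3 t4)))).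
Qed.

(** Each $j(u;q)$ merges with a theta function of nome $q^2$ into a product of nomes $q^2$ and
    $q^4$, with a factor $J_1/J_4$; the three factors trade $J_1^3$ for $J_4^3$. For $z$ the two
    halves of $j(z;q)$ exchange roles, which produces the clearing factor. *)
Lemma triple_product_term (x y z T U V : K) :
  `|q| < `|x| < 1 -> `|q| < `|y| < 1 -> `|q| < `|z| < 1 ->
  z * (Jprod q 1 ^+ 3 * Jprod q 2 ^+ 3 / (theta x q * theta y q * theta z q))
    * (T * U * V / (theta (- (x * q)) (q ^+ 2) * theta (- (y * q)) (q ^+ 2) * theta (- z) (q ^+ 2)))
  = z * (qpoch (q ^+ 2) (q ^+ 2) ^+ 3 * qpoch (q ^+ 4) (q ^+ 4) ^+ 3 * T /
    (theta x (q ^+ 2) * theta y (q ^+ 2) * (theta (q ^+ 2 * x ^+ 2) (q ^+ 4) * theta (q ^+ 2 * y ^+ 2) (q ^+ 4)))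
    * (U * V) / (theta (q * z) (q ^+ 2) * theta (z ^+ 2) (q ^+ 4))).
Proof.
move=> hx hy hz.
have x0 := annulus_neq0 hq hx; have y0 := annulus_neq0 hq hy; have z0 := annulus_neq0 hq hz.
rewrite (JprodE hq (isT : 0 < 1)%N) (JprodE hq (isT : 0 < 2)%N) expr1.
have J10 := J_neq0 hq; have J20 := J_neq0 hq2; have J40 := J_neq0 hq4.
have merge (u : K) : u != 0 -> theta u q * theta (- (u * q)) (q ^+ 2) =
    theta u (q ^+ 2) * theta (q ^+ 2 * u ^+ 2) (q ^+ 4) * (qpoch q q / qpoch (q ^+ 4) (q ^+ 4)).
  move=> u0; have h := theta_sqr2 hq (mulf_neq0 q0 u0).
  rewrite exprMn (mulrC q u) in h; rewrite (theta_split hq u0) (mulrC q u).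
  have alg (A B C D j1 j2 j4 : K) : B * C = D * (j2 ^+ 2 / j4) -> j2 != 0 -> j4 != 0 ->
      A * B * (j1 / j2 ^+ 2) * C = A * D * (j1 / j4).
    move=> e n2 n4; have -> : A * B * (j1 / j2 ^+ 2) * C = A * (B * C) * (j1 / j2 ^+ 2) by ring.
    by rewrite e; field; rewrite n2 n4.
  exact: alg h J20 J40.
have mergez : theta z q * theta (- z) (q ^+ 2) =
    theta (q * z) (q ^+ 2) * theta (z ^+ 2) (q ^+ 4) * (qpoch q q / qpoch (q ^+ 4) (q ^+ 4)).
  have h := theta_sqr2 hq z0; rewrite (theta_split hq z0).
  have alg (A B C D j1 j2 j4 : K) : A * C = D * (j2 ^+ 2 / j4) -> j2 != 0 -> j4 != 0 ->
      A * B * (j1 / j2 ^+ 2) * C = B * D * (j1 / j4).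
    move=> e n2 n4; have -> : A * B * (j1 / j2 ^+ 2) * C = B * (A * C) * (j1 / j2 ^+ 2) by ring.
    by rewrite e; field; rewrite n2 n4.
  exact: alg h J20 J40.
have alg (tx ty tz mx my mz ax ay bz cx cy cz j1 j2 j4 : K) :
    tx * mx = ax * cx * (j1 / j4) -> ty * my = ay * cy * (j1 / j4) ->
    tz * mz = bz * cz * (j1 / j4) -> j1 != 0 -> j4 != 0 ->
    z * (j1 ^+ 3 * j2 ^+ 3 / (tx * ty * tz)) * (T * U * V / (mx * my * mz)) =
    z * (j2 ^+ 3 * j4 ^+ 3 * T / (ax * ay * (cx * cy)) * (U * V) / (bz * cz)).
  move=> ex ey ez n1 n4.
  have -> : z * (j1 ^+ 3 * j2 ^+ 3 / (tx * ty * tz)) * (T * U * V / (mx * my * mz)) =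
      z * j1 ^+ 3 * j2 ^+ 3 * T * U * V / ((tx * mx) * (ty * my) * (tz * mz)).
    rewrite !invfM; move: tx^-1 ty^-1 tz^-1 mx^-1 my^-1 mz^-1 => *; ring.
  rewrite ex ey ez !invfM invrK.
  by move: ax^-1 ay^-1 bz^-1 cx^-1 cy^-1 cz^-1 => *; field; rewrite n1.
exact: alg (merge _ x0) (merge _ y0) mergez J10 J40.
Qed.

(** The sign comes from the quasi-period $j(q^4u;q^4)=-u^{-1}j(u;q^4)$ at $u=x^2y^2$, applied to the
    theta function in [K11E]. *)
Lemma last_term (x y z : K) :
  `|q| < `|x| < 1 -> `|q| < `|y| < 1 -> `|q| < `|z| < 1 ->
  q / (x * y) * (Jprod q 4 ^+ 3 * theta (x ^+ 2 * y ^+ 2) (q ^+ 4)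
     / (theta (q ^+ 2 * x ^+ 2) (q ^+ 4) * theta (q ^+ 2 * y ^+ 2) (q ^+ 4)))
    * appell (- (q * z / (x * y))) (q ^+ 2) (- (x * y))
  = - (B4 q x y * lerch q (q * z) (q * (x * y))).
Proof.
move=> hx hy hz.
have x0 := annulus_neq0 hq hx; have y0 := annulus_neq0 hq hy.
have w0 : x * y != 0 by exact: mulf_neq0.
have hqz : `|q ^+ 2| < `|q * z| < 1.
  have [z1 z2] := andP hz; have [p0 _] := andP hq.
  by rewrite normrX (normrM q) expr2 ltr_pM2l// z1 mulr_ilt1.
rewrite (appell_lerch_shift hq w0 hqz) (JprodE hq (isT : 0 < 4)%N).
rewrite /B4 (K11E hq hx hy).
have w20 : x ^+ 2 * y ^+ 2 != 0 by rewrite mulf_neq0// expf_neq0.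
have -> : q ^+ 2 * y ^+ 2 * (q ^+ 2 * x ^+ 2) = q ^+ 4 * (x ^+ 2 * y ^+ 2) by ring.
rewrite (theta_px hq4 w20).
have alg (J t a b s l : K) :
    q / (x * y) * (J ^+ 3 * t / (a * b)) * (s^-1 * (x * y * l)) =
    - (q * x * y * (J ^+ 3 * (- (x ^+ 2 * y ^+ 2)^-1 * t) / (b * a)) * (x * y) / s * l).
  by rewrite !(invfM a) !(invfM b); move: a^-1 b^-1 s^-1 => *; field; rewrite x0 y0.
exact: alg.
Qed.

End Assembly.

Section ExtValue.
Variable R : realType.
Local Notation K := (cplx R).
Variable q : K.
Hypothesis hq : 0 < `|q| < 1.

(** The cancelled expression is continuous and agrees with the formula at all points of the domain
    near [t0], so it is the limit. The abstract parameter space lets both side terms, with [x] and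
    [y] exchanged, be treated at once. *)
Lemma ext_value_side (T : topologicalType) (a b c : T -> K) (t0 : T) :
  `|q| < `|a t0| < 1 -> `|q| < `|b t0| < 1 -> `|q| < `|c t0| < 1 ->
  a t @[t --> nbhs t0] --> a t0 -> b t @[t --> nbhs t0] --> b t0 -> c t @[t --> nbhs t0] --> c t0 ->
  ext_value [set t | b t * c t != - q] (fun t => side_formula q (a t) (b t) (c t)) t0
    (side_value q (a t0) (b t0) (c t0)).
Proof.
move=> ha hb hc ca cb cc.
have hbc := annulus_mul hb hc; have [n1 n2] := andP hbc.
have cbc : b t * c t @[t --> nbhs t0] --> b t0 * c t0 by exact: (cvgM cb cc).
split=> [|_] /=.
  by move=> hD; rewrite (side_formulaE hq _ (annulus_neq0 hq hb) (annulus_neq0 hq hc) hbc hD).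
have /cvgrPdist_lt h : side_value q (a t) (b t) (c t) @[t --> nbhs t0] -->
    side_value q (a t0) (b t0) (c t0).
  exact: (cvg_side_value hq (nbhs_pfilter t0) ha hb hc ca cb cc).
have b0 : 0 < `|b t0| by rewrite normr_gt0 (annulus_neq0 hq hb).
have c0 : 0 < `|c t0| by rewrite normr_gt0 (annulus_neq0 hq hc).
have FW : Filter (within [set t | b t * c t != - q] (nbhs t0)) by exact: within_filter.
apply: (@cvgrPdist_lt _ (cplx R) _ _ FW _ _).2 => e e0; rewrite near_withinE; near=> t => hD.
have bt : b t != 0 by rewrite -normr_gt0; near: t; exact: near_norm_gt _ cb b0.
have ct : c t != 0 by rewrite -normr_gt0; near: t; exact: near_norm_gt _ cc c0.
have bct : `|q ^+ 2| < `|b t * c t| < 1.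
  apply/andP; split; near: t; first exact: near_norm_gt _ cbc n1.
  exact: near_norm_lt _ cbc n2.
by rewrite (side_formulaE hq _ bt ct bct hD); near: t; exact: h.
Unshelve. all: by end_near.
Qed.

End ExtValue.

Theorem theorem1p4 (R : realType) (q x y z : cplx R)
  (hq : 0 < `|q| < 1)
  (hx0 : x != 0) (hy0 : y != 0) (hz0 : z != 0)
  (hx : `|q| < `|x| < 1) (hy : `|q| < `|y| < 1) (hz : `|q| < `|z| < 1) :
  exists A B : cplx R,
    [/\ ext_value
          [set p : cplx R * cplx R * cplx R | p.1.2 * p.2 != - q]
          (fun p : cplx R * cplx R * cplx R => let: (a, b, c) := p in
            c * (Jprod q 4 ^+ 3
                   * theta (q ^+ 2 * b ^+ 2 * c ^+ 2) (q ^+ 4)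
                 / (theta (q ^+ 2 * b ^+ 2) (q ^+ 4)
                    * theta (c ^+ 2) (q ^+ 4)))
              * appell (- (q * a / (b * c))) (q ^+ 2) (- (q * b * c)))
          (x, y, z) A,
        ext_value
          [set p : cplx R * cplx R * cplx R | p.1.1 * p.2 != - q]
          (fun p : cplx R * cplx R * cplx R => let: (a, b, c) := p in
            c * (Jprod q 4 ^+ 3
                   * theta (q ^+ 2 * a ^+ 2 * c ^+ 2) (q ^+ 4)
                 / (theta (q ^+ 2 * a ^+ 2) (q ^+ 4)
                    * theta (c ^+ 2) (q ^+ 4)))
              * appell (- (q * b / (a * c))) (q ^+ 2) (- (q * a * c)))
          (x, y, z) B
      & summability.partial_sum
          (fun p : int * int * int => let: (r, s, t) := p in
            if [&& sg r == sg s, sg s == sg t,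
                   (r == s %[mod 2])%Z & (s != t %[mod 2])%Z]
            then q ^ (r * s + r * t + s * t) * x ^ r * y ^ s * z ^ t
            else 0 : cplx R)
          @ summability.totally -->
        A + B
        - z * (Jprod q 1 ^+ 3 * Jprod q 2 ^+ 3
               / (theta x q * theta y q * theta z q))
            * (theta (x * y) (q ^+ 2) * theta (q * x * z) (q ^+ 2)
                 * theta (q * y * z) (q ^+ 2)
               / (theta (- (x * q)) (q ^+ 2) * theta (- (y * q)) (q ^+ 2)
                  * theta (- z) (q ^+ 2)))
        - q / (x * y)
            * (Jprod q 4 ^+ 3 * theta (x ^+ 2 * y ^+ 2) (q ^+ 4)
               / (theta (q ^+ 2 * x ^+ 2) (q ^+ 4)
                  * theta (q ^+ 2 * y ^+ 2) (q ^+ 4)))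
            * appell (- (q * z / (x * y))) (q ^+ 2) (- (x * y)) ].
Proof.
have cfst : p.1.1 @[p --> nbhs ((x, y), z)] --> x.
  by apply: cvg_comp; [exact: cvg_fst|exact: cvg_fst].
have csnd : p.1.2 @[p --> nbhs ((x, y), z)] --> y.
  by apply: cvg_comp; [exact: cvg_fst|exact: cvg_snd].
have cthd : p.2 @[p --> nbhs ((x, y), z)] --> z by exact: cvg_snd.
have [s E] := core_identity hq hx hy hz.
exists (side_value q x y z), (side_value q y x z); split.
- rewrite (_ : (fun p => _) = fun p : cplx R * cplx R * cplx R =>
    side_formula q p.1.1 p.1.2 p.2); last by apply/funext => -[[a b] c].
  exact: (ext_value_side hq (t0 := ((x, y), z)) hx hy hz cfst csnd cthd).
- rewrite (_ : (fun p => _) = fun p : cplx R * cplx R * cplx R =>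
    side_formula q p.1.2 p.1.1 p.2); last by apply/funext => -[[a b] c].
  exact: (ext_value_side hq (t0 := ((x, y), z)) hy hx hz csnd cfst cthd).
rewrite (triple_product_term hq _ _ _ hx hy hz) (last_term hq hx hy hz).
have h := tsum_cvg (absum_triple_term hq hx hy hz).
rewrite (triple_sum hq hx hy hz) in h.
(* What is left is [core_identity] divided by the clearing factor, which is nonzero for
   $|q|<|z|<1$. *)
rewrite (_ : _ - _ - _ = ev (lhs_coef q x y) z); first exact: h.
have tz := theta_sq_neq0 hq hz.
have hqz : `|q ^+ 2| < `|q * z| < 1.
  have [z1 z2] := andP hz; have [p0 p1] := andP hq.
  by rewrite normrX (normrM q) expr2 ltr_pM2l// z1 mulr_ilt1.
have tqz := theta_neq0 (norm_expr_lt1 hq (isT : 0 < 2)%N) hqz.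
move: E; rewrite /rhs_value /side_value.
have alg (c1 A B T S t1 t2 l1 l2 dY dX V D U : cplx R) : A != 0 -> B != 0 ->
   A * B * (V - D) = z * (c1 * A * (t1 * l1 / dY + t2 * l2 / dX) + - T * (t2 * t1)) ->
   z * (c1 * t1 * l1 / (dY * B)) + z * (c1 * t2 * l2 / (dX * B))
     - z * (T * (t2 * t1) / (A * B)) - - D = V.
  move=> A0 B0 e; rewrite -[V](subrK D) opprK; congr (_ + _).
  apply: (mulfI (mulf_neq0 A0 B0)); rewrite e (invfM dY) (invfM dX).
  by move: dX^-1 dY^-1 => *; field; rewrite A0 B0.
exact: alg.
Qed.
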